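(* Let $\mu$ be a positive regular Borel measure supported in the right half-plane $\mathbb C_+$, and let $1<p'\le q<\infty$, $p\le2$. Then the following are equivalent: 1. The Laplace--Carleson embedding $\mathcal L:L^p(0,\infty)\to L^q(\mathbb C_+,\mu)$, $f\mapsto\mathcal Lf$, is well-defined and bounded. 2. There exists a constant $C>0$ such that $\mu(Q_I)\le C|I|^{q/p'}$ for all intervals $I\subset i\mathbb R$. 3. There exists a constant $C>0$ such that $\|\mathcal Le^{-\cdot z}\|_{L^q(\mathbb C_+,\mu)}\le C\|e^{-\cdot z}\|_{L^p(0,\infty)}$ for all $z\in\mathbb C_+$.
   Context: $\mathbb C_+=\{\operatorname{Re}z>0\}$, $\mathcal Lf(s)=\int_0^\infty e^{-ts}f(t)\,dt$, and $p'$ is the conjugate exponent of $p$, $1/p+1/p'=1$. $e^{-\cdot z}$ denotes the function $t\mapsto e^{-tz}$ on $(0,\infty)$. For a bounded interval $I\subset i\mathbb R$ of length $|I|$, $Q_I=\{x+iy:iy\in I,\ 0<x<|I|\}$. *)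

(* Defs.v *)
From HB Require Import structures.
From mathcomp Require Import all_boot all_order all_algebra complex.
From mathcomp Require Import all_classical all_reals all_analysis.

Set Implicit Arguments.
Unset Strict Implicit.
Unset Printing Implicit Defensive.
Import Order.TTheory GRing.Theory Num.Theory.
Import numFieldNormedType.Exports.

Local Open Scope classical_set_scope.
Local Open Scope ring_scope.
Local Open Scope complex_scope.

(* The library's unqualified [Re] and [Im] have values in [R[i]], not in [R]. *)
Local Notation Re := complex.Re.
Local Notation Im := complex.Im.

(* [R[i]] has no topology of its own in the library: the one induced by the
   modulus is carried by the alias [R[i]^o]. *)
Notation borelC R := (g_sigma_algebraType (@open (R[i]^o))).

Definition right_half_plane (R : realType) : set R[i] := [set z | 0 < Re z].

Definition pos_halfline (R : realType) : set R := `]0, +oo[.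

Definition supported_in (R : realType) (mu : {measure set (borelC R) -> \bar R})
    (H : set R[i]) : Prop :=
  mu (~` H) = 0%E.

(* Outer regularity by open sets and inner regularity by compact sets.  Only
   the subsets of [H] are tested, so that for a measure supported in the open
   set [H] this is regularity of [mu] as a Borel measure on the space [H]: no
   finiteness of [mu] near the boundary of [H] is implied. *)
Definition regular_on (R : realType) (mu : {measure set (borelC R) -> \bar R})
    (H : set R[i]) : Prop :=
  forall E : set (borelC R), measurable E -> E `<=` H ->
    mu E = ereal_inf [set mu U | U in
             [set U : set (borelC R) | @open (R[i]^o) U /\ E `<=` U]] /\
    mu E = ereal_sup [set mu K | K in
             [set K : set (borelC R) | @compact (R[i]^o) K /\ K `<=` E]].

Definition cexp (R : realType) (z : R[i]) : R[i] :=
  (expR (Re z) * cos (Im z)) +i* (expR (Re z) * sin (Im z)).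

(* The L^p norm over [D] of a complex-valued function, as an extended real. *)
Definition cLnorm (d : measure_display) (T : measurableType d) (R : realType)
    (mu : {measure set T -> \bar R}) (D : set T) (p : R) (f : T -> R[i]) :
    \bar R :=
  'N[mu]_p%:E [(fun x => (Normc.normc (f x))%:E) \_ D]%E.

Definition in_cLp (d : measure_display) (T : measurableType d) (R : realType)
    (mu : {measure set T -> \bar R}) (D : set T) (p : R) (f : T -> R[i]) :
    Prop :=
  measurable_fun D (f : T -> borelC R) /\ (cLnorm mu D p f < +oo)%E.

Definition cintegrable (d : measure_display) (T : measurableType d)
    (R : realType) (mu : {measure set T -> \bar R}) (D : set T)
    (f : T -> R[i]) : Prop :=
  mu.-integrable D (fun x => (Re (f x))%:E) /\
  mu.-integrable D (fun x => (Im (f x))%:E).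

Definition cintegral (d : measure_display) (T : measurableType d)
    (R : realType) (mu : {measure set T -> \bar R}) (D : set T)
    (f : T -> R[i]) : R[i] :=
  (\int[mu]_(x in D) Re (f x)) +i* (\int[mu]_(x in D) Im (f x)).

Definition laplace_kernel (R : realType) (f : R -> R[i]) (s : R[i]) (t : R) :
    R[i] :=
  cexp (- (t%:C * s)) * f t.

Definition laplace (R : realType) (f : R -> R[i]) (s : R[i]) : R[i] :=
  cintegral (@lebesgue_measure R) (@pos_halfline R) (laplace_kernel f s).

Definition exp_fun (R : realType) (z : R[i]) (t : R) : R[i] :=
  cexp (- (t%:C * z)).

Definition laplace_well_defined (R : realType)
    (mu : {measure set (borelC R) -> \bar R}) (p q : R) : Prop :=
  forall f : R -> R[i],
    in_cLp (@lebesgue_measure R) (@pos_halfline R) p f ->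
    (forall s, @right_half_plane R s ->
       cintegrable (@lebesgue_measure R) (@pos_halfline R)
         (laplace_kernel f s)) /\
    in_cLp mu (@right_half_plane R) q (laplace f).

Definition laplace_bounded (R : realType)
    (mu : {measure set (borelC R) -> \bar R}) (p q : R) : Prop :=
  exists2 C : R, 0 < C &
    forall f : R -> R[i],
      in_cLp (@lebesgue_measure R) (@pos_halfline R) p f ->
      (cLnorm mu (@right_half_plane R) q (laplace f) <=
       C%:E * cLnorm (@lebesgue_measure R) (@pos_halfline R) p f)%E.

(* [Q_I] for the interval [I] of the imaginary axis with endpoints [i a] and
   [i b]; the booleans [l] and [r] select open or closed ends, as in
   [Interval (BSide l a) (BSide r b)]. *)
Definition carleson_square (R : realType) (l r : bool) (a b : R) : set R[i] :=
  [set z | Im z \in Interval (BSide l a) (BSide r b) /\ 0 < Re z < b - a].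

(* Main.v *)
Require Import Defs.
From HB Require Import structures.
From mathcomp Require Import all_boot all_order all_algebra complex.
From mathcomp Require Import all_classical all_reals all_analysis.
From mathcomp Require Import measurable_realfun ring lra.
Import Order.TTheory GRing.Theory Num.Theory.
Import numFieldNormedType.Exports.

(** The embedding implies the test on exponentials, which implies the bound on
    squares, which implies the embedding.

    The exponentials [exp (- t z)] belong to [L^p], so they may be tested.
    The transform of such an exponential at [s] is [1 / (z + s)]: for the square
    over the interval from [a] to [b], of side [d], the point [z = d - i a]
    makes its modulus at least [1 / (5 d)] on the whole square, while the norm of
    the exponential is [(p d)^(-1/p)].  This bounds the measure of the square by a
    multiple of [d^(q - q/p) = d^(q/p')].

    The converse is a Carleson embedding theorem.  Real and imaginary parts, and
    then positive and negative parts, reduce it to the functions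
    [F (x + i y) = \int exp (- x t) cos (y t + theta) g t dt] with [g >= 0] on
    the half-line, and one has to bound [\int |F|^(alpha p') dmu] by a multiple of
    [(\int g^p)^(alpha (p' - 1))], where [alpha = q / p' >= 1].
    Three facts carry the proof.
    - [F] is the Poisson integral of its boundary values [F_0] ([poisson_cosT]),
      and [\int F_0^2 <= 2 pi \int g^2] ([bessel_cosT]).
    - If the measure of a square of side [d] is at most [C d^alpha], then the
      Poisson integral of [h >= 0] exceeds [lambda] on a set of measure at most
      a multiple of [(\int h / lambda)^alpha] ([measure_poisson_gt]).  The set is
      covered by squares over intervals in which [h] has a large average, and
      Vitali's lemma makes these intervals disjoint; superadditivity of
      [x^alpha] makes it possible to sum the bounds.
    - A weak estimate at each height [lambda] for a part of the data that depends
      on [lambda] integrates to a strong one ([integral_powR_interpolation]).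
    Splitting [|F_0|] at the height [lambda / 2] and interpolating gives the
    embedding for [p = 2].  Splitting [g] itself and
    interpolating between this case and the trivial bound [|F| <= \int g] gives
    it for [1 < p < 2]: this is the Marcinkiewicz argument that also
    proves the Hausdorff-Young inequality. *)

Local Open Scope classical_set_scope.
Local Open Scope ring_scope.
Set Implicit Arguments.
Unset Strict Implicit.
Unset Printing Implicit Defensive.

(** * Translation and reflection of Lebesgue integrals *)

Section lebesgue_invariance.
Context {R : realType}.
Notation leb := (@lebesgue_measure R).
Local Open Scope ereal_scope.

Let measurable_shift (c : R) : measurable_fun [set: measurableTypeR R]
  (fun v : measurableTypeR R => (v + c)%R : measurableTypeR R).
Proof. exact: measurable_funD. Qed.

Lemma lebesgue_measure_shift (c : R) (A : set (measurableTypeR R)) : measurable A ->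
  pushforward leb (fun v : measurableTypeR R => (v + c)%R : measurableTypeR R) A = leb A.
Proof.
move=> mA.
pose phi : {mfun measurableTypeR R >-> measurableTypeR R} :=
  HB.pack (fun v : measurableTypeR R => (v + c)%R : measurableTypeR R)
    (isMeasurableFun.Build _ _ _ _ _ (measurable_shift c)).
apply/esym; rewrite (_ : (fun _ => _) = phi)//.
apply: lebesgue_measure_unique => // _ [[a b]] _ <-; rewrite /pushforward.
rewrite [RHS](_ : _ = leb `](a - c)%R, (b - c)%R]%classic); last first.
  congr (leb _).
  by apply/seteqP; split => x /=; rewrite !in_itv/= ltrBlDr lerBrDr.
rewrite !lebesgue_measure_itv/= !lte_fin ltrD2r; case: ifPn => // _.
by rewrite -!EFinD; congr EFin; ring.
Qed.

Lemma ge0_integral_shift (c : R) (f : R -> \bar R) :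
  measurable_fun setT f -> (forall v, 0 <= f v) ->
  \int[leb]_v f (v + c)%R = \int[leb]_v f v.
Proof.
move=> mf f0.
rewrite -[LHS](@ge0_integral_pushforward _ _ _ _ _
  (fun v : measurableTypeR R => (v + c)%R : measurableTypeR R) _ leb setT f)//.
pose phi : {mfun measurableTypeR R >-> measurableTypeR R} :=
  HB.pack (fun v : measurableTypeR R => (v + c)%R : measurableTypeR R)
    (isMeasurableFun.Build _ _ _ _ _ (measurable_shift c)).
rewrite (_ : (fun _ => _) = phi)//.
by apply: eq_measure_integral => //= A mA _; exact: lebesgue_measure_shift.
Qed.

Lemma ge0_integral_opp (f : R -> \bar R) :
  measurable_fun setT f -> (forall v, 0 <= f v) ->
  \int[leb]_v f (- v)%R = \int[leb]_v f v.
Proof.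
move=> mf f0.
rewrite -[LHS](@ge0_integral_pushforward _ _ _ _ _
  (-%R : measurableTypeR R -> measurableTypeR R) _ leb setT f)//.
by apply: eq_measure_integral => //= A mA _; exact: lebesgue_measureN.
Qed.

Lemma integral_shift (c : R) (f : R -> \bar R) : measurable_fun setT f ->
  \int[leb]_v f (v + c)%R = \int[leb]_v f v.
Proof.
move=> mf; rewrite integralE [RHS]integralE.
rewrite (funepos_comp f (fun v => v + c)%R) (funeneg_comp f (fun v => v + c)%R)/=.
by rewrite !ge0_integral_shift//; [exact: measurable_funeneg|exact: measurable_funepos].
Qed.

Lemma integral_opp (f : R -> \bar R) : measurable_fun setT f ->
  \int[leb]_v f (- v)%R = \int[leb]_v f v.
Proof.
move=> mf; rewrite integralE [RHS]integralE.
rewrite funepos_comp funeneg_comp/=.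
by rewrite !ge0_integral_opp//; [exact: measurable_funeneg|exact: measurable_funepos].
Qed.

End lebesgue_invariance.

(** * Real-valued integrals *)

Section rint.
Context d (T : measurableType d) {R : realType} (m : {measure set T -> \bar R}).

Lemma EFin_Rintegral (D : set T) (f : T -> R) : measurable D ->
  m.-integrable D (EFin \o f) ->
  (\int[m]_(x in D) f x)%:E = (\int[m]_(x in D) (f x)%:E)%E.
Proof. by move=> mD fi; rewrite fineK//; exact: integrable_fin_num. Qed.

Lemma RintegralP (D : set T) (f : T -> R) (a : R) :
  (\int[m]_(x in D) (f x)%:E)%E = a%:E -> \int[m]_(x in D) f x = a.
Proof. by rewrite /Rintegral => ->. Qed.

Lemma integrable_ge0 (D : set T) (f : T -> R) (a : R) :
  measurable_fun D f -> (forall x, D x -> 0 <= f x) ->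
  (\int[m]_(x in D) (f x)%:E)%E = a%:E -> m.-integrable D (EFin \o f).
Proof.
move=> mf f0 fE; apply/integrableP; split; first exact/measurable_EFinP.
under eq_integral => x /[!inE] xD do rewrite /= ger0_norm ?f0//.
by rewrite fE ltry.
Qed.

Lemma le_integrableR (D : set T) (f g : T -> R) : measurable D ->
  measurable_fun D f -> (forall x, D x -> `|f x| <= g x) ->
  m.-integrable D (EFin \o g) -> m.-integrable D (EFin \o f).
Proof.
move=> mD mf fg; apply: le_integrable => //; first exact/measurable_EFinP.
by move=> x Dx /=; rewrite lee_fin (le_trans (fg _ Dx))// ler_norm.
Qed.

Lemma integrableRD (D : set T) (f g : T -> R) : measurable D ->
  m.-integrable D (EFin \o f) -> m.-integrable D (EFin \o g) ->
  m.-integrable D (fun x => (f x + g x)%:E).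
Proof. by move=> mD fi gi; exact: (integrableD mD fi gi). Qed.

Lemma integrableRZl (D : set T) (k : R) (f : T -> R) : measurable D ->
  m.-integrable D (EFin \o f) -> m.-integrable D (fun x => (k * f x)%:E).
Proof. by move=> mD fi; exact: (integrableZl mD k fi). Qed.

End rint.

(** * Laplace transforms of trigonometric functions *)

Section expcos.
Context {R : realType}.
Notation leb := (@lebesgue_measure R).

Lemma cvg_expR_neg (d : R) : 0 < d -> expR (- d * x) @[x --> +oo] --> (0 : R).
Proof.
move=> d0; rewrite (_ : (fun x => expR (- d * x)) =
               (fun z => expR (- z)) \o (fun z => d * z)); last first.
  by apply: eq_fun => x; rewrite mulNr.
apply: (@cvg_comp _ _ _ _ _ _ (pinfty_nbhs R)); last exact: cvgr_expR.
exact: gt0_cvgMry.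
Qed.

Lemma continuous_expRM (d : R) : continuous (fun v : R => expR (d * v)).
Proof.
move=> x; apply: continuous_comp; last exact: continuous_expR.
exact: mulrl_continuous.
Qed.

Lemma integral_expR_half (d : R) : 0 < d ->
  (\int[leb]_(v in `[0%R, +oo[) (expR (- d * v))%:E)%E = (d^-1)%:E.
Proof.
move=> d0.
rewrite (@ge0_continuous_FTC2y _ _ (fun v => - (d^-1 * expR (- d * v))) _ 0).
- by rewrite mulr0 expR0 mulr1 EFinN sub0e oppeK.
- by move=> x _; exact: expR_ge0.
- apply: continuous_subspaceT => x; apply: continuous_comp; last exact: continuous_expR.
  exact: mulrl_continuous.
- rewrite -oppr0 -[X in nbhs (- X)](mulr0 d^-1); apply: cvgN; apply: cvgMr.
  exact: cvg_expR_neg.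
- by move=> x _; exact: ex_derive.
- apply: cvg_at_right_filter; apply: cvgN; apply: cvgMr.
  apply: continuous_comp; last exact: continuous_expR.
  exact: mulrl_continuous.
- move=> x _; rewrite derive1E derive_val /=.
  rewrite /GRing.scale/=; field; exact: lt0r_neq0.
Qed.

Lemma continuous_cosM (a phi : R) : continuous (fun v : R => cos (v * a + phi)).
Proof.
move=> x; apply: continuous_comp; last exact: continuous_cos.
by apply: cvgD; [exact: mulrr_continuous|exact: cvg_cst].
Qed.

(** The summand 1 makes the integrand nonnegative, as the fundamental theorem
    of calculus on an unbounded interval asks for. *)
Lemma integral_expR1cos_half (d a phi : R) : 0 < d ->
  (\int[leb]_(v in `[0%R, +oo[) (expR (- d * v) * (1 + cos (v * a + phi)))%:E)%E =
  (d^-1 + (d * cos phi - a * sin phi) / (d ^+ 2 + a ^+ 2))%:E.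
Proof.
move=> d0.
have da0 : 0 < d ^+ 2 + a ^+ 2 by rewrite ltr_pwDl ?sqr_ge0// exprn_gt0.
pose B v := - d^-1 + (a * sin (v * a + phi) - d * cos (v * a + phi)) / (d ^+ 2 + a ^+ 2).
pose F v := expR (- d * v) * B v.
have dF (x : R) : is_derive x 1 F (expR (- d * x) * (1 + cos (x * a + phi))).
  rewrite /F /B; apply: is_derive_eq.
  rewrite /GRing.scale/=; field.
  by rewrite (gt_eqF d0) (gt_eqF da0).
have cF : continuous F.
  by move=> x; apply: differentiable_continuous; apply/derivable1_diffP; exact: ex_derive.
rewrite (@ge0_continuous_FTC2y _ _ F _ 0).
- transitivity ((0 - F 0)%:E) => //; congr EFin.
  rewrite /F /B mulr0 expR0 mul1r mul0r !add0r.
  by field; rewrite (gt_eqF d0) (gt_eqF da0).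
- by move=> x _; rewrite mulr_ge0 ?expR_ge0//.
- apply: continuous_subspaceT => x.
  apply: cvgM; first exact: continuous_expRM.
  by apply: cvgD; [exact: cvg_cst|exact: continuous_cosM].
- pose M := d^-1 + (`|a| + d) / (d ^+ 2 + a ^+ 2).
  have BM v : `|B v| <= M.
    rewrite /B /M (le_trans (ler_normD _ _))// normrN lerD//.
      by rewrite gtr0_norm// invr_gt0.
    rewrite normrM (gtr0_norm (x := _^-1)) ?invr_gt0// ler_wpM2r ?invr_ge0 ?(ltW da0)//.
    rewrite (le_trans (ler_normB _ _))// !normrM (gtr0_norm d0) lerD//.
      by rewrite ler_piMr// ler_norml sin_geN1 sin_le1.
    by rewrite ler_piMr ?(ltW d0)// ler_norml cos_geN1 cos_le1.
  have EM : expR (- d * v) * M @[v --> +oo] --> (0 : R).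
    have : expR (- d * v) * M @[v --> +oo] --> 0 * M.
      by apply: cvgM; [exact: cvg_expR_neg|exact: cvg_cst].
    by rewrite mul0r.
  apply: (@squeeze_cvgr _ _ _ _ (fun v => - (expR (- d * v) * M)) (fun v => expR (- d * v) * M)).
  + apply: nearW => v; rewrite -ler_norml /F normrM (ger0_norm (expR_ge0 _)).
    by rewrite ler_wpM2l ?expR_ge0.
  + by rewrite -oppr0; exact: cvgN.
  + exact: EM.
- by move=> x _; exact: ex_derive.
- by apply: cvg_at_right_filter; exact: cF.
- by move=> x _; rewrite derive1E derive_val.
Qed.

Lemma integrable_expR_half (d : R) : 0 < d ->
  leb.-integrable `[0, +oo[ (fun v => (expR (- d * v))%:E).
Proof.
move=> d0; apply: (integrable_ge0 _ _ (integral_expR_half d0)).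
  by apply: measurable_funTS; apply: continuous_measurable_fun; exact: continuous_expRM.
by move=> x _; exact: expR_ge0.
Qed.

Lemma integral_expRcos_half (d a phi : R) : 0 < d ->
  leb.-integrable `[0, +oo[ (fun v => (expR (- d * v) * cos (v * a + phi))%:E) /\
  \int[leb]_(v in `[0, +oo[) (expR (- d * v) * cos (v * a + phi)) =
  (d * cos phi - a * sin phi) / (d ^+ 2 + a ^+ 2).
Proof.
move=> d0.
have mc : measurable_fun (setT : set R) (fun v => expR (- d * v) * cos (v * a + phi)).
  apply: measurable_funM; apply: continuous_measurable_fun; first exact: continuous_expRM.
  exact: continuous_cosM.
have ic : leb.-integrable `[0, +oo[ (fun v => (expR (- d * v) * cos (v * a + phi))%:E).
  apply: (le_integrableR _ _ _ (integrable_expR_half d0)) => //.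
    exact: measurable_funTS.
  move=> x _; rewrite normrM (ger0_norm (expR_ge0 _)) ler_piMr ?expR_ge0//.
  by rewrite ler_norml cos_geN1 cos_le1.
split => //.
have := integral_expR1cos_half a phi d0 => /RintegralP.
under eq_Rintegral do rewrite mulrDr mulr1.
rewrite RintegralD//; last exact: integrable_expR_half.
rewrite (RintegralP (integral_expR_half d0)).
by move/addrI.
Qed.

Lemma ge0_integral_half (f : R -> \bar R) : measurable_fun setT f ->
  (forall v, 0 <= f v)%E ->
  (\int[leb]_v f v = \int[leb]_(v in `[0%R, +oo[) f v
                     + \int[leb]_(v in `[0%R, +oo[) f (- v)%R)%E.
Proof.
move=> mf f0.
have mfN : measurable_fun setT (fun v : R => f (- v)%R).
  exact: (measurableT_comp mf).
rewrite -(setUv `[0, +oo[%classic) ge0_integral_setU//=; last 3 first.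
- by apply: measurableC; exact: measurable_itv.
- by rewrite setUv.
- exact/disj_setPCl.
congr (_ + _)%E.
rewrite setCitvr -[RHS]integral_itv_obnd_cbnd; last exact: measurable_funTS.
rewrite integral_mkcond -ge0_integral_opp; last 2 first.
- by apply/(measurable_restrictT _ _).1 => //; exact: measurable_funTS.
- by move=> v; rewrite patchE; case: ifPn.
rewrite [RHS]integral_mkcond; apply: eq_integral => v _.
by rewrite !patchE !mem_setE !in_itv/= andbT oppr_lt0.
Qed.

Lemma Rintegral_half (f : R -> R) : measurable_fun setT f ->
  leb.-integrable `[0%R, +oo[ (fun v => (f v)%:E) ->
  leb.-integrable `[0%R, +oo[ (fun v => (f (- v))%:E) ->
  leb.-integrable setT (EFin \o f) /\
  \int[leb]_v f v = \int[leb]_(v in `[0, +oo[) f v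
                     + \int[leb]_(v in `[0, +oo[) f (- v).
Proof.
move=> mf i1 i2.
have mfE : measurable_fun setT (EFin \o f) by exact/measurable_EFinP.
split.
  apply/integrableP; split => //.
  rewrite ge0_integral_half//; last exact: measurableT_comp.
  by apply: lte_add_pinfty; [case/integrableP : i1|case/integrableP : i2].
rewrite /Rintegral integralE.
rewrite ge0_integral_half//; last exact: measurable_funepos.
rewrite [X in (_ - X)%E]ge0_integral_half//; last exact: measurable_funeneg.
rewrite [X in _ = fine X + _]integralE [X in _ = _ + fine X]integralE.
have mI : measurable (`[0%R, +oo[%classic : set (measurableTypeR R)) by exact: measurable_itv.
have := integrable_pos_fin_num mI i1.
have := integrable_neg_fin_num mI i1.
have := integrable_pos_fin_num mI i2.
have := integrable_neg_fin_num mI i2.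
rewrite (funepos_comp (EFin \o f) -%R) (funeneg_comp (EFin \o f) -%R)/=.
move=> /fineK <- /fineK <- /fineK <- /fineK <-/=.
ring.
Qed.

Lemma integral_expRcos (d a phi : R) : 0 < d ->
  leb.-integrable setT (fun v => (expR (- d * `|v|) * cos (v * a + phi))%:E) /\
  \int[leb]_v (expR (- d * `|v|) * cos (v * a + phi)) =
  2 * cos phi * (d / (d ^+ 2 + a ^+ 2)).
Proof.
move=> d0.
have mf : measurable_fun setT (fun v : R => expR (- d * `|v|) * cos (v * a + phi)).
  apply: measurable_funM.
    apply: (@measurableT_comp _ _ _ _ _ _ (fun v => expR (- d * v))).
      by apply: continuous_measurable_fun; exact: continuous_expRM.
    by apply: continuous_measurable_fun; exact: norm_continuous.
  by apply: continuous_measurable_fun; exact: continuous_cosM.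
have [i1 e1] := integral_expRcos_half a phi d0.
have [i2 e2] := integral_expRcos_half (- a) phi d0.
have E1 v : v \in `[0, +oo[%classic -> expR (- d * `|v|) * cos (v * a + phi) =
    expR (- d * v) * cos (v * a + phi).
  by rewrite inE/= in_itv/= andbT => v0; rewrite ger0_norm.
have E2 v : v \in `[0, +oo[%classic -> expR (- d * `|- v|) * cos (- v * a + phi) =
    expR (- d * v) * cos (v * - a + phi).
  by rewrite inE/= in_itv/= andbT => v0; rewrite normrN ger0_norm// (_ : - v * a = v * - a)//; ring.
have [||i3 ->] := Rintegral_half mf.
- by apply: eq_integrable i1 => // v /E1 ->.
- by apply: eq_integrable i2 => // v /E2 ->.
split => //.
under eq_Rintegral => v vI do rewrite (E1 v vI).
under [X in _ + X = _]eq_Rintegral => v vI do rewrite (E2 v vI).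
have da0 : d ^+ 2 + a ^+ 2 != 0 by rewrite gt_eqF// ltr_pwDl ?sqr_ge0// exprn_gt0.
by rewrite e1 e2 sqrrN; field.
Qed.

Lemma integral_expR_abs (d : R) : 0 < d ->
  leb.-integrable setT (fun v => (expR (- d * `|v|))%:E).
Proof.
move=> d0; have [+ _] := integral_expRcos 0 0 d0.
by apply: eq_integrable => // v _; rewrite mulr0 addr0 cos0 mulr1.
Qed.

End expcos.

(** * The Poisson kernel *)

Section poisson_kernel.
Context {R : realType}.
Notation leb := (@lebesgue_measure R).

(** The Poisson kernel of the half plane, normalised to have mass [pi]. *)
Definition poisson (d u : R) : R := d / (d ^+ 2 + u ^+ 2).

Lemma poisson_denom_gt0 (d u : R) : 0 < d -> 0 < d ^+ 2 + u ^+ 2.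
Proof. by move=> d0; rewrite ltr_pwDl ?sqr_ge0// exprn_gt0. Qed.

Lemma poisson_ge0 (d u : R) : 0 < d -> 0 <= poisson d u.
Proof. by move=> d0; rewrite divr_ge0 ?ltW// poisson_denom_gt0. Qed.

Lemma poissonN (d u : R) : poisson d (- u) = poisson d u.
Proof. by rewrite /poisson sqrrN. Qed.

Lemma continuous_poisson (d : R) : 0 < d -> continuous (poisson d).
Proof.
move=> d0 u; apply: cvgM; first exact: cvg_cst.
apply: cvgV; first by rewrite gt_eqF// poisson_denom_gt0.
by apply: cvgD; [exact: cvg_cst|exact: exprn_continuous].
Qed.

Lemma measurable_poisson (d : R) : 0 < d -> measurable_fun setT (poisson d).
Proof. by move=> d0; exact: continuous_measurable_fun (continuous_poisson d0). Qed.

Lemma integral_oneDsqrV : (\int[leb]_v ((oneDsqr v)^-1)%:E = pi%:E)%E.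
Proof.
rewrite ge0_symfun_integralT; last 3 first.
- by move=> x; rewrite invr_ge0 ltW// (lt_le_trans _ (oneDsqr_ge1 x)).
- exact: continuous_oneDsqrV.
- by move=> x /=; rewrite /oneDsqr sqrrN.
rewrite -set_itvcy integral0y_oneDsqr -EFinM; congr EFin.
by rewrite mulrC divfK.
Qed.

(** The rescaling [u = d w + a]. *)
Lemma integral_poisson_subst (d a : R) (f : R -> R) : 0 < d -> continuous f ->
  (forall v, 0 <= f v) ->
  (\int[leb]_v (f v * poisson d (v - a))%:E =
   \int[leb]_w (f (d * w + a) / oneDsqr w)%:E)%E.
Proof.
move=> d0 cf f0.
pose F (w : R) := d * w + a.
have F1 : F^`()%classic = cst d.
  apply/funext => w; rewrite derive1E /F derive_val.
  by rewrite /GRing.scale/= mulr1 addr0.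
rewrite (@increasing_ge0_integration_by_substitutionT _ F).
- apply: eq_integral => w _; rewrite F1 /F/=; congr EFin.
  rewrite !fctE/= /poisson /oneDsqr addrK.
  have w0 : 1 + w ^+ 2 != 0 by rewrite gt_eqF// ltr_pwDl ?sqr_ge0.
  have -> : d ^+ 2 + (d * w) ^+ 2 = d ^+ 2 * (1 + w ^+ 2) by ring.
  by field; rewrite (gt_eqF d0) w0.
- by move=> x y xy; rewrite /F ltrD2r ltr_pM2l.
- by rewrite F1 => ?; exact: cvg_cst.
- by rewrite F1; exact: is_cvg_cst.
- by rewrite F1; exact: is_cvg_cst.
- by move=> x; exact: ex_derive.
- apply: (@cvg_comp _ _ _ ( *%R d) (fun w => w + a) _ (ninfty_nbhs R)); last exact: cvg_addrr_Ny.
  by apply: gt0_cvgMrNy => //; exact: cvg_id.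
- apply: (@cvg_comp _ _ _ ( *%R d) (fun w => w + a) _ (pinfty_nbhs R)); last exact: cvg_addrr.
  by apply: gt0_cvgMry => //; exact: cvg_id.
- move=> v; apply: cvgM; first exact: cf.
  apply: (@continuous_comp _ _ _ (fun x => x - a) (poisson d)); last exact: continuous_poisson.
  by apply: cvgB; [exact: cvg_id|exact: cvg_cst].
- by move=> v; rewrite mulr_ge0// poisson_ge0.
Qed.

Lemma integral_poisson (d a : R) : 0 < d ->
  (\int[leb]_v (poisson d (v - a))%:E = pi%:E)%E.
Proof.
move=> d0; under eq_integral do rewrite -[poisson _ _]mul1r.
rewrite (@integral_poisson_subst d a (cst 1))//; last exact: cst_continuous.
by under eq_integral do rewrite /= mul1r; rewrite integral_oneDsqrV.
Qed.

Lemma integrable_poisson (d a : R) : 0 < d ->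
  leb.-integrable setT (fun v => (poisson d (v - a))%:E).
Proof.
move=> d0; apply: (integrable_ge0 _ _ (integral_poisson a d0)).
  apply: (measurableT_comp (measurable_poisson d0)).
  exact: measurable_funB.
by move=> v _; exact: poisson_ge0.
Qed.

End poisson_kernel.

(** * Parametric and iterated integrals *)

Section iterated.
Context {R : realType}.
Notation leb := (@lebesgue_measure R).
Notation T := (measurableTypeR R).

Lemma measurable_continuous_comp d (U : measurableType d) (h : R -> R) (f : U -> R) :
  continuous h -> measurable_fun setT f -> measurable_fun setT (fun x => h (f x)).
Proof.
move=> ch mf; apply: (measurableT_comp _ mf).
exact: continuous_measurable_fun.
Qed.

Lemma measurable_Rintegral d (U : measurableType d) (f : U -> R -> R) :
  measurable_fun setT (fun z : U * T => f z.1 z.2) ->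
  measurable_fun setT (fun x => \int[leb]_y f x y).
Proof.
move=> mf; have mfE : measurable_fun setT (fun z : U * T => (f z.1 z.2)%:E).
  exact/measurable_EFinP.
rewrite /Rintegral; apply: (@measurableT_comp _ _ _ _ _ _ (@fine R)) => //.
pose F := fun z : U * T => (f z.1 z.2)%:E.
rewrite (_ : (fun x => _) = (fun x => \int[leb]_y F^\+ (x, y)) \-
                            (fun x => \int[leb]_y F^\- (x, y)))%E; last first.
  apply/funext => x; rewrite -[LHS]/(\int[leb]_y F (x, y))%E [LHS]integralE.
  under eq_integral do rewrite funepos_comp/=.
  by under [X in (_ - X)%E = _]eq_integral do rewrite funeneg_comp/=.
by apply: emeasurable_funB; apply: measurable_fun_fubini_tonelli_F => //;
  [exact: measurable_funepos|exact: measurable_funeneg].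
Qed.

Lemma Rintegral_swap (f : R -> R -> R) (a b : R -> R) :
  measurable_fun setT (fun z : T * T => f z.1 z.2) ->
  leb.-integrable setT (EFin \o a) -> leb.-integrable setT (EFin \o b) ->
  (forall x, 0 <= a x) -> (forall y, 0 <= b y) ->
  (forall x y, `|f x y| <= a x * b y) ->
  \int[leb]_x \int[leb]_y f x y = \int[leb]_y \int[leb]_x f x y.
Proof.
move=> mf ia ib a0 b0 fab.
have mfE : measurable_fun setT (fun z : T * T => (f z.1 z.2)%:E).
  exact/measurable_EFinP.
have mx x : measurable_fun (setT : set T) (f x).
  exact: (measurable_fun_pair2 x mf).
have my y : measurable_fun (setT : set T) (fun x => f x y).
  exact: (measurable_fun_pair1 y mf).
have ix x : leb.-integrable setT (EFin \o f x).
  apply: (@le_integrableR _ T R leb setT (f x) (fun y => a x * b y)) => //.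
  exact: (integrableZl _ (a x) ib).
have iy y : leb.-integrable setT (EFin \o f^~ y).
  apply: (@le_integrableR _ T R leb setT (f^~ y) (fun x => a x * b y)) => //.
  by apply: eq_integrable (integrableZr _ (b y) ia).
have ii : (leb \x leb)%E.-integrable setT (fun z : T * T => (f z.1 z.2)%:E).
  apply/(integrable12ltyP _ _ mfE).
  apply: (@le_lt_trans _ _ (\int[leb]_x \int[leb]_y ((a x)%:E * (b y)%:E))%E).
    apply: ge0_le_integral => //.
    - by move=> x _; apply: integral_ge0.
    - apply: (@measurable_fun_fubini_tonelli_F _ _ _ _ _ leb (fun z : T * T => `|(f z.1 z.2)%:E|%E)) => //.
      exact: measurableT_comp.
    - rewrite (_ : (fun x => _) = (fun x => (a x)%:E * \int[leb]_y (b y)%:E)%E); last first.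
        by apply/funext => x; rewrite integralZl.
      apply: emeasurable_funM; last exact: measurable_cst.
      by case/integrableP : ia.
    - move=> x _; apply: ge0_le_integral => //.
      + by apply: measurableT_comp => //; apply/measurable_EFinP; exact: mx.
      + apply: emeasurable_funM; first exact: measurable_cst.
        by case/integrableP : ib.
      + by move=> y _; rewrite -EFinM lee_fin.
  under eq_integral do rewrite integralZl//.
  rewrite -(fineK (integrable_fin_num _ ib))//.
  rewrite integralZr// -(fineK (integrable_fin_num _ ia))//.
  by rewrite -EFinM ltry.
rewrite [LHS]/Rintegral [RHS]/Rintegral; congr fine.
transitivity (\int[leb]_x \int[leb]_y (f x y)%:E)%E.
  by apply: eq_integral => x _; rewrite EFin_Rintegral.
rewrite (Fubini ii); apply: eq_integral => y _.
by rewrite (EFin_Rintegral _ (iy y)).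
Qed.

Lemma Rintegral_dominated_cvg d (U : measurableType d) (m : {measure set U -> \bar R})
    (D : set U) (f_ : nat -> U -> R) (f g : U -> R) : measurable D ->
  (forall n, measurable_fun D (f_ n)) -> measurable_fun D f ->
  (forall x, D x -> f_ n x @[n --> \oo] --> f x) ->
  m.-integrable D (EFin \o g) ->
  (forall n x, D x -> `|f_ n x| <= g x) ->
  \int[m]_(x in D) f_ n x @[n --> \oo] --> \int[m]_(x in D) f x.
Proof.
move=> mD mf_ mf ff ig fg.
have [] := @dominated_convergence _ _ _ m D mD (fun n x => (f_ n x)%:E)
  (EFin \o f) (EFin \o g).
- by move=> n; exact/measurable_EFinP.
- exact/measurable_EFinP.
- by apply: aeW => x Dx; apply: cvg_EFin; [exact: nearW|exact: ff].
- by [].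
- by apply: aeW => x n Dx; rewrite /= lee_fin; exact: fg.
move=> i_f _ cf; rewrite /Rintegral; apply: fine_cvg.
by rewrite fineK//; exact: integrable_fin_num.
Qed.

End iterated.

(** * The Fourier transform of the Poisson kernel *)

Section cosine_transform.
Context {R : realType}.
Notation leb := (@lebesgue_measure R).
Notation T := (measurableTypeR R).

Lemma cosM_half (A B : R) : cos A * cos B = 2^-1 * (cos (A + B) + cos (A - B)).
Proof. by rewrite cosD cosB; field. Qed.

Lemma normr_cos_le1 (x : R) : `|cos x| <= 1.
Proof. by rewrite ler_norml cos_geN1 cos_le1. Qed.

(** The kernel is itself the transform of [exp (- x |u|)], so its own transform
    is a Fourier inversion.  The damping factor [exp (- d |v|)] makes the double
    integral absolutely convergent; integrating first in [v] turns it into a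
    Poisson kernel of parameter [d]. *)
Lemma damped_poisson_fourier (d x t phi : R) : 0 < d -> 0 < x ->
  \int[leb]_v (expR (- d * `|v|) * (poisson x v * cos (v * t + phi))) =
  cos phi * \int[leb]_u (expR (- x * `|u|) * poisson d (u - t)).
Proof.
move=> d0 x0.
have PE v : poisson x v = 2^-1 * \int[leb]_u (expR (- x * `|u|) * cos (u * v + 0)).
  have [_ ->] := integral_expRcos v 0 x0.
  by rewrite cos0 mulr1 mulKf.
pose f v u := 2^-1 * expR (- d * `|v|) * cos (v * t + phi) * (expR (- x * `|u|) * cos (u * v + 0)).
have mabs (c : R) : measurable_fun (setT : set T) (fun v : R => expR (- c * `|v|)).
  apply: (measurable_continuous_comp (h := fun v => expR (- c * v))); first exact: continuous_expRM.
  by apply: continuous_measurable_fun; exact: norm_continuous.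
have -> : \int[leb]_v (expR (- d * `|v|) * (poisson x v * cos (v * t + phi))) =
   \int[leb]_v \int[leb]_u f v u.
  apply: eq_Rintegral => v _; rewrite PE /f.
  rewrite RintegralZl//; last exact: (integral_expRcos v 0 x0).1.
  by ring.
rewrite (@Rintegral_swap _ f (fun v => expR (- d * `|v|)) (fun u => expR (- x * `|u|)))//;
  last first.
- move=> v u; rewrite /f !normrM !(ger0_norm (expR_ge0 _)) ger0_norm ?invr_ge0//.
  rewrite -!mulrA [in leLHS]mulrCA ler_wpM2l ?expR_ge0// mulrCA.
  rewrite (_ : _ * _ = expR (- x * `|u|) *
    (2^-1 * (`|cos (v * t + phi)| * `|cos (u * v + 0)|))); last by ring.
  rewrite ler_piMr ?expR_ge0//.
  have := normr_cos_le1 (v * t + phi); have := normr_cos_le1 (u * v + 0).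
  have := normr_ge0 (cos (v * t + phi)); have := normr_ge0 (cos (u * v + 0)).
  by nra.
- exact: integral_expR_abs.
- exact: integral_expR_abs.
- rewrite /f; apply: measurable_funM.
    apply: measurable_funM; last first.
      apply: (measurable_continuous_comp (h := fun v => cos (v * t + phi))).
        exact: continuous_cosM.
      exact: measurable_fst.
    apply: measurable_funM; first exact: measurable_cst.
    exact: (measurableT_comp (mabs d) measurable_fst).
  apply: measurable_funM.
    exact: (measurableT_comp (mabs x) measurable_snd).
  apply: (measurable_continuous_comp (h := cos)); first exact: continuous_cos.
  apply: measurable_funD; last exact: measurable_cst.
  by apply: measurable_funM; [exact: measurable_snd|exact: measurable_fst].
have fE u : \int[leb]_v f v u =
    2^-1 * (cos phi * (expR (- x * `|u|) * poisson d (u + t))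
            + cos phi * (expR (- x * `|u|) * poisson d (u - t))).
  have [i1 e1] := integral_expRcos (t + u) phi d0.
  have [i2 e2] := integral_expRcos (t - u) phi d0.
  transitivity (\int[leb]_v (4^-1 * expR (- x * `|u|) *
     (expR (- d * `|v|) * cos (v * (t + u) + phi) + expR (- d * `|v|) * cos (v * (t - u) + phi)))).
    apply: eq_Rintegral => v _; rewrite /f.
    transitivity (2^-1 * expR (- d * `|v|) * expR (- x * `|u|) * (cos (v * t + phi) * cos (u * v + 0))).
      by ring.
    rewrite cosM_half.
    have -> : v * t + phi + (u * v + 0) = v * (t + u) + phi by ring.
    have -> : v * t + phi - (u * v + 0) = v * (t - u) + phi by ring.
    by field.
  rewrite RintegralZl//; last exact: integrableRD.
  rewrite RintegralD// e1 e2 /poisson.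
  rewrite -(sqrrN (u - t)) opprB (addrC u t); field.
  by rewrite !gt_eqF// ltr_pwDl ?sqr_ge0// exprn_gt0.
under eq_Rintegral do rewrite fE.
have bP (s u : R) : `|expR (- x * `|u|) * poisson d (u + s)| <= d^-1 * expR (- x * `|u|).
  rewrite normrM (ger0_norm (expR_ge0 _)) ger0_norm ?poisson_ge0// mulrC.
  rewrite ler_wpM2r ?expR_ge0// /poisson ler_pdivrMr ?poisson_denom_gt0//.
  by rewrite expr2 mulrDr mulrA mulVf ?gt_eqF// mul1r lerDl mulr_ge0 ?sqr_ge0// invr_ge0 ltW.
have iP (s : R) : leb.-integrable setT (EFin \o (fun u => expR (- x * `|u|) * poisson d (u + s))).
  apply: (@le_integrableR _ T R leb setT _ (fun u => d^-1 * expR (- x * `|u|))) => //.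
    apply: measurable_funM => //.
    apply: (measurableT_comp (measurable_poisson d0)).
    exact: measurable_funD.
  exact: (integrableRZl d^-1 measurableT (integral_expR_abs x0)).
rewrite RintegralZl//; last first.
  by apply: integrableRD => //; apply: integrableRZl.
rewrite RintegralD//; [|by apply: integrableRZl => //; exact: (iP t)|by apply: integrableRZl => //; exact: (iP (- t))].
rewrite !RintegralZl//.
have -> : \int[leb]_u (expR (- x * `|u|) * poisson d (u + t)) =
          \int[leb]_u (expR (- x * `|u|) * poisson d (u - t)).
  rewrite /Rintegral -integral_opp; last first.
    by have /integrableP[] := iP t.
  congr fine; apply: eq_integral => u _; rewrite normrN -[poisson d (_ - _)]poissonN.
  by rewrite opprB addrC.
by field.
Qed.

Lemma integrable_oneDsqrV : leb.-integrable setT (fun v => ((oneDsqr v)^-1)%:E).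
Proof.
apply: (integrable_ge0 _ _ integral_oneDsqrV).
  by apply: continuous_measurable_fun; exact: continuous_oneDsqrV.
by move=> v _; rewrite invr_ge0 ltW// (lt_le_trans _ (oneDsqr_ge1 v)).
Qed.

(** After the rescaling [u = d w + t] the kernel no longer depends on [d], and
    dominated convergence applies. *)
Lemma poisson_approx_identity (x t : R) : 0 < x ->
  \int[leb]_u (expR (- x * `|u|) * poisson (n.+1%:R)^-1 (u - t)) @[n --> \oo] -->
  pi * expR (- x * `|t|).
Proof.
move=> x0; pose d n : R := (n.+1%:R)^-1.
have d0 n : 0 < d n by rewrite invr_gt0.
have o0 (w : R) : 0 < oneDsqr w by rewrite (lt_le_trans _ (oneDsqr_ge1 w)).
have ce : continuous (fun u : R => expR (- x * `|u|)).
  move=> u; exact: (continuous_comp (@norm_continuous _ R u) (@continuous_expRM R (- x) _)).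
have E n : \int[leb]_u (expR (- x * `|u|) * poisson (d n) (u - t)) =
    \int[leb]_w (expR (- x * `|d n * w + t|) / oneDsqr w).
  rewrite /Rintegral (@integral_poisson_subst _ _ t (fun u => expR (- x * `|u|)))//.
under eq_cvg do rewrite E.
have -> : pi * expR (- x * `|t|) = \int[leb]_w (expR (- x * `|t|) / oneDsqr w).
  rewrite RintegralZl//; last exact: integrable_oneDsqrV.
  by rewrite (RintegralP integral_oneDsqrV) mulrC.
apply: (@Rintegral_dominated_cvg _ _ _ leb setT _ _ (fun w => (oneDsqr w)^-1)) => //.
- move=> n; apply: measurable_funM; last first.
    by apply: continuous_measurable_fun; exact: continuous_oneDsqrV.
  apply: (measurable_continuous_comp (h := fun u => expR (- x * `|u|))) => //.
  by apply: measurable_funD => //; apply: measurable_funM.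
- apply: measurable_funM => //.
  by apply: continuous_measurable_fun; exact: continuous_oneDsqrV.
- move=> w _; apply: cvgM; last exact: cvg_cst.
  have : d n * w + t @[n --> \oo] --> 0 * w + t.
    apply: cvgD; last exact: cvg_cst.
    by apply: cvgM; [exact: cvg_harmonic|exact: cvg_cst].
  rewrite mul0r add0r => h.
  exact: (cvg_comp _ _ h (ce t)).
- exact: integrable_oneDsqrV.
- move=> n w _; rewrite normrM (gtr0_norm (x := _^-1)) ?invr_gt0//.
  rewrite ler_piMl ?invr_ge0 ?(ltW (o0 _))// ger0_norm ?expR_ge0//.
  by rewrite -[leRHS]expR0 ler_expR mulNr oppr_le0 mulr_ge0// ltW.
Qed.

Lemma poisson_fourier (x t phi : R) : 0 < x ->
  \int[leb]_v (poisson x v * cos (v * t + phi)) =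
  pi * (expR (- x * `|t|) * cos phi).
Proof.
move=> x0; pose d n : R := (n.+1%:R)^-1.
have d0 n : 0 < d n by rewrite invr_gt0.
have mc : measurable_fun (setT : set T) (fun v => cos (v * t + phi)).
  by apply: continuous_measurable_fun; exact: continuous_cosM.
have mabs (c : R) : measurable_fun (setT : set T) (fun v : R => expR (- c * `|v|)).
  apply: (measurable_continuous_comp (h := fun v => expR (- c * v))); first exact: continuous_expRM.
  by apply: continuous_measurable_fun; exact: norm_continuous.
have lim1 : \int[leb]_v (expR (- d n * `|v|) * (poisson x v * cos (v * t + phi)))
    @[n --> \oo] --> \int[leb]_v (poisson x v * cos (v * t + phi)).
  apply: (@Rintegral_dominated_cvg _ _ _ leb setT _ _ (poisson x)) => //.
  - move=> n; apply: measurable_funM => //; apply: measurable_funM => //.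
    exact: measurable_poisson.
  - by apply: measurable_funM => //; exact: measurable_poisson.
  - move=> v _; rewrite -[X in _ --> X]mul1r; apply: cvgM; last exact: cvg_cst.
    have : - d n * `|v| @[n --> \oo] --> - 0 * `|v|.
      by apply: cvgM; [apply: cvgN; exact: cvg_harmonic|exact: cvg_cst].
    rewrite oppr0 mul0r -expR0 => h.
    exact: (cvg_comp _ _ h (@continuous_expR R 0)).
  - have := integrable_poisson 0 x0.
    by apply: eq_integrable => // v _; rewrite subr0.
  - move=> n v _; rewrite normrM (ger0_norm (expR_ge0 _)).
    rewrite -[leRHS]mul1r ler_pM ?expR_ge0//.
      by rewrite -[leRHS]expR0 ler_expR mulNr oppr_le0 mulr_ge0// ltW.
    by rewrite normrM (ger0_norm (poisson_ge0 _ _))// ler_piMr ?poisson_ge0 ?normr_cos_le1.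
have lim2 : \int[leb]_v (expR (- d n * `|v|) * (poisson x v * cos (v * t + phi)))
    @[n --> \oo] --> cos phi * (pi * expR (- x * `|t|)).
  under eq_cvg do rewrite damped_poisson_fourier//.
  by apply: cvgM; [exact: cvg_cst|exact: poisson_approx_identity].
by rewrite (cvg_unique _ lim1 lim2)// mulrCA [cos _ * _]mulrC.
Qed.

End cosine_transform.

(** * Cosine transforms and the Poisson formula *)

Section cosine_transform_of_function.
Context {R : realType}.
Notation leb := (@lebesgue_measure R).
Notation T := (measurableTypeR R).

(** With a phase [phi], so that one definition covers the cosine and the sine
    transform. *)
Definition cosT (phi : R) (g : R -> R) (y : R) : R :=
  \int[leb]_t (cos (y * t + phi) * g t).

Lemma Rintegral_shift (c : R) (f : R -> R) : measurable_fun (setT : set T) f ->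
  \int[leb]_v f (v + c) = \int[leb]_v f v.
Proof.
move=> mf; rewrite /Rintegral (@integral_shift _ c (EFin \o f))//.
exact/measurable_EFinP.
Qed.

Lemma measurable_cosM2 (phi : R) :
  measurable_fun setT (fun z : T * T => cos (z.1 * z.2 + phi)).
Proof.
apply: (measurable_continuous_comp (h := cos)); first exact: continuous_cos.
apply: measurable_funD; last exact: measurable_cst.
by apply: measurable_funM; [exact: measurable_fst|exact: measurable_snd].
Qed.

Lemma measurable_cosT (phi : R) (g : R -> R) : measurable_fun (setT : set T) g ->
  measurable_fun (setT : set T) (cosT phi g).
Proof.
move=> mg; apply: (@measurable_Rintegral R _ T (fun y t => cos (y * t + phi) * g t)).
apply: measurable_funM; first exact: measurable_cosM2.
exact: (measurableT_comp mg measurable_snd).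
Qed.

Section integrable.
Variables (g : R -> R).
Hypothesis mg : measurable_fun (setT : set T) g.
Hypothesis ig : leb.-integrable setT (EFin \o g).

Lemma integrable_cosM (phi y : R) :
  leb.-integrable setT (fun t => (cos (y * t + phi) * g t)%:E).
Proof.
apply: (@le_integrableR _ T R leb setT _ (fun t => `|g t|)) => //.
- apply: measurable_funM => //.
  apply: (measurable_continuous_comp (h := cos)); first exact: continuous_cos.
  by apply: measurable_funD => //; apply: measurable_funM.
- by move=> t _; rewrite normrM ler_piMl// normr_cos_le1.
- exact: integrable_norm.
Qed.

Lemma cosT_bound (phi y : R) : `|cosT phi g y| <= \int[leb]_t `|g t|.
Proof.
rewrite /cosT (le_trans (le_normr_Rintegral _ (integrable_cosM _ _)))//.
apply: le_Rintegral => //.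
- exact: (integrable_norm (integrable_cosM _ _)).
- exact: integrable_norm.
- by move=> t _; rewrite normrM ler_piMl// normr_cos_le1.
Qed.

Lemma measurable_poisson_shift (x y : R) : 0 < x ->
  measurable_fun (setT : set T) (fun v => poisson x (v - y)).
Proof.
move=> x0; apply: (measurable_continuous_comp (h := poisson x)).
  exact: continuous_poisson.
exact: measurable_funB.
Qed.

(** The Poisson formula: inside the half plane the transform of [g] is an average
    of its values on the boundary line.  By Fubini this is the Fourier transform
    of the kernel, applied to each frequency [t]; since [g] lives on nonnegative
    frequencies, [|t|] there is [t]. *)
Lemma poisson_cosT (x y phi : R) : 0 < x -> (forall t, t < 0 -> g t = 0) ->
  \int[leb]_v (poisson x (v - y) * cosT phi g v) =
  pi * cosT phi (fun t => expR (- x * t) * g t) y.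
Proof.
move=> x0 gN.
pose f v t := poisson x (v - y) * (cos (v * t + phi) * g t).
have -> : \int[leb]_v (poisson x (v - y) * cosT phi g v) =
    \int[leb]_v \int[leb]_t f v t.
  apply: eq_Rintegral => v _; rewrite /f RintegralZl//.
  exact: integrable_cosM.
rewrite (@Rintegral_swap _ f (fun v => poisson x (v - y)) (fun t => `|g t|)) //.
- rewrite /cosT -RintegralZl//; last first.
    apply: (@le_integrableR _ T R leb setT _ (fun t => `|g t|)) => //.
    + apply: measurable_funM.
        apply: (measurable_continuous_comp (h := cos)); first exact: continuous_cos.
        by apply: measurable_funD => //; apply: measurable_funM.
      apply: measurable_funM => //.
      by apply: continuous_measurable_fun; exact: continuous_expRM.
    + move=> t _; have [t0|t0] := ltP t 0; first by rewrite gN// !mulr0 normr0.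
      rewrite mulrA normrM ler_piMl// normrM (ger0_norm (expR_ge0 _)).
      rewrite mulr_ile1 ?expR_ge0 ?normr_cos_le1//.
      by rewrite -[leRHS]expR0 ler_expR mulNr oppr_le0 mulr_ge0// ltW.
    + exact: integrable_norm.
  apply: eq_Rintegral => t _; rewrite /f.
  transitivity (\int[leb]_v (g t * (poisson x (v - y) * cos (v * t + phi)))).
    by apply: eq_Rintegral => v _; ring.
  have mp : measurable_fun (setT : set T) (fun v => poisson x (v - y) * cos (v * t + phi)).
    apply: measurable_funM; first exact: measurable_poisson_shift.
    by apply: continuous_measurable_fun; exact: continuous_cosM.
  rewrite RintegralZl//; last first.
    apply: (@le_integrableR _ T R leb setT _ (fun v => poisson x (v - y))) => //.
      move=> v _; rewrite normrM (ger0_norm (poisson_ge0 _ _))//.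
      by rewrite ler_piMr ?poisson_ge0 ?normr_cos_le1.
    exact: integrable_poisson.
  rewrite -(Rintegral_shift y)//.
  under eq_Rintegral => v _.
    rewrite addrK (_ : (v + y) * t + phi = v * t + (y * t + phi)); last by ring.
    over.
  rewrite poisson_fourier//.
  have [t0|t0] := ltP t 0; first by rewrite gN// !(mulr0, mul0r).
  by rewrite ger0_norm//; ring.
- rewrite /f; apply: measurable_funM.
    exact: (measurableT_comp (measurable_poisson_shift y x0) measurable_fst).
  apply: measurable_funM; first exact: measurable_cosM2.
  exact: (measurableT_comp mg measurable_snd).
- exact: integrable_poisson.
- exact: integrable_norm.
- by move=> v; exact: poisson_ge0.
- move=> v t; rewrite /f normrM (ger0_norm (poisson_ge0 _ _))// ler_wpM2l ?poisson_ge0//.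
  by rewrite normrM ler_piMl// normr_cos_le1.
Qed.

End integrable.
End cosine_transform_of_function.

(** * A Bessel inequality for cosine transforms *)

Section bessel.
Context {R : realType}.
Notation leb := (@lebesgue_measure R).
Notation T := (measurableTypeR R).
Variables (g : R -> R) (phi : R).
Hypothesis mg : measurable_fun (setT : set T) g.
Hypothesis ig : leb.-integrable setT (EFin \o g).
Hypothesis g0 : forall t, 0 <= g t.
Hypothesis gN : forall t, t < 0 -> g t = 0.

Let C := cosT phi g.
Let G := \int[leb]_t g t.
Let CG v : `|C v| <= G.
Proof.
rewrite (le_trans (cosT_bound mg ig phi v))// le_eqVlt; apply/orP; left; apply/eqP.
by apply: eq_Rintegral => t _; rewrite ger0_norm.
Qed.
Let mC : measurable_fun (setT : set T) C.
Proof. exact: measurable_cosT. Qed.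
Let G0 : 0 <= G.
Proof. exact: (le_trans (normr_ge0 _) (CG 0)). Qed.

Let measurable_abs_exp (d : R) : measurable_fun (setT : set T) (fun v : R => expR (- d * `|v|)).
Proof.
apply: (measurable_continuous_comp (h := fun v => expR (- d * v))); first exact: continuous_expRM.
by apply: continuous_measurable_fun; exact: norm_continuous.
Qed.

Let damped_cos_cos (d t u : R) : 0 < d ->
  \int[leb]_v (expR (- d * `|v|) * (cos (v * t + phi) * cos (v * u + phi))) =
  cos (phi + phi) * poisson d (t + u) + poisson d (t - u).
Proof.
move=> d0.
have [i1 e1] := integral_expRcos (t + u) (phi + phi) d0.
have [i2 e2] := integral_expRcos (t - u) 0 d0.
transitivity (\int[leb]_v (2^-1 * (expR (- d * `|v|) * cos (v * (t + u) + (phi + phi)) +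
   expR (- d * `|v|) * cos (v * (t - u) + 0)))).
  apply: eq_Rintegral => v _; rewrite cosM_half.
  have -> : v * t + phi + (v * u + phi) = v * (t + u) + (phi + phi) by ring.
  have -> : v * t + phi - (v * u + phi) = v * (t - u) + 0 by ring.
  by ring.
rewrite RintegralZl//; last exact: integrableRD.
rewrite RintegralD// e1 e2 cos0 mulr1 /poisson -[RHS]mulr1.
rewrite -[X in _ = _ * X](@mulVf _ 2)//; ring.
Qed.

Let damped_cosT_pairing (d t : R) : 0 < d ->
  \int[leb]_v (expR (- d * `|v|) * C v * cos (v * t + phi)) =
  \int[leb]_u (g u * (cos (phi + phi) * poisson d (t + u) + poisson d (t - u))).
Proof.
move=> d0.
pose f v u := expR (- d * `|v|) * cos (v * t + phi) * (cos (v * u + phi) * g u).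
transitivity (\int[leb]_v \int[leb]_u f v u).
  apply: eq_Rintegral => v _; rewrite /f RintegralZl//; last exact: integrable_cosM.
  by rewrite /C/cosT; ring.
rewrite (@Rintegral_swap _ f (fun v => expR (- d * `|v|)) g) //.
- apply: eq_Rintegral => u _; rewrite -damped_cos_cos// -RintegralZl//; last first.
    apply: (@le_integrableR _ T R leb setT _ (fun v => expR (- d * `|v|))) => //.
    + apply: measurable_funM => //.
      by apply: measurable_funM; apply: continuous_measurable_fun; exact: continuous_cosM.
    + move=> v _; rewrite normrM (ger0_norm (expR_ge0 _)) ler_piMr ?expR_ge0//.
      by rewrite normrM mulr_ile1 ?normr_cos_le1.
    + exact: integral_expR_abs.
  by apply: eq_Rintegral => v _; rewrite /f; ring.
- have m1 : measurable_fun (setT : set T) (fun v => expR (- d * `|v|) * cos (v * t + phi)).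
    by apply: measurable_funM => //; apply: continuous_measurable_fun; exact: continuous_cosM.
  rewrite /f; apply: measurable_funM; first exact: (measurableT_comp m1 measurable_fst).
  apply: measurable_funM; first exact: measurable_cosM2.
  exact: (measurableT_comp mg measurable_snd).
- exact: integral_expR_abs.
- move=> v u; rewrite /f !normrM (ger0_norm (expR_ge0 _)) (ger0_norm (g0 _)).
  rewrite -mulrA ler_wpM2l ?expR_ge0// mulrA ler_piMl// mulr_ile1 ?normr_cos_le1//.
Qed.

Let damped_cosT_sqr (d : R) : 0 < d ->
  \int[leb]_v (expR (- d * `|v|) * C v ^+ 2) =
  \int[leb]_t (g t * \int[leb]_v (expR (- d * `|v|) * C v * cos (v * t + phi))).
Proof.
move=> d0.
pose f v t := expR (- d * `|v|) * C v * (cos (v * t + phi) * g t).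
have mWC : measurable_fun (setT : set T) (fun v => expR (- d * `|v|) * C v).
  by apply: measurable_funM.
transitivity (\int[leb]_v \int[leb]_u f v u).
  apply: eq_Rintegral => v _; rewrite /f RintegralZl//; last exact: integrable_cosM.
  by rewrite expr2 mulrA.
have iWC : leb.-integrable setT (fun v => (expR (- d * `|v|) * G)%:E).
  have := integrableRZl G measurableT (integral_expR_abs d0).
  by under eq_fun do rewrite mulrC.
rewrite (@Rintegral_swap _ f (fun v => expR (- d * `|v|) * G) g) //.
- apply: eq_Rintegral => t _; rewrite -RintegralZl//; last first.
    apply: (@le_integrableR _ T R leb setT _ (fun v => expR (- d * `|v|) * G)) => //.
    + apply: measurable_funM => //.
      by apply: continuous_measurable_fun; exact: continuous_cosM.
    + move=> v _; rewrite !normrM (ger0_norm (expR_ge0 _)) -mulrA ler_wpM2l ?expR_ge0//.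
      by rewrite (le_trans _ (CG v))// ler_piMr// normr_cos_le1.
  by apply: eq_Rintegral => v _; rewrite /f; ring.
- rewrite /f; apply: measurable_funM.
    exact: (measurableT_comp mWC measurable_fst).
  apply: measurable_funM; first exact: measurable_cosM2.
  exact: (measurableT_comp mg measurable_snd).
- by move=> v; rewrite mulr_ge0 ?expR_ge0.
- move=> v u; rewrite /f !normrM (ger0_norm (expR_ge0 _)) (ger0_norm (g0 _)).
  rewrite -!mulrA ler_wpM2l ?expR_ge0// ler_pM ?mulr_ge0//.
  by rewrite ler_piMl// normr_cos_le1.
Qed.

Let poisson_le (d u : R) : 0 < d -> poisson d u <= d^-1.
Proof.
move=> d0; rewrite /poisson ler_pdivrMr ?poisson_denom_gt0//.
by rewrite expr2 mulrDr mulrA mulVf ?gt_eqF// mul1r lerDl mulr_ge0 ?sqr_ge0// invr_ge0 ltW.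
Qed.

Let integrable_gpoisson (d t : R) : 0 < d ->
  leb.-integrable setT (fun u => (g u * poisson d (u - t))%:E).
Proof.
move=> d0; apply: (@le_integrableR _ T R leb setT _ (fun u => d^-1 * g u)) => //.
- by apply: measurable_funM => //; exact: measurable_poisson_shift.
- move=> u _; have P0 := poisson_ge0 (u - t) d0.
  rewrite ger0_norm; last exact: mulr_ge0.
  by rewrite mulrC ler_wpM2r// poisson_le.
- exact: integrableRZl.
Qed.

(** For nonnegative [t] and [u] the reflected kernel [poisson d (t + u)] is
    smaller than [poisson d (t - u)], which absorbs it at the cost of a factor 2. *)
Let damped_cosT_pairing_le (d t : R) : 0 < d -> 0 <= t ->
  \int[leb]_v (expR (- d * `|v|) * C v * cos (v * t + phi)) <=
  \int[leb]_u (2 * (g u * poisson d (u - t))).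
Proof.
move=> d0 t0; rewrite damped_cosT_pairing//.
have PN u : poisson d (t - u) = poisson d (u - t) by rewrite -poissonN opprB.
apply: le_Rintegral => //.
- apply: (@le_integrableR _ T R leb setT _ (fun u => 2 * d^-1 * g u)) => //.
  + apply: measurable_funM => //; apply: measurable_funD.
      apply: measurable_funM => //.
      apply: (measurable_continuous_comp (h := poisson d)); first exact: continuous_poisson.
      exact: measurable_funD.
    under eq_fun do rewrite PN.
    exact: measurable_poisson_shift.
  + move=> u _; rewrite normrM (ger0_norm (g0 _)) mulrC ler_wpM2r//.
    rewrite (le_trans (ler_normD _ _))// normrM mulr_natl mulr2n lerD//.
      rewrite (le_trans _ (poisson_le (t + u) d0))// (ger0_norm (poisson_ge0 _ _))//.
      by rewrite ler_piMl ?poisson_ge0// normr_cos_le1.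
    by rewrite (ger0_norm (poisson_ge0 _ _))// poisson_le.
  + exact: integrableRZl.
- by apply: integrableRZl => //; exact: integrable_gpoisson.
- move=> u _; have [u0|u0] := ltP u 0; first by rewrite gN// !(mul0r, mulr0).
  rewrite [leRHS]mulrCA ler_wpM2l// PN mulr_natl mulr2n lerD2r.
  rewrite (@le_trans _ _ (poisson d (t + u)))//.
    by rewrite ler_piMl ?poisson_ge0// cos_le1.
  rewrite /poisson ler_wpM2l ?(ltW d0)// lef_pV2 ?posrE ?poisson_denom_gt0//.
  by rewrite lerD2l; nra.
Qed.

Local Open Scope ereal_scope.

(** The damped square integral of the transform is a quadratic form in [g] with
    kernel at most [2 poisson d (u - t)].  By [2 g t g u <= g t ^ 2 + g u ^ 2]
    (Schur's test) it is at most the mass of twice the kernel times the integral of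
    [g ^ 2]. *)
Let damped_bessel (d : R) : (0 < d)%R ->
  (\int[leb]_v (expR (- d * `|v|) * C v ^+ 2))%:E <=
  (2 * pi)%:E * \int[leb]_t (g t ^+ 2)%:E.
Proof.
move=> d0; rewrite damped_cosT_sqr//.
have mP2 : measurable_fun setT (fun z : T * T => poisson d (z.2 - z.1)).
  apply: (measurable_continuous_comp (h := poisson d)); first exact: continuous_poisson.
  by apply: measurable_funB; [exact: measurable_snd|exact: measurable_fst].
have mg1 : measurable_fun setT (fun z : T * T => g z.1).
  exact: (measurableT_comp mg measurable_fst).
have mg2 : measurable_fun setT (fun z : T * T => g z.2).
  exact: (measurableT_comp mg measurable_snd).
have P0 t u : (0 <= 2 * (g u * poisson d (u - t)))%R.
  by apply: mulr_ge0 => //; apply: mulr_ge0 => //; exact: poisson_ge0.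
pose I t := (\int[leb]_u (2 * (g u * poisson d (u - t))))%R.
have mI : measurable_fun (setT : set T) I.
  apply: (@measurable_Rintegral R _ T (fun t u => 2 * (g u * poisson d (u - t))))%R.
  by apply: measurable_funM => //; apply: measurable_funM.
have I0 t : (0 <= I t)%R.
  by apply: Rintegral_ge0 => u _; exact: P0.
have ID t : (I t <= 2 * d^-1 * G)%R.
  rewrite /I /G -RintegralZl//; apply: le_Rintegral => //.
  - by apply: integrableRZl => //; exact: integrable_gpoisson.
  - exact: integrableRZl.
  - move=> u _; rewrite -mulrA ler_wpM2l// mulrC ler_wpM2r//.
    exact: poisson_le.
have igI : leb.-integrable setT (EFin \o (fun t => g t * I t)%R).
  apply: (@le_integrableR _ T R leb setT _ (fun t => (2 * d^-1 * G) * g t)%R) => //.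
  - exact: measurable_funM.
  - by move=> t _; rewrite ger0_norm ?mulr_ge0// mulrC ler_wpM2r.
  - exact: integrableRZl.
pose J t := (\int[leb]_v (expR (- d * `|v|) * C v * cos (v * t + phi)))%R.
have igJ : leb.-integrable setT (EFin \o (fun t => g t * J t)%R).
  have iWG : leb.-integrable setT (fun v => (expR (- d * `|v|) * G)%:E).
    have := integrableRZl G measurableT (integral_expR_abs d0).
    by under eq_fun do rewrite mulrC.
  have Wcos t v : (`|expR (- d * `|v|) * C v * cos (v * t + phi)| <= expR (- d * `|v|) * G)%R.
    rewrite !normrM (ger0_norm (expR_ge0 _)) -mulrA ler_wpM2l ?expR_ge0//.
    by rewrite (le_trans _ (CG v))// ler_piMr// normr_cos_le1.
  have iW t : leb.-integrable setT (EFin \o (fun v => expR (- d * `|v|) * C v * cos (v * t + phi)))%R.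
    apply: (@le_integrableR _ T R leb setT _ (fun v => expR (- d * `|v|) * G)%R) => //.
    apply: measurable_funM; first exact: measurable_funM.
    by apply: continuous_measurable_fun; exact: continuous_cosM.
  have mJ : measurable_fun (setT : set T) J.
    apply: (@measurable_Rintegral R _ T (fun t v => expR (- d * `|v|) * C v * cos (v * t + phi)))%R.
    have mWC : measurable_fun (setT : set T) (fun v => expR (- d * `|v|) * C v)%R.
      exact: measurable_funM.
    apply: measurable_funM; first exact: (measurableT_comp mWC measurable_snd).
    apply: (measurable_continuous_comp (h := cos)); first exact: continuous_cos.
    apply: measurable_funD; last exact: measurable_cst.
    by apply: measurable_funM; [exact: measurable_snd|exact: measurable_fst].
  apply: (@le_integrableR _ T R leb setT _ (fun t => (\int[leb]_v (expR (- d * `|v|) * G))%R * g t)%R) => //.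
  - exact: measurable_funM.
  - move=> t _; rewrite normrM mulrC (ger0_norm (g0 _)) ler_wpM2r//.
    rewrite /J (le_trans (le_normr_Rintegral _ (iW t)))//.
    by apply: le_Rintegral => //; exact: integrable_norm.
  - exact: integrableRZl.
apply: (@le_trans _ _ (\int[leb]_t (g t * I t)%R)%:E).
  rewrite lee_fin; apply: le_Rintegral => // t _.
  have [t0|t0] := ltP t 0%R; first by rewrite gN// !mul0r.
  by rewrite ler_wpM2l// damped_cosT_pairing_le.
rewrite EFin_Rintegral//.
apply: (@le_trans _ _ (\int[leb]_t \int[leb]_u
   ((g t ^+ 2 * poisson d (u - t))%:E + (g u ^+ 2 * poisson d (u - t))%:E))).
  apply: ge0_le_integral => //.
  - by move=> t _; rewrite lee_fin mulr_ge0.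
  - by case/integrableP : igI.
  - apply: (@measurable_fun_fubini_tonelli_F _ _ _ _ _ leb (fun z : T * T =>
      (g z.1 ^+ 2 * poisson d (z.2 - z.1))%:E + (g z.2 ^+ 2 * poisson d (z.2 - z.1))%:E)).
    + apply: emeasurable_funD; apply/measurable_EFinP; apply: measurable_funM => //; exact: measurable_funX.
    + by move=> z; rewrite adde_ge0// lee_fin mulr_ge0 ?sqr_ge0 ?poisson_ge0.
  - move=> t _; rewrite EFinM /I EFin_Rintegral//; last first.
      by apply: integrableRZl => //; exact: integrable_gpoisson.
    rewrite -ge0_integralZl_EFin//; last 2 first.
    + by move=> u _; rewrite lee_fin P0.
    + apply/measurable_EFinP; do 2 apply: measurable_funM => //.
      exact: measurable_poisson_shift.
    apply: ge0_le_integral => //.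
    + by move=> u _; rewrite -EFinM lee_fin mulr_ge0.
    + apply: emeasurable_funM => //; apply/measurable_EFinP.
      do 2 apply: measurable_funM => //.
      exact: measurable_poisson_shift.
    + apply: emeasurable_funD; apply/measurable_EFinP; apply: measurable_funM.
      * exact: measurable_cst.
      * exact: measurable_poisson_shift.
      * exact: measurable_funX.
      * exact: measurable_poisson_shift.
    + move=> u _; rewrite -EFinM -EFinD lee_fin -mulrDl.
      rewrite (_ : g t * _ = 2 * g t * g u * poisson d (u - t))%R; last by ring.
      apply: ler_wpM2r; first exact: poisson_ge0.
      by rewrite -subr_ge0 (_ : _ - _ = (g t - g u) ^+ 2)%R ?sqr_ge0//; ring.
under eq_integral => t _.
  rewrite ge0_integralD//; last 4 first.
  - by move=> u _; rewrite lee_fin mulr_ge0 ?sqr_ge0 ?poisson_ge0.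
  - by apply/measurable_EFinP; apply: measurable_funM => //; exact: measurable_poisson_shift.
  - by move=> u _; rewrite lee_fin mulr_ge0 ?sqr_ge0 ?poisson_ge0.
  - by apply/measurable_EFinP; apply: measurable_funM => //; [exact: measurable_funX|exact: measurable_poisson_shift].
  over.
have mF : measurable_fun setT (fun z : T * T => (g z.1 ^+ 2 * poisson d (z.2 - z.1))%:E).
  by apply/measurable_EFinP; apply: measurable_funM => //; exact: measurable_funX.
have mH : measurable_fun setT (fun z : T * T => (g z.2 ^+ 2 * poisson d (z.2 - z.1))%:E).
  by apply/measurable_EFinP; apply: measurable_funM => //; exact: measurable_funX.
rewrite ge0_integralD//; last 4 first.
- by move=> t _; apply: integral_ge0 => u _; rewrite lee_fin mulr_ge0 ?sqr_ge0 ?poisson_ge0.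
- apply: (measurable_fun_fubini_tonelli_F _ mF).
  by move=> z; rewrite lee_fin mulr_ge0 ?sqr_ge0 ?poisson_ge0.
- by move=> t _; apply: integral_ge0 => u _; rewrite lee_fin mulr_ge0 ?sqr_ge0 ?poisson_ge0.
- apply: (measurable_fun_fubini_tonelli_F _ mH).
  by move=> z; rewrite lee_fin mulr_ge0 ?sqr_ge0 ?poisson_ge0.
have sqP t : (\int[leb]_u (g t ^+ 2 * poisson d (u - t))%:E) = pi%:E * (g t ^+ 2)%:E.
  under eq_integral do rewrite EFinM.
  rewrite ge0_integralZl_EFin ?sqr_ge0//; last 2 first.
  - by move=> u _; rewrite lee_fin poisson_ge0.
  - by apply/measurable_EFinP; exact: measurable_poisson_shift.
  by rewrite integral_poisson// muleC.
under eq_integral do rewrite sqP.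
rewrite [X in _ + X](fubini_tonelli _ mH)/=; last first.
  by move=> z; rewrite lee_fin mulr_ge0 ?sqr_ge0 ?poisson_ge0.
under [X in _ + X]eq_integral => u _.
  under eq_integral do rewrite -poissonN opprB.
  rewrite sqP; over.
have -> : \int[leb]_t (pi%:E * (g t ^+ 2)%:E) = pi%:E * \int[leb]_t (g t ^+ 2)%:E.
  apply: ge0_integralZl_EFin; rewrite ?pi_ge0//.
  - by move=> u _; rewrite lee_fin sqr_ge0.
  - by apply/measurable_EFinP; exact: measurable_funX.
by rewrite -mule2n -mule_natl muleA -EFinM.
Qed.

(** The damping is removed by monotone convergence. *)
Lemma bessel_cosT : \int[leb]_v (C v ^+ 2)%:E <= (2 * pi)%:E * \int[leb]_t (g t ^+ 2)%:E.
Proof.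
pose d n : R := (n.+1%:R)^-1%R.
have d0 n : (0 < d n)%R by rewrite invr_gt0.
pose f n v := (expR (- d n * `|v|) * C v ^+ 2)%:E.
have f0 n v : 0 <= f n v by rewrite lee_fin mulr_ge0 ?expR_ge0 ?sqr_ge0.
have mf n : measurable_fun (setT : set T) (f n).
  apply/measurable_EFinP; apply: measurable_funM => //.
  exact: measurable_funX.
have fC v : f n v @[n --> \oo] --> (C v ^+ 2)%:E.
  apply: cvg_EFin; first exact: nearW.
  rewrite /f/= -[X in _ --> X]mul1r; apply: cvgM; last exact: cvg_cst.
  have : (- d n * `|v|)%R @[n --> \oo] --> (- 0 * `|v|)%R.
    by apply: cvgM; [apply: cvgN; exact: cvg_harmonic|exact: cvg_cst].
  rewrite oppr0 mul0r -expR0 => h.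
  exact: (cvg_comp _ _ h (@continuous_expR R 0%R)).
have -> : \int[leb]_v (C v ^+ 2)%:E = \int[leb]_v limn (f ^~ v).
  by apply: eq_integral => v _; apply/esym/cvg_lim => //; exact: fC.
have nd v : nondecreasing_seq (f ^~ v).
  move=> m n mn; rewrite lee_fin ler_wpM2r ?sqr_ge0// ler_expR ler_wpM2r//.
  by rewrite lerN2 lef_pV2 ?posrE// ler_nat.
have := @cvg_monotone_convergence _ _ _ leb setT measurableT f mf (fun n v _ => f0 n v) (fun v _ => nd v).
move=> /cvg_lim <- //.
apply: lime_le.
  apply: ereal_nondecreasing_is_cvgn => m n mn; apply: ge0_le_integral => //.
  by move=> v _; exact: nd.
apply: nearW => n; have := damped_bessel (d0 n); rewrite EFin_Rintegral//.
apply: (@le_integrableR _ T R leb setT _ (fun v => G ^+ 2 * expR (- d n * `|v|))%R) => //.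
- by apply: measurable_funM => //; exact: measurable_funX.
- move=> v _; rewrite normrM (ger0_norm (expR_ge0 _)) mulrC ler_wpM2r ?expR_ge0//.
  by rewrite normrX ler_sqr ?nnegrE.
- by apply: integrableRZl => //; exact: integral_expR_abs.
Qed.

End bessel.

(** * Borel sets of the complex plane *)

Section borel_complex.
Context {R : realType}.
Notation CC := (borelC R).

Lemma normr_Re_le (z : R[i]) : `|complex.Re z| <= Normc.normc z.
Proof.
case: z => a b /=; rewrite -sqrtr_sqr ler_wsqrtr// lerDl; exact: sqr_ge0.
Qed.

Lemma normr_Im_le (z : R[i]) : `|complex.Im z| <= Normc.normc z.
Proof.
case: z => a b /=; rewrite -sqrtr_sqr ler_wsqrtr// lerDr; exact: sqr_ge0.
Qed.

Lemma normc_le_ReIm (z : R[i]) : Normc.normc z <= `|complex.Re z| + `|complex.Im z|.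
Proof.
case: z => a b /=.
rewrite -[leRHS]ger0_norm ?addr_ge0// -sqrtr_sqr ler_wsqrtr//.
rewrite -(real_normK (num_real a)) -(real_normK (num_real b)).
by rewrite sqrrD addrAC lerDl mulrn_wge0// mulr_ge0.
Qed.

Lemma normc_ge0 (z : R[i]) : 0 <= Normc.normc z.
Proof. by case: z => a b /=; exact: sqrtr_ge0. Qed.

Lemma open_complexP (U : set R[i]) :
  (forall z, U z -> exists2 e : R, 0 < e &
     forall w, Normc.normc (z - w) < e -> U w) -> @open (R[i]^o) U.
Proof.
move=> h; rewrite openE => z /= Uz.
have [e e0 he] := h z Uz.
apply/nbhs_ballP; exists (e%:C)%C; first by rewrite /= ltcE/= eqxx.
by move=> w; rewrite /ball/= ltcE/= => /andP[_ zw]; exact: he.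
Qed.

Lemma open_complex_ball (U : set R[i]) (z : R[i]) : @open (R[i]^o) U -> U z ->
  exists2 e : R, 0 < e & forall w, Normc.normc (z - w) < e -> U w.
Proof.
rewrite openE => /(_ z)/[apply]/nbhs_ballP[e] /=.
rewrite ltcE/= => /andP[/eqP e1 e0] h; exists (complex.Re e) => // w zw.
by apply: h; rewrite /ball/= ltcE/= e1 eqxx.
Qed.

Lemma measurable_Re : measurable_fun (setT : set CC) (@complex.Re R : CC -> R).
Proof.
apply: (measurability _ (RGenOInfty.measurableE R)) => //= _ [_ [a ->] <-].
rewrite setTI; apply: sub_sigma_algebra; apply: open_complexP => z /=.
rewrite in_itv/= andbT => az; exists (complex.Re z - a); first by rewrite subr_gt0.
move=> w zw; rewrite in_itv/= andbT.
have := le_lt_trans (normr_Re_le (z - w)) zw.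
by rewrite raddfB/= ltr_norml => /andP[_]; rewrite ltrD2l ltrN2.
Qed.

Lemma measurable_Im : measurable_fun (setT : set CC) (@complex.Im R : CC -> R).
Proof.
apply: (measurability _ (RGenOInfty.measurableE R)) => //= _ [_ [a ->] <-].
rewrite setTI; apply: sub_sigma_algebra; apply: open_complexP => z /=.
rewrite in_itv/= andbT => az; exists (complex.Im z - a); first by rewrite subr_gt0.
move=> w zw; rewrite in_itv/= andbT.
have := le_lt_trans (normr_Im_le (z - w)) zw.
by rewrite raddfB/= ltr_norml => /andP[_]; rewrite ltrD2l ltrN2.
Qed.

(** A map to the complex plane is Borel as soon as its two coordinates are,
    because an open set is a countable union of rational squares. *)
Lemma measurable_Complex d (X : measurableType d) (D : set X) (u v : X -> R) :
  measurable_fun D u -> measurable_fun D v ->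
  measurable_fun D ((fun x => Complex (u x) (v x)) : X -> CC).
Proof.
move=> mu mv mD; apply: (@measurability _ _ X CC D _ (@open (R[i]^o)) erefl _ mD) => // _ [U oU <-].
pose box (a b r : R) : set R[i] := [set w | `|complex.Re w - a| < r /\ `|complex.Im w - b| < r].
pose F (a b r : rat) : set X :=
  if asbool (box (ratr a) (ratr b) (ratr r) `<=` U) then
    D `&` (fun x => Complex (u x) (v x)) @^-1` box (ratr a) (ratr b) (ratr r) else set0.
rewrite [X in measurable X](_ : _ = \bigcup_a \bigcup_b \bigcup_r F a b r).
  apply: bigcupT_measurable_rat => a; apply: bigcupT_measurable_rat => b.
  apply: bigcupT_measurable_rat => r; rewrite /F; case: asboolP => // _.
  rewrite (_ : _ `&` _ = (D `&` u @^-1` ball (ratr a : R) (ratr r)) `&`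
                         (D `&` v @^-1` ball (ratr b : R) (ratr r))).
    by apply: measurableI; [apply: mu => //|apply: mv => //]; exact: measurable_ball.
  by apply/seteqP; split => x /=; rewrite /box /ball/= (distrC (ratr a)) (distrC (ratr b)); tauto.
apply/seteqP; split => x /=.
  move=> [Dx Ux]; have [e e0 he] := open_complex_ball oU Ux.
  have /rat_in_itvoo[r] : 0 < e / 4 by rewrite divr_gt0.
  rewrite in_itv/= => /andP[r0 re].
  have /rat_in_itvoo[a] : u x - ratr r < u x + ratr r by rewrite ltrD2l gtrN.
  rewrite in_itv/= => /andP[a1 a2].
  have /rat_in_itvoo[b] : v x - ratr r < v x + ratr r by rewrite ltrD2l gtrN.
  rewrite in_itv/= => /andP[b1 b2].
  have xa : `|u x - ratr a| < ratr r by rewrite ltr_distlC; lra.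
  have xb : `|v x - ratr b| < ratr r by rewrite ltr_distlC; lra.
  exists a => //; exists b => //; exists r => //.
  rewrite /F; case: asboolP => //= -[] w [/= wa wb]; apply: he.
  apply: le_lt_trans (normc_le_ReIm _) _; rewrite !raddfB/=.
  have : `|u x - complex.Re w| < 2 * ratr r.
    by move: xa wa; rewrite !ltr_norml; lra.
  have : `|v x - complex.Im w| < 2 * ratr r.
    by move: xb wb; rewrite !ltr_norml; lra.
  lra.
move=> [a _ [b _ [r _]]]; rewrite /F; case: asboolP => //= h [Dx Bx].
by split => //; exact: h.
Qed.

Lemma measurable_right_half_plane : measurable (@right_half_plane R : set CC).
Proof.
have := measurable_Re measurableT (measurable_itv `]0%R, +oo[).
by rewrite setTI; congr measurable; apply/seteqP; split => z /=; rewrite in_itv/= andbT.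
Qed.

Lemma measurable_carleson_square (l r : bool) (a b : R) :
  measurable (carleson_square l r a b : set CC).
Proof.
have m1 := measurable_Im measurableT (measurable_itv (Interval (BSide l a) (BSide r b))).
have m2 := measurable_Re measurableT (measurable_itv `]0%R, (b - a)[).
rewrite [X in measurable X](_ : _ = (setT `&` @complex.Im R @^-1` [set` Interval (BSide l a) (BSide r b)])
   `&` (setT `&` @complex.Re R @^-1` `]0%R, (b - a)[%classic)); first exact: measurableI.
by rewrite !setTI; apply/seteqP; split => z /=; rewrite in_itv.
Qed.

End borel_complex.

(** * A covering argument for Poisson integrals *)

Section covering.
Context {R : realType}.
Notation leb := (@lebesgue_measure R).
Notation T := (measurableTypeR R).
Notation CC := (borelC R).

Lemma powR_superadd (alpha : R) (I : Type) (s : seq I) (a : I -> R) :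
  1 <= alpha -> (forall i, 0 <= a i) ->
  \sum_(i <- s) a i `^ alpha <= (\sum_(i <- s) a i) `^ alpha.
Proof.
move=> alpha1 a0; have alpha0 : 0 < alpha by apply: lt_le_trans alpha1.
have superadd2 (x y : R) : 0 <= x -> 0 <= y -> x `^ alpha + y `^ alpha <= (x + y) `^ alpha.
  move=> x0 y0; rewrite -(mulr_powRB1 x0)// -(mulr_powRB1 y0)// -(mulr_powRB1 (addr_ge0 x0 y0))//.
  rewrite mulrDl lerD// ler_wpM2l// ge0_ler_powR ?nnegrE ?subr_ge0 ?addr_ge0//.
    by rewrite lerDl.
  by rewrite lerDr.
elim: s => [|i s IH]; first by rewrite !big_nil powR0// gt_eqF.
rewrite !big_cons (le_trans _ (superadd2 _ _ (a0 i) _))//; first by rewrite lerD2l.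
by apply: sumr_ge0.
Qed.

(** The Carleson square over the ball of centre [c] and radius [r]. *)
Definition tent (c r : R) : set CC := carleson_square false true (c - r) (c + r).

Lemma tentE (c r : R) (z : R[i]) :
  tent c r z <-> ball c r (complex.Im z) /\ 0 < complex.Re z < 2 * r.
Proof.
rewrite /tent/carleson_square/= in_itv/= /ball/= distrC ltr_distlC.
rewrite (_ : c + r - (c - r) = 2 * r); last by ring.
rewrite (_ : (complex.Im z - r < c < complex.Im z + r) = (c - r < complex.Im z < c + r))//.
by apply/idP/idP => /andP[? ?]; apply/andP; split; lra.
Qed.

Variables (mu : {measure set CC -> \bar R}) (C alpha : R).
Hypotheses (C0 : 0 < C) (alpha1 : 1 <= alpha).
Hypothesis carleson : forall (l r : bool) (a b : R), a <= b ->
  (mu (carleson_square l r a b) <= (C * (b - a) `^ alpha)%:E)%E.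

Let alpha0 : 0 < alpha. Proof. exact: lt_le_trans alpha1. Qed.

Lemma measurable_tent (c r : R) : measurable (tent c r).
Proof. exact: measurable_carleson_square. Qed.

Let mu_tent (c r : R) : 0 < r -> (mu (tent c r) <= (C * (2 * r) `^ alpha)%:E)%E.
Proof.
move=> r0; rewrite (_ : 2 * r = c + r - (c - r)); last by ring.
by apply: carleson; lra.
Qed.

Lemma measure_bigsetU_le d (X : measurableType d) (m : {measure set X -> \bar R})
    (I : Type) (s : seq I) (A : I -> set X) : (forall i, measurable (A i)) ->
  (m (\big[setU/set0]_(i <- s) A i) <= \sum_(i <- s) m (A i))%E.
Proof.
move=> mA; elim: s => [|i s IH]; first by rewrite !big_nil measure0.
rewrite !big_cons (le_trans (measureU2 _ _ _))//; last by rewrite leeD2l.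
by apply: bigsetU_measurable.
Qed.

Section balls.
Variables (I : countType) (c r : I -> R) (h : R -> R) (delta H : R).
Hypotheses (r0 : forall i, 0 < r i) (delta0 : 0 < delta).
Hypotheses (mh : measurable_fun (setT : set T) h) (h0 : forall x, 0 <= h x).
Hypothesis hH : (\int[leb]_x (h x)%:E <= H%:E)%E.

Let good i := ((delta * r i)%:E <= \int[leb]_(x in ball (c i) (r i)) (h x)%:E)%E.

(** By the finite Vitali lemma disjoint good balls suffice, up to a dilation by
    three; superadditivity of [x `^ alpha] then turns the sum of the bounds for
    the dilated tents into a bound by the total mass of [h]. *)
Lemma measure_finite_tents (s : seq I) : (forall i, i \in s -> good i) ->
  (mu (\big[setU/set0]_(i <- s) tent (c i) (r i)) <=
   (C * (6 / delta * H) `^ alpha)%:E)%E.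
Proof.
move=> sgood.
have [D [uD Ds tD cov]] := @vitali_lemma_finite R I (fun i => ball (c i) (r i))
  (fun i => is_ball_ball (c i) (r i))
  (fun i => ex_intro _ (c i) (ballxx (c i) (r0 i))) s.
have sub : \big[setU/set0]_(i <- s) tent (c i) (r i) `<=`
           \big[setU/set0]_(j <- D) tent (c j) (3 * r j).
  move=> z; rewrite -!bigcup_seq => -[i /= si /tentE[zi ri]].
  have [j [jD _ rij sij]] := cov i si; exists j => //.
  have rij' : r i <= r j.
    rewrite -[leLHS](radius_ball_num (c i) (ltW (r0 i))).
    by rewrite -[leRHS](radius_ball_num (c j) (ltW (r0 j))); exact: rij.
  apply/tentE; split; last by lra.
  by have := sij _ zi; rewrite scale_ballE.
have mB (i : I) : measurable (ball (c i) (r i) : set T) by exact: measurable_ball.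
apply: (@le_trans _ _ (mu (\big[setU/set0]_(j <- D) tent (c j) (3 * r j)))).
  by apply: le_measure => //; rewrite inE; apply: bigsetU_measurable => i _; exact: measurable_tent.
apply: (le_trans (measure_bigsetU_le _ _ _)); first by move=> i; exact: measurable_tent.
apply: (@le_trans _ _ (\sum_(j <- D) (C * (6 * r j) `^ alpha)%:E)%E).
  apply: lee_sum => j _; rewrite (_ : 6 * r j = 2 * (3 * r j)); last by ring.
  by apply: mu_tent; rewrite mulr_gt0.
rewrite sumEFin lee_fin -mulr_sumr ler_pM2l//.
apply: (le_trans (powR_superadd _ alpha1 _)); first by move=> i; rewrite mulr_ge0// ltW.
have sumD : \sum_(j <- D) delta * r j <= H.
  rewrite -lee_fin -sumEFin; apply: le_trans hH.
  apply: (@le_trans _ _ (\sum_(j <- D) \int[leb]_(x in ball (c j) (r j)) (h x)%:E)%E).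
    by rewrite big_seq [leRHS]big_seq; apply: lee_sum => j /Ds /sgood.
  rewrite -ge0_integral_bigsetU//; last 2 first.
  - by apply/measurable_EFinP; exact: measurable_funTS.
  - by move=> x _; rewrite lee_fin.
  apply: ge0_subset_integral => //; first exact: bigsetU_measurable.
  - exact/measurable_EFinP.
  - by move=> x _; rewrite lee_fin.
have sum0 : 0 <= \sum_(j <- D) delta * r j.
  by apply: sumr_ge0 => j _; rewrite mulr_ge0// ltW.
have E : \sum_(j <- D) 6 * r j = 6 / delta * \sum_(j <- D) delta * r j.
  rewrite mulr_sumr; apply: eq_bigr => j _.
  by rewrite -mulrA mulKf// gt_eqF.
have d60 : 0 <= 6 / delta by rewrite divr_ge0// ltW.
apply: ge0_ler_powR; rewrite ?nnegrE ?(ltW alpha0)//.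
- by rewrite E mulr_ge0.
- by rewrite mulr_ge0// (le_trans sum0).
- by rewrite E ler_wpM2l.
Qed.

(** Every finite subfamily satisfies the bound, and countability gives the
    union as an increasing limit. *)
Lemma measure_countable_tents :
  measurable (\bigcup_(i in good) tent (c i) (r i)) /\
  (mu (\bigcup_(i in good) tent (c i) (r i)) <= (C * (6 / delta * H) `^ alpha)%:E)%E.
Proof.
pose s n := [seq i <- pmap (@unpickle I) (iota 0 n) | good i].
pose U n := \big[setU/set0]_(i <- s n) tent (c i) (r i).
have mU n : measurable (U n) by apply: bigsetU_measurable => i _; exact: measurable_tent.
have UE : \bigcup_(i in good) tent (c i) (r i) = \bigcup_n U n.
  apply/seteqP; split => z.
    move=> [i gi zi]; exists (pickle i).+1 => //; rewrite /U -bigcup_seq; exists i => //=.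
    rewrite /s mem_filter (gi : good i) mem_pmap; apply/mapP; exists (pickle i).
      by rewrite mem_iota /= add0n.
    by rewrite pickleK.
  move=> [n _]; rewrite /U -bigcup_seq => -[i /=]; rewrite mem_filter => /andP[gi _] zi.
  by exists i.
have mUU : measurable (\bigcup_n U n) by exact: bigcupT_measurable.
rewrite UE; split => //.
have nd : nondecreasing_seq U.
  move=> m n mn; apply/subsetPset => z; rewrite /U -!bigcup_seq => -[i /= im zi]; exists i => //=.
  move: im; rewrite !mem_filter => /andP[-> /=]; rewrite !mem_pmap => /mapP[k kn ->].
  by apply: map_f; move: kn; rewrite !mem_iota !add0n => /leq_trans; apply.
have cU := @nondecreasing_cvg_mu _ _ R mu U mU mUU nd.
rewrite -(cvg_lim _ cU)//.
apply: lime_le.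
  by apply/cvg_ex; eexists; exact: cU.
apply: nearW => n; apply: measure_finite_tents => i.
by rewrite mem_filter => /andP[].
Qed.

End balls.

(** Take the least [k] such that [|v| < 2^k x]. *)
Lemma poisson_le_dyadic (x v : R) : 0 < x ->
  exists k : nat, `|v| < 2 ^+ k * x /\ poisson x v <= 4 / x * 4^-1 ^+ k.
Proof.
move=> x0.
have ex : exists k : nat, `|v| < 2 ^+ k * x.
  have [n] : exists n : nat, `|v| / x < n%:R.
    by exists (Num.truncn (`|v| / x)).+1; exact: truncnS_gt.
  rewrite ltr_pdivrMr// => vn; exists n; rewrite (lt_le_trans vn)// ler_pM2r//.
  by rewrite -natrX ler_nat ltnW// ltn_expl.
have [k vk kmin] := ex_minnP ex; exists k; split => //.
rewrite /poisson ler_pdivrMr ?poisson_denom_gt0//.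
case: k vk kmin => [|k] vk kmin.
  rewrite expr0 mulr1 mulrDr (_ : 4 / x * x ^+ 2 = 4 * x); last by field; rewrite gt_eqF.
  have : 0 <= 4 / x * v ^+ 2 by rewrite mulr_ge0 ?sqr_ge0// divr_ge0// ltW.
  lra.
have vk' : 2 ^+ k * x <= `|v|.
  by rewrite leNgt; apply/negP => /kmin; rewrite ltnn.
have : (2 ^+ k * x) ^+ 2 <= v ^+ 2.
  by rewrite -(real_normK (num_real v)) ler_sqr ?nnegrE ?mulr_ge0 ?exprn_ge0// ltW.
rewrite exprMn -exprM mulnC exprM (_ : 2 ^+ 2 = 4 :> R); last by ring.
move=> h; have k0 : 0 < (4 : R) ^+ k by rewrite exprn_gt0.
rewrite exprVn exprS invfM mulrA (_ : 4 / x / 4 = x^-1); last by field; rewrite gt_eqF.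
rewrite -ler_pdivrMl ?mulr_gt0 ?invr_gt0// invfM !invrK.
rewrite (_ : x * 4 ^+ k * x = 4 ^+ k * x ^+ 2); last by ring.
by rewrite (le_trans h)// lerDr sqr_ge0.
Qed.

Local Open Scope ereal_scope.

(** The Poisson integral is a superposition of averages over the dyadic
    dilates of the interval of length [2 x] about [y]. *)
Lemma poisson_integral_le (h : R -> R) (x y M : R) : (0 < x)%R -> (0 <= M)%R ->
  measurable_fun (setT : set T) h -> (forall v, (0 <= h v)%R) ->
  (forall r, (x <= r)%R -> \int[leb]_(v in ball y r) (h v)%:E <= (M * r)%:E) ->
  \int[leb]_v (poisson x (v - y) * h v)%:E <= (8 * M)%:E.
Proof.
move=> x0 M0 mh h0 hM.
pose B k : set T := ball y (2 ^+ k * x)%R.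
have mB k : measurable (B k) by exact: measurable_ball.
pose F k v := (4 / x * 4^-1 ^+ k * (\1_(B k) v * h v))%:E.
have a0 k : (0 <= 4 / x * 4^-1 ^+ k :> R)%R by rewrite mulr_ge0 ?divr_ge0 ?exprn_ge0// ltW.
have F0 k v : 0 <= F k v by rewrite lee_fin; apply: mulr_ge0 => //; exact: mulr_ge0.
have mF k : measurable_fun (setT : set T) (F k).
  by apply/measurable_EFinP; do 2 apply: measurable_funM => //; exact: measurable_indic.
apply: (@le_trans _ _ (\int[leb]_v \sum_(0 <= k <oo) F k v)).
  apply: ge0_le_integral => //.
  - by move=> v _; rewrite lee_fin mulr_ge0// poisson_ge0.
  - by apply/measurable_EFinP; apply: measurable_funM => //; exact: measurable_poisson_shift.
  - by apply: ge0_emeasurable_sum => // k v _ _.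
  - move=> v _; have [k [vk pk]] := poisson_le_dyadic (v - y) x0.
    apply: (@le_trans _ _ (F k v)).
      rewrite /F lee_fin indicE mem_set ?mul1r ?ler_wpM2r//.
      by rewrite /B/ball/= distrC.
    rewrite (le_trans _ (@nneseries_lim_ge _ (F ^~ v) xpredT 0 k.+1 _))//.
    by rewrite big_nat_recr//= leeDr// sume_ge0.
rewrite integral_nneseries//.
apply: lime_le.
  by apply: is_cvg_nneseries => k _ _; exact: integral_ge0.
apply: nearW => n.
apply: (@le_trans _ _ (\sum_(0 <= k < n) (4 * M * 2^-1 ^+ k)%:E)).
  apply: lee_sum => k _; rewrite /F.
  under eq_integral do rewrite EFinM.
  rewrite ge0_integralZl_EFin//; last 2 first.
  - by move=> v _; rewrite lee_fin mulr_ge0.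
  - by apply/measurable_EFinP; apply: measurable_funM => //; exact: measurable_indic.
  have -> : \int[leb]_v (\1_(B k) v * h v)%:E = \int[leb]_(v in B k) (h v)%:E.
    rewrite [RHS]integral_mkcond; apply: eq_integral => v _.
    by rewrite patchE indicE; case: ifPn => _; rewrite ?mul1r ?mul0r.
  apply: (@le_trans _ _ ((4 / x * 4^-1 ^+ k)%:E * (M * (2 ^+ k * x))%:E)).
    rewrite lee_wpmul2l ?lee_fin//; apply: hM.
    by rewrite ler_peMl ?(ltW x0)// exprn_ege1// ler1n.
  rewrite -EFinM lee_fin le_eqVlt; apply/orP; left; apply/eqP.
  rewrite (_ : 4 / x * 4^-1 ^+ k * (M * (2 ^+ k * x)) = 4 * M * (4^-1 * 2) ^+ k * (x / x))%R; last first.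
    by rewrite exprMn; ring.
  by rewrite divff ?gt_eqF// mulr1; congr (_ * _ ^+ _)%R; field.
rewrite sumEFin lee_fin -mulr_sumr.
rewrite (_ : 8 * M = 4 * M * 2)%R; last by ring.
rewrite ler_wpM2l ?mulr_ge0//.
suff -> : (\sum_(0 <= k < n) 2^-1 ^+ k = 2 - 2 * 2^-1 ^+ n :> R)%R.
  by rewrite gerBl mulr_ge0// exprn_ge0.
elim: n => [|n IH]; first by rewrite big_geq// expr0; ring.
by rewrite big_nat_recr//= IH exprS; field.
Qed.

(** If the Poisson integral at [z] is large, then [h] has a large average over
    some interval about [Im z] of radius at least [Re z], so [z] lies in the tent
    over it.  Only countably many tents are used, with rational centres and with
    radii whose logarithms are rational, so that their union is measurable. *)
Lemma measure_poisson_gt (h : R -> R) (H lambda : R) :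
  measurable_fun (setT : set T) h -> (forall v, (0 <= h v)%R) -> (0 < lambda)%R ->
  \int[leb]_v (h v)%:E <= H%:E ->
  exists U : set CC, [/\ measurable U,
    (forall z : R[i], (0 < complex.Re z)%R ->
       lambda%:E < \int[leb]_v (poisson (complex.Re z) (v - complex.Im z) * h v)%:E -> U z) &
    mu U <= (C * (144 / lambda * H) `^ alpha)%:E].
Proof.
move=> mh h0 l0 hH.
(* 24 is 8, from the dyadic sum, times 3, from the enlarged rational interval. *)
pose delta := (lambda / 24)%R.
have d0 : (0 < delta)%R by rewrite divr_gt0.
pose c (i : rat * rat) : R := ratr i.1.
pose r (i : rat * rat) : R := expR (ratr i.2).
have r0 i : (0 < r i)%R by exact: expR_gt0.
have [mU muU] := measure_countable_tents c r0 d0 mh h0 hH.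
eexists; split; [exact: mU| |]; last first.
  by move: muU; rewrite /delta (_ : 6 / (lambda / 24) = 144 / lambda)%R//; field; rewrite gt_eqF.
move=> z x0 hz; apply: contrapT => nU.
suff : \int[leb]_v (poisson (complex.Re z) (v - complex.Im z) * h v)%:E <= (8 * (3 * delta))%:E.
  rewrite leNgt => /negP; apply; rewrite (le_lt_trans _ hz)// lee_fin /delta.
  lra.
apply: poisson_integral_le => //; first by rewrite mulr_ge0// ltW.
move=> rho xrho; have rho0 : (0 < rho)%R by exact: lt_le_trans xrho.
(* An interval of radius more than [2 rho] with centre at distance less than
   [rho] from [Im z] contains the ball of radius [rho] about [Im z]. *)
have /rat_in_itvoo[q1] : (complex.Im z - rho < complex.Im z + rho)%R by lra.
rewrite in_itv/= => /andP[q1a q1b].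
have /rat_in_itvoo[q2] : (ln (2 * rho) < ln (3 * rho))%R by rewrite ltr_ln ?posrE; lra.
rewrite in_itv/= => /andP[q2a' q2b'].
have q2a : (2 * rho < r (q1, q2))%R.
  by rewrite -[ltLHS]lnK ?posrE ?ltr_expR// mulr_gt0.
have q2b : (r (q1, q2) < 3 * rho)%R.
  by rewrite -[ltRHS]lnK ?posrE ?ltr_expR// mulr_gt0.
have qz : (`|ratr q1 - complex.Im z| < rho)%R by rewrite ltr_distlC; lra.
apply: (@le_trans _ _ (\int[leb]_(v in ball (c (q1, q2)) (r (q1, q2))) (h v)%:E)).
  apply: ge0_subset_integral.
  - exact: measurable_ball.
  - exact: measurable_ball.
  - by apply/measurable_EFinP; exact: measurable_funTS.
  - by move=> v _; rewrite lee_fin.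
  - move=> v; rewrite /ball/= => zv.
    rewrite (_ : c _ - v = (ratr q1 - complex.Im z) + (complex.Im z - v))%R; last by rewrite /c/=; ring.
    by rewrite (le_lt_trans (ler_normD _ _))//; lra.
rewrite leNgt; apply/negP => good; apply: nU; exists (q1, q2) => /=.
  rewrite ltW// (le_lt_trans _ good)// lee_fin.
  rewrite (_ : 3 * delta * rho = delta * (3 * rho))%R; last by ring.
  by rewrite ler_wpM2l ?ltW.
by apply/tentE; split; [rewrite /ball/= /c/=; lra|lra].
Qed.

End covering.

(** * Layer cake formula and interpolation *)

Section layer_cake.
Context {R : realType}.
Notation leb := (@lebesgue_measure R).
Notation T := (measurableTypeR R).
Local Open Scope ereal_scope.

Lemma measurable_ltr_set d (X : measurableType d) (f g : X -> R) :
  measurable_fun setT f -> measurable_fun setT g ->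
  measurable [set x | (f x < g x)%R].
Proof.
move=> mf mg; have := measurable_fun_ltr mf mg measurableT (Y := [set true]).
by rewrite setTI => /(_ I); congr measurable.
Qed.

Lemma powR_expR (w s : R) : (expR w `^ s = expR (s * w))%R.
Proof. by rewrite /powR gt_eqF ?expR_gt0// expRK. Qed.

(** In the logarithmic scale [lambda = exp w] the layer cake formula for the
    power [s] only involves an exponential integral. *)
Lemma integral_expR_lt (s L : R) : (0 < s)%R -> (0 <= L)%R ->
  \int[leb]_w (expR (s * w) * \1_[set w : R | (expR w < L)%R] w)%:E = (L `^ s / s)%:E.
Proof.
move=> s0; rewrite le_eqVlt => /predU1P[<-|L0].
  rewrite powR0 ?gt_eqF// mul0r; under eq_integral => w _.
    rewrite indicE memNset/= ?mulr0; last by rewrite ltNge expR_ge0.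
    over.
  by rewrite integral0.
set W := ln L.
have lW w : (expR w < L)%R = (w < W)%R by rewrite -{1}(lnK (x := L)) ?posrE// ltr_expR.
pose f (w : R) := (expR (s * w) * \1_[set w : R | (expR w < L)%R] w)%:E.
have mf : measurable_fun (setT : set T) f.
  apply/measurable_EFinP; apply: measurable_funM.
    by apply: continuous_measurable_fun; exact: continuous_expRM.
  by apply: measurable_indic; apply: measurable_ltr_set => //; exact: measurable_expR.
have f0 w : 0 <= f w by rewrite lee_fin mulr_ge0 ?expR_ge0.
rewrite -/(\int[leb]_w f w) -(ge0_integral_shift W)// -ge0_integral_opp//; last first.
  apply: (measurableT_comp mf).
  by apply: measurable_funD.
transitivity (\int[leb]_w ((L `^ s)%:E * ((EFin \o (fun u => expR (- s * u))%R) \_ `]0%R, +oo[) w)).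
  apply: eq_integral => w _; rewrite /f patchE indicE.
  have [w0|w0] := ltP 0%R w.
    rewrite !mem_set/=; [|by rewrite in_itv/= andbT|by rewrite lW; lra].
    rewrite mulr1 /powR gt_eqF// -EFinM -expRD -/W; congr (expR _)%:E; ring.
  rewrite !memNset/= ?mulr0 ?mule0//; first by rewrite in_itv/= andbT; apply/negP; rewrite -leNgt.
  by rewrite lW; apply/negP; rewrite -leNgt; lra.
rewrite ge0_integralZl_EFin ?powR_ge0//; last 2 first.
- by move=> w _; rewrite patchE; case: ifPn => // _; rewrite lee_fin expR_ge0.
- apply/(measurable_restrictT _ _).1 => //; apply/measurable_EFinP; apply: measurable_funTS.
  by apply: continuous_measurable_fun; exact: continuous_expRM.
rewrite -integral_mkcond integral_itv_obnd_cbnd; last first.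
  apply/measurable_EFinP; apply: measurable_funTS.
  by apply: continuous_measurable_fun; exact: continuous_expRM.
by rewrite integral_expR_half// -EFinM.
Qed.

Lemma integral_powR_layer_cake d (X : measurableType d)
    (mu : {sigma_finite_measure set X -> \bar R}) (D : set X) (F : X -> R) (q : R) :
  measurable D -> measurable_fun setT F -> (forall z, (0 <= F z)%R) -> (0 < q)%R ->
  \int[mu]_(z in D) (F z `^ q)%:E =
  \int[leb]_w ((q * expR (q * w))%:E * mu (D `&` [set z | (expR w < F z)%R])).
Proof.
move=> mD mF F0 q0.
pose G (p : T * X) : R := (q * expR (q * p.1) * (\1_[set p : T * X | (expR p.1 < F p.2)%R] p * \1_D p.2))%R.
have mG : measurable_fun setT G.
  apply: measurable_funM.
    apply: measurable_funM; first exact: measurable_cst.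
    apply: (measurable_continuous_comp (h := fun w => expR (q * w))); first exact: continuous_expRM.
    exact: measurable_fst.
  apply: measurable_funM.
    apply: measurable_indic; apply: measurable_ltr_set.
      apply: (measurable_continuous_comp (h := expR)); first exact: continuous_expR.
      exact: measurable_fst.
    exact: (measurableT_comp mF measurable_snd).
  exact: (measurableT_comp (measurable_indic mD) measurable_snd).
have G0 p : 0 <= (G p)%:E by rewrite lee_fin; do ![apply: mulr_ge0 => //]; rewrite ?expR_ge0// ltW.
have mGE : measurable_fun setT (EFin \o G) by exact/measurable_EFinP.
have := @fubini_tonelli _ _ _ _ R leb mu (EFin \o G) mGE G0.
rewrite /= => e.
transitivity (\int[mu]_z \int[leb]_w (G (w, z))%:E).
  rewrite integral_mkcond; apply: eq_integral => z _.
  transitivity (\int[leb]_w ((q * \1_D z)%:E *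
      (expR (q * w) * \1_[set w : R | (expR w < F z)%R] w)%:E)).
    rewrite ge0_integralZl_EFin ?mulr_ge0 ?(ltW q0)//; last first.
      apply/measurable_EFinP; apply: measurable_funM.
        by apply: continuous_measurable_fun; exact: continuous_expRM.
      by apply: measurable_indic; apply: measurable_ltr_set => //; exact: measurable_expR.
    rewrite integral_expR_lt// patchE indicE; case: ifPn => _; last by rewrite mulr0 mul0e.
    by rewrite mulr1 -EFinM; congr EFin; field; rewrite gt_eqF.
  apply: eq_integral => w _; rewrite -EFinM /G/=; congr EFin.
  by rewrite !indicE/=; ring.
rewrite -e; apply: eq_integral => w _.
set S := [set z | (expR w < F z)%R].
have mS : measurable (D `&` S) by apply: measurableI => //; exact: measurable_ltr_set.
have -> : mu (D `&` S) = \int[mu]_z (\1_(D `&` S) z)%:E by rewrite integral_indic ?setIT.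
rewrite -ge0_integralZl_EFin//; last 2 first.
- by apply/measurable_EFinP; exact: measurable_indic.
- by apply: mulr_ge0; [exact: ltW|exact: expR_ge0].
apply: eq_integral => z _; rewrite -EFinM /G/=; congr (_ * _)%:E.
by rewrite setIC indicI/= !indicE/=.
Qed.

(** At the height [lambda] the weak bound involves [B], the integral of [phi] over
    the set where [Lam] exceeds [lambda].  Of its power [B ^ alpha], the factor
    [B ^ (alpha - 1)] is estimated by Chebyshev's inequality
    [B <= lambda ^ (- s) N], and the remaining factor [B] is integrated in
    [lambda] by Tonelli's theorem.  The case [p = 2] of the embedding uses
    [phi = h], [Lam = 2 h] and [a = s = 1]; below two, [phi = g ^ 2],
    [Lam] is a negative power of [g], [a = 2] and [s = p' - 2]. *)
Lemma integral_powR_interpolation d (X : measurableType d)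
    (mu : {sigma_finite_measure set X -> \bar R}) (D : set X) (F : X -> R)
    (phi Lam : R -> R) (a s alpha K N : R) :
  measurable D -> measurable_fun setT F -> (forall z, (0 <= F z)%R) ->
  measurable_fun (setT : set T) phi -> (forall t, (0 <= phi t)%R) ->
  measurable_fun (setT : set T) Lam -> (forall t, (0 <= Lam t)%R) ->
  (0 <= a)%R -> (0 < s)%R -> (1 <= alpha)%R -> (0 <= K)%R -> (0 <= N)%R ->
  \int[leb]_t (phi t * Lam t `^ s)%:E <= N%:E ->
  (forall lambda B, (0 < lambda)%R ->
     \int[leb]_t (phi t * \1_[set t : R | (lambda < Lam t)%R] t)%:E <= B%:E ->
     mu (D `&` [set z | (lambda < F z)%R]) <= (K * (lambda `^ (- a) * B) `^ alpha)%:E) ->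
  \int[mu]_(z in D) (F z `^ (alpha * (a + s)))%:E <=
  (K * (alpha * (a + s)) / s * N `^ alpha)%:E.
Proof.
move=> mD mF F0 mphi phi0 mLam Lam0 a0 s0 alpha1 K0 N0 hN hweak.
have alpha0 : (0 < alpha)%R by exact: lt_le_trans alpha1.
set q := (alpha * (a + s))%R.
have q0 : (0 < q)%R by rewrite mulr_gt0// ltr_wpDl.
have qe0 w : (0 <= q * expR (q * w))%R by apply: mulr_ge0; [exact: ltW|exact: expR_ge0].
pose J w t := (phi t * \1_[set t : R | (expR w < Lam t)%R] t)%R.
have J0 w t : (0 <= J w t)%R by exact: mulr_ge0.
have mJ w : measurable_fun (setT : set T) (J w).
  by apply: measurable_funM => //; apply: measurable_indic; exact: measurable_ltr_set.
have JN w : \int[leb]_t (J w t)%:E <= (expR (- s * w) * N)%:E.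
  rewrite EFinM; apply: (@le_trans _ _ ((expR (- s * w))%:E * \int[leb]_t (phi t * Lam t `^ s)%:E)); last first.
    by rewrite lee_wpmul2l ?lee_fin ?expR_ge0.
  have mpL : measurable_fun (setT : set T) (fun t => phi t * Lam t `^ s)%R.
    apply: measurable_funM => //; exact: (measurableT_comp (measurable_powR s) mLam).
  rewrite -ge0_integralZl_EFin ?expR_ge0//; last 2 first.
  - by move=> t _; rewrite lee_fin mulr_ge0 ?powR_ge0.
  - exact/measurable_EFinP.
  apply: ge0_le_integral => //.
  - by move=> t _; rewrite lee_fin.
  - exact/measurable_EFinP.
  - by apply: emeasurable_funM => //; exact/measurable_EFinP.
  - move=> t _; rewrite -EFinM lee_fin mulrCA /J ler_wpM2l// indicE.
    case: (boolP (t \in _)) => [|_]; last by rewrite /= mulr_ge0 ?expR_ge0 ?powR_ge0.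
    rewrite inE/= => wL.
    have : (expR w `^ s <= Lam t `^ s)%R by rewrite ge0_ler_powR ?nnegrE ?expR_ge0// ltW.
    rewrite powR_expR mulNr expRN => h.
    by rewrite -ler_pdivrMl ?invr_gt0 ?expR_gt0// invrK mulr1.
pose b w := fine (\int[leb]_t (J w t)%:E).
have bE w : \int[leb]_t (J w t)%:E = (b w)%:E.
  rewrite fineK// ge0_fin_numE; first by rewrite (le_lt_trans (JN w))// ltry.
  by apply: integral_ge0 => t _; rewrite lee_fin.
have b0 w : (0 <= b w)%R by rewrite fine_ge0//; apply: integral_ge0 => t _; rewrite lee_fin.
have bN w : (b w <= expR (- s * w) * N)%R by rewrite -lee_fin -bE.
rewrite integral_powR_layer_cake//.
pose c := (q * K * N `^ (alpha - 1))%R.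
have c0 : (0 <= c)%R by rewrite mulr_ge0 ?powR_ge0// mulr_ge0// ltW.
have mEJ : measurable_fun setT (fun p : T * T => (expR (s * p.1) * J p.1 p.2)%:E).
  apply/measurable_EFinP; apply: measurable_funM.
    apply: (measurable_continuous_comp (h := fun w => expR (s * w))); first exact: continuous_expRM.
    exact: measurable_fst.
  apply: measurable_funM; first exact: (measurableT_comp mphi measurable_snd).
  apply: (measurable_indic (U := [set p : T * T | (expR p.1 < Lam p.2)%R])).
  apply: measurable_ltr_set.
    apply: (measurable_continuous_comp (h := expR)); first exact: continuous_expR.
    exact: measurable_fst.
  exact: (measurableT_comp mLam measurable_snd).
have EJ0 p : 0 <= (expR (s * p.1) * J p.1 p.2)%:E by rewrite lee_fin mulr_ge0 ?expR_ge0.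
have mmu : measurable_fun (setT : set T) (fun w => mu (D `&` [set z | (expR w < F z)%R])).
  pose A : set (T * X) := [set p | (expR p.1 < F p.2)%R] `&` (setT `*` D).
  have mA : measurable A.
    apply: measurableI; last exact: measurableX.
    apply: measurable_ltr_set; last exact: (measurableT_comp mF measurable_snd).
    apply: (measurable_continuous_comp (h := expR)); first exact: continuous_expR.
    exact: measurable_fst.
  have := measurable_fun_xsection mu mA; congr (measurable_fun _).
  apply/funext => w; congr (mu _); apply/seteqP; split => z.
    by rewrite /xsection /= inE => -[/= ? []].
  by rewrite /xsection /= inE => -[? ?].
apply: (@le_trans _ _ (\int[leb]_w (c%:E * \int[leb]_t (expR (s * w) * J w t)%:E))).
  apply: ge0_le_integral => //.
  - by move=> w _; rewrite mule_ge0// lee_fin.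
  - apply: emeasurable_funM => //; apply/measurable_EFinP; apply: measurable_funM => //.
    by apply: continuous_measurable_fun; exact: continuous_expRM.
  - by apply: emeasurable_funM => //; exact: (measurable_fun_fubini_tonelli_F _ mEJ).
  - move=> w _; have h := hweak (expR w) (b w) (expR_gt0 _).
    have {}h := h _; rewrite -/(J w _) in h.
    apply: (@le_trans _ _ ((q * expR (q * w))%:E * (K * (expR w `^ (- a) * b w) `^ alpha)%:E)).
      rewrite lee_wpmul2l ?lee_fin ?qe0//.
      by apply: h; rewrite -bE.
    under eq_integral do rewrite EFinM.
    rewrite ge0_integralZl_EFin ?expR_ge0//; last 2 first.
    + by move=> t _; rewrite lee_fin.
    + exact/measurable_EFinP.
    rewrite bE -!EFinM lee_fin powR_expR.
    set y := (expR (- a * w) * b w)%R.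
    have y0 : (0 <= y)%R by rewrite mulr_ge0 ?expR_ge0.
    rewrite -(mulr_powRB1 y0 alpha0).
    have yN : (y `^ (alpha - 1) <= expR (- (a + s) * (alpha - 1) * w) * N `^ (alpha - 1))%R.
      have -> : expR (- (a + s) * (alpha - 1) * w) = (expR (- (a + s) * w) `^ (alpha - 1))%R.
        by rewrite powR_expR; congr expR; ring.
      rewrite -powRM ?expR_ge0// ge0_ler_powR ?nnegrE ?subr_ge0// ?mulr_ge0 ?expR_ge0//.
      rewrite /y (_ : - (a + s) * w = - a * w + - s * w)%R; last by ring.
      by rewrite expRD -mulrA ler_wpM2l ?expR_ge0.
    apply: (@le_trans _ _ (q * expR (q * w) * (K * (y * (expR (- (a + s) * (alpha - 1) * w) * N `^ (alpha - 1)))))%R).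
      by rewrite ler_wpM2l ?qe0// ler_wpM2l// ler_wpM2l.
    rewrite /y /c.
    rewrite (_ : expR (s * w) = (expR (q * w) * expR (- a * w) * expR (- (a + s) * (alpha - 1) * w))%R); last first.
      by rewrite -!expRD /q; congr expR; ring.
    rewrite le_eqVlt; apply/orP; left; apply/eqP; ring.
rewrite ge0_integralZl_EFin//; last 2 first.
- by move=> w _; apply: integral_ge0 => t _; exact: (EJ0 (w, t)).
- exact: (measurable_fun_fubini_tonelli_F _ mEJ).
rewrite (fubini_tonelli _ mEJ EJ0)/=.
apply: (@le_trans _ _ (c%:E * \int[leb]_t ((s^-1)%:E * (phi t * Lam t `^ s)%:E))).
  rewrite le_eqVlt; apply/orP; left; apply/eqP; congr (_ * _).
  apply: eq_integral => t _.
  transitivity (\int[leb]_w ((phi t)%:E * (expR (s * w) * \1_[set w : R | (expR w < Lam t)%R] w)%:E)).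
    by apply: eq_integral => w _; rewrite -EFinM /J !indicE/=; congr EFin; ring.
  rewrite ge0_integralZl_EFin//; last first.
    apply/measurable_EFinP; apply: measurable_funM.
      by apply: continuous_measurable_fun; exact: continuous_expRM.
    by apply: measurable_indic; apply: measurable_ltr_set => //; exact: measurable_expR.
  by rewrite integral_expR_lt// -!EFinM; congr EFin; ring.
rewrite ge0_integralZl_EFin ?invr_ge0 ?(ltW s0)//; last 2 first.
- by move=> t _; rewrite lee_fin mulr_ge0 ?powR_ge0.
- apply/measurable_EFinP; apply: measurable_funM => //; exact: (measurableT_comp (measurable_powR s) mLam).
apply: (@le_trans _ _ (c%:E * ((s^-1)%:E * N%:E))).
  by rewrite lee_wpmul2l ?lee_fin// lee_wpmul2l ?lee_fin ?invr_ge0 ?(ltW s0).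
rewrite -!EFinM lee_fin /c -(mulr_powRB1 N0 alpha0) -/q.
by rewrite le_eqVlt; apply/orP; left; apply/eqP; ring.
Qed.

End layer_cake.

(** * Carleson embedding of transforms of nonnegative functions *)

Lemma cvg_powR {R : realType} (u : nat -> R) (l r : R) : 0 < r -> (forall n, 0 <= u n) ->
  u n @[n --> \oo] --> l -> u n `^ r @[n --> \oo] --> l `^ r.
Proof.
move=> r0 u0 ul; have l0 : 0 <= l.
  by rewrite -(cvg_lim _ ul)//; apply: limr_ge => //; [exact: cvgP ul|exact: nearW].
move: l0; rewrite le_eqVlt => /predU1P[l0|l0].
  rewrite -{l}l0 in ul *; rewrite powR0 ?gt_eqF//.
  apply/cvgrPdist_lt => e e0.
  have e'0 : 0 < e `^ r^-1 by rewrite powR_gt0.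
  move/cvgrPdist_lt : ul => /(_ _ e'0); apply: filterS => n.
  rewrite !sub0r !normrN (ger0_norm (u0 n)) ger0_norm ?powR_ge0// => un.
  rewrite (_ : e = (e `^ r^-1) `^ r); first by rewrite gt0_ltr_powR ?nnegrE// ltW.
  by rewrite -powRrM mulVf ?gt_eqF// powRr1// ltW.
have [lnl pl] : {for l, continuous (@ln R)} /\ l `^ r = expR (r * ln l).
  by split; [exact: continuous_ln|rewrite /powR gt_eqF].
rewrite pl; apply: (@cvg_trans _ (expR (r * ln (u n)) @[n --> \oo])).
  apply: near_eq_cvg; near=> n; rewrite /powR gt_eqF//.
  near: n; exact: cvgr_gt ul _ l0.
have lc : r * ln (u n) @[n --> \oo] --> r * ln l.
  by apply: cvgMr; exact: (cvg_comp _ _ ul lnl).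
exact: (cvg_comp _ _ lc (@continuous_expR R _)).
Unshelve. all: by end_near. Qed.

Section embedding.
Context {R : realType}.

Lemma measurable_abs d (U : measurableType d) (f : U -> R) :
  measurable_fun setT f -> measurable_fun setT (fun x => `|f x|).
Proof.
move=> mf; apply: (measurable_continuous_comp (h := fun x : R => `|x|)) => //.
exact: norm_continuous.
Qed.

Notation leb := (@lebesgue_measure R).
Notation T := (measurableTypeR R).
Notation CC := (borelC R).
Notation H := (@right_half_plane R : set CC).

(** The transform of [g] at [x + i y], with kernel [exp (- x t) cos (y t + theta)]:
    for [theta] equal to [0] and to [pi / 2] it is the real part and the
    imaginary part of the Laplace transform of [g]. *)
Definition phase_laplace (theta : R) (g : R -> R) (z : R[i]) : R :=
  cosT theta (fun t => expR (- complex.Re z * t) * g t) (complex.Im z).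

Lemma measurable_phase_laplace (theta : R) (g : R -> R) : measurable_fun (setT : set T) g ->
  measurable_fun (setT : set CC) (phase_laplace theta g).
Proof.
move=> mg; apply: (@measurable_Rintegral R _ CC (fun z t =>
  cos (complex.Im z * t + theta) * (expR (- complex.Re z * t) * g t))).
have mR : measurable_fun setT (fun z : CC * T => complex.Re (z.1 : R[i])).
  exact: (measurableT_comp measurable_Re measurable_fst).
have mI : measurable_fun setT (fun z : CC * T => complex.Im (z.1 : R[i])).
  exact: (measurableT_comp measurable_Im measurable_fst).
apply: measurable_funM.
  apply: (measurable_continuous_comp (h := cos)); first exact: continuous_cos.
  apply: measurable_funD; last exact: measurable_cst.
  by apply: measurable_funM => //; exact: measurable_snd.
apply: measurable_funM; last exact: (measurableT_comp mg measurable_snd).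
apply: (measurable_continuous_comp (h := expR)); first exact: continuous_expR.
by apply: measurable_funM; [exact: measurableT_comp|exact: measurable_snd].
Qed.

Section integrable.
Variables (theta : R) (g : R -> R).
Hypotheses (mg : measurable_fun (setT : set T) g).
Hypotheses (g0 : forall t, 0 <= g t) (gN : forall t, t < 0 -> g t = 0).

Lemma integrable_damped (z : R[i]) : leb.-integrable setT (EFin \o g) ->
  0 <= complex.Re z ->
  leb.-integrable setT (EFin \o (fun t => expR (- complex.Re z * t) * g t)).
Proof.
move=> ig x0; apply: (@le_integrableR _ T R leb setT _ g) => //.
  apply: measurable_funM => //.
  by apply: continuous_measurable_fun; exact: continuous_expRM.
move=> t _; have [t0|t0] := ltP t 0; first by rewrite gN// mulr0 normr0.
rewrite normrM (ger0_norm (expR_ge0 _)) (ger0_norm (g0 _)) ler_piMl//.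
by rewrite -[leRHS]expR0 ler_expR mulNr oppr_le0 mulr_ge0.
Qed.

Lemma phase_laplace_le (z : R[i]) : leb.-integrable setT (EFin \o g) -> 0 <= complex.Re z ->
  `|phase_laplace theta g z| <= \int[leb]_t g t.
Proof.
move=> ig x0; apply: (le_trans (cosT_bound _ (integrable_damped ig x0) _ _)).
  apply: measurable_funM => //.
  by apply: continuous_measurable_fun; exact: continuous_expRM.
apply: le_Rintegral => //.
  exact: (integrable_norm (integrable_damped ig x0)).
move=> t _; have [t0|t0] := ltP t 0; first by rewrite gN// mulr0 normr0.
rewrite normrM (ger0_norm (expR_ge0 _)) (ger0_norm (g0 _)) ler_piMl//.
by rewrite -[leRHS]expR0 ler_expR mulNr oppr_le0 mulr_ge0.
Qed.

End integrable.

Variables (mu : {sigma_finite_measure set CC -> \bar R}) (C alpha : R).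
Hypotheses (C0 : 0 < C) (alpha1 : 1 <= alpha).
Hypothesis carleson : forall (l r : bool) (a b : R), a <= b ->
  (mu (carleson_square l r a b) <= (C * (b - a) `^ alpha)%:E)%E.

Let alpha0 : 0 < alpha. Proof. exact: lt_le_trans alpha1. Qed.
Let mH : measurable H. Proof. exact: measurable_right_half_plane. Qed.

Local Open Scope ereal_scope.

(** The part of [|F_0|] below [lambda / 2] contributes at most [pi lambda / 2] to
    the Poisson integral, because the kernel has mass [pi]; so only the part above,
    whose integral is [B], counts. *)
Let measure_phase_laplace_gt (theta : R) (g : R -> R) (lambda B : R) :
  measurable_fun (setT : set T) g -> leb.-integrable setT (EFin \o g) ->
  (forall t, (0 <= g t)%R) -> (forall t, (t < 0)%R -> g t = 0%R) -> (0 < lambda)%R ->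
  let h : R -> R := (fun v => `|cosT theta g v|)%R in
  \int[leb]_v (h v * \1_[set v : R | (lambda < 2 * h v)%R] v)%:E <= B%:E ->
  mu (H `&` [set z | (lambda < `|phase_laplace theta g z|)%R]) <=
  (C * (288 / pi) `^ alpha * (lambda `^ (- 1) * B) `^ alpha)%:E.
Proof.
move=> mg ig g0 gN l0 h hB.
have mC := measurable_cosT theta mg.
have mh : measurable_fun (setT : set T) h.
  exact: measurable_abs.
have h0 v : (0 <= h v)%R by exact: normr_ge0.
pose S := [set v : R | (lambda < 2 * h v)%R].
have mS : measurable (S : set T).
  by apply: measurable_ltr_set => //; exact: measurable_funM.
pose h1 v := (h v * \1_S v)%R.
have mh1 : measurable_fun (setT : set T) h1.
  by apply: measurable_funM => //; exact: measurable_indic.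
have h10 v : (0 <= h1 v)%R by exact: mulr_ge0.
have l'0 : (0 < pi * lambda / 2)%R by rewrite divr_gt0// mulr_gt0// pi_gt0.
have [U [mU hU muU]] := measure_poisson_gt C0 alpha1 carleson mh1 h10 l'0 hB.
have B0 : (0 <= B)%R.
  by rewrite -lee_fin (le_trans _ hB)//; apply: integral_ge0 => v _; rewrite lee_fin h10.
apply: (@le_trans _ _ (mu U)).
  apply: le_measure; rewrite ?inE//.
    apply: measurableI => //; apply: measurable_ltr_set => //.
    by apply: measurable_abs; exact: measurable_phase_laplace.
  move=> z [Hz lz]; apply: hU => //.
  set x := complex.Re z; set y := complex.Im z.
  have x0 : (0 < x)%R by exact: Hz.
  have mP := measurable_poisson_shift y x0.
  have iPh : leb.-integrable setT (EFin \o (fun v => poisson x (v - y) * cosT theta g v)%R).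
    apply: (@le_integrableR _ T R leb setT _ (fun v => (\int[leb]_t `|g t|)%R * poisson x (v - y))%R) => //.
    - exact: measurable_funM.
    - move=> v _; rewrite normrM (ger0_norm (poisson_ge0 _ x0)) mulrC.
      apply: ler_wpM2r; first exact: poisson_ge0.
      exact: cosT_bound.
    - by apply: integrableRZl => //; exact: integrable_poisson.
  have e := poisson_cosT mg ig y theta x0 gN.
  have : (pi * lambda)%:E < \int[leb]_v (poisson x (v - y) * h v)%:E.
    apply: (@lt_le_trans _ _ (pi * `|phase_laplace theta g z|)%:E).
      by rewrite lte_fin ltr_pM2l// pi_gt0.
    rewrite -[X in (X * _)%:E](ger0_norm (pi_ge0 R)) -normrM -e.
    apply: (@le_trans _ _ (\int[leb]_v `|poisson x (v - y) * cosT theta g v|)%R%:E).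
      by rewrite lee_fin; exact: le_normr_Rintegral.
    rewrite EFin_Rintegral//; last exact: integrable_norm.
    apply: ge0_le_integral => //.
    - by apply/measurable_EFinP; apply: measurable_abs; exact: measurable_funM.
    - by apply/measurable_EFinP; exact: measurable_funM.
    - by move=> v _; rewrite lee_fin normrM (ger0_norm (poisson_ge0 _ x0)).
  have hle : \int[leb]_v (poisson x (v - y) * h v)%:E <=
     \int[leb]_v (poisson x (v - y) * h1 v)%:E + (pi * lambda / 2)%:E.
    have -> : (pi * lambda / 2)%:E = \int[leb]_v ((lambda / 2)%:E * (poisson x (v - y))%:E).
      rewrite ge0_integralZl_EFin//; last 3 first.
      - by move=> v _; rewrite lee_fin poisson_ge0.
      - exact/measurable_EFinP.
      - by rewrite divr_ge0// ltW.
      by rewrite integral_poisson// -EFinM; congr EFin; ring.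
    rewrite -ge0_integralD//; last 4 first.
    - by move=> v _; rewrite lee_fin; apply: mulr_ge0 => //; exact: poisson_ge0.
    - by apply/measurable_EFinP; exact: measurable_funM.
    - by move=> v _; rewrite -EFinM lee_fin; apply: mulr_ge0; [rewrite divr_ge0// ltW|exact: poisson_ge0].
    - by apply/measurable_EFinP; exact: measurable_funM.
    apply: ge0_le_integral => //.
    - by move=> v _; rewrite lee_fin; apply: mulr_ge0 => //; exact: poisson_ge0.
    - by apply/measurable_EFinP; exact: measurable_funM.
    - by apply: emeasurable_funD; apply/measurable_EFinP; exact: measurable_funM.
    - move=> v _; rewrite -EFinM -EFinD lee_fin (mulrC (lambda / 2)%R) -mulrDr.
      apply: ler_wpM2l; first exact: poisson_ge0.
      rewrite /h1 indicE; case: (boolP (v \in S)) => [_|/negP vS].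
        by rewrite mulr1 lerDl divr_ge0// ltW.
      have : ~~ (lambda < 2 * h v)%R by apply/negP => vl; apply: vS; rewrite inE.
      by rewrite mulr0 add0r -leNgt; lra.
  move=> /lt_le_trans/(_ hle).
  rewrite -lteBlDr// -EFinB (_ : pi * lambda - pi * lambda / 2 = pi * lambda / 2)%R//; by field.
have E1 : (288 / pi * (lambda `^ (- 1) * B) = 144 / (pi * lambda / 2) * B)%R.
  rewrite powRN powRr1 ?(ltW l0)//; move: (@pi R) (pi_gt0 R) => P P0; field.
  by rewrite (gt_eqF l0) (gt_eqF P0).
have c0 : (0 <= 288 / pi :> R)%R by apply: divr_ge0; [exact: ler0n|exact: pi_ge0].
have lB0 : (0 <= lambda `^ (- 1) * B)%R by rewrite mulr_ge0// powR_ge0.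
by move: muU; rewrite -E1 (powRM alpha c0 lB0) [in X in _ <= X%:E -> _]mulrA.
Qed.

Let K2 := (C * (288 / pi) `^ alpha * (alpha * (1 + 1)) / 1 * (4 * pi) `^ alpha)%R.

Let K20 : (0 <= K2)%R.
Proof. by rewrite /K2 !mulr_ge0 ?powR_ge0 ?invr_ge0 ?(ltW C0) ?(ltW alpha0). Qed.

(** The weak estimate for the part of [|F_0|] above [lambda / 2] is integrated in
    [lambda], and the Bessel inequality bounds the outcome. *)
Let embedding2 (theta : R) (g : R -> R) (N : R) :
  measurable_fun (setT : set T) g -> leb.-integrable setT (EFin \o g) ->
  (forall t, (0 <= g t)%R) -> (forall t, (t < 0)%R -> g t = 0%R) ->
  (0 <= N)%R -> \int[leb]_t (g t ^+ 2)%:E <= N%:E ->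
  \int[mu]_(z in H) (`|phase_laplace theta g z| `^ (alpha * (1 + 1)))%:E <= (K2 * N `^ alpha)%:E.
Proof.
move=> mg ig g0 gN N0 hN.
have mC := measurable_cosT theta mg.
pose h (v : R) : R := `|cosT theta g v|%R.
have mh : measurable_fun (setT : set T) h.
  exact: measurable_abs.
have pN0 : (0 <= 4 * pi * N)%R by rewrite !mulr_ge0// pi_ge0.
have h0 v : (0 <= h v)%R by exact: normr_ge0.
have pi4 : (0 <= 4 * pi :> R)%R by rewrite mulr_ge0// pi_ge0.
have -> : (K2 * N `^ alpha = C * (288 / pi) `^ alpha * (alpha * (1 + 1)) / 1 * (4 * pi * N) `^ alpha)%R.
  by rewrite (powRM _ pi4 N0) mulrA.
apply: (@integral_powR_interpolation R _ CC mu H (fun z => `|phase_laplace theta g z|%R) h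
  (fun v => 2 * h v)%R).
- exact: mH.
- by apply: measurable_abs; exact: measurable_phase_laplace.
- by move=> z; exact: normr_ge0.
- exact: mh.
- exact: h0.
- exact: measurable_funM.
- by move=> t; rewrite mulr_ge0.
- exact: ler01.
- exact: ltr01.
- exact: alpha1.
- by apply: mulr_ge0; [exact: ltW|exact: powR_ge0].
- exact: mulr_ge0.
- rewrite (_ : (4 * pi * N)%:E = 2%:E * ((2 * pi)%:E * N%:E)); last first.
    by rewrite -!EFinM; congr EFin; ring.
  apply: (@le_trans _ _ (2%:E * \int[leb]_v (cosT theta g v ^+ 2)%:E)).
    rewrite -ge0_integralZl_EFin//; last 2 first.
    - by move=> v _; rewrite lee_fin sqr_ge0.
    - by apply/measurable_EFinP; exact: measurable_funX.
    rewrite le_eqVlt; apply/orP; left; apply/eqP; apply: eq_integral => v _.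
    rewrite powRr1 ?mulr_ge0// -EFinM /h -[(cosT _ _ _ ^+ 2)%R]real_normK ?num_real//.
    by congr EFin; ring.
  rewrite lee_wpmul2l// (le_trans (bessel_cosT theta mg ig g0 gN))//.
  by rewrite lee_wpmul2l// lee_fin mulr_ge0// pi_ge0.
- by move=> lambda B l0 hB; exact: measure_phase_laplace_gt.
Qed.

(** Chebyshev's inequality for the previous estimate: the weak form that the
    interpolation below the exponent two needs. *)
Let measure_gt_phase_laplace (theta : R) (g : R -> R) (lambda N : R) :
  measurable_fun (setT : set T) g -> leb.-integrable setT (EFin \o g) ->
  (forall t, (0 <= g t)%R) -> (forall t, (t < 0)%R -> g t = 0%R) -> (0 < lambda)%R ->
  \int[leb]_t (g t ^+ 2)%:E <= N%:E ->
  mu (H `&` [set z | (lambda < `|phase_laplace theta g z|)%R]) <=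
  (K2 * (lambda `^ (- 2) * N) `^ alpha)%:E.
Proof.
move=> mg ig g0 gN l0 hN.
have N0 : (0 <= N)%R.
  by rewrite -lee_fin (le_trans _ hN)//; apply: integral_ge0 => v _; rewrite lee_fin sqr_ge0.
set E := H `&` _.
have mL := measurable_abs (measurable_phase_laplace theta mg).
have mE : measurable E by apply: measurableI => //; exact: measurable_ltr_set.
have p0 : (0 < lambda `^ (alpha * (1 + 1)))%R by rewrite powR_gt0.
have mLp : measurable_fun (setT : set CC) (fun z => (`|phase_laplace theta g z| `^ (alpha * (1 + 1)))%:E).
  by apply/measurable_EFinP; exact: (measurableT_comp (measurable_powR _) mL).
have cheb : (lambda `^ (alpha * (1 + 1)))%:E * mu E <= (K2 * N `^ alpha)%:E.
  rewrite -integral_cst//.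
  apply: (@le_trans _ _ (\int[mu]_(z in E) (`|phase_laplace theta g z| `^ (alpha * (1 + 1)))%:E)).
    apply: ge0_le_integral => //.
    - by move=> z _; rewrite lee_fin powR_ge0.
    - exact: measurable_funTS.
    - move=> z [_ /= /ltW lz]; rewrite lee_fin ge0_ler_powR ?nnegrE ?mulr_ge0 ?(ltW alpha0) ?(ltW l0)//.
  apply: le_trans (embedding2 theta mg ig g0 gN N0 hN).
  apply: ge0_subset_integral => //; last by move=> z [].
  exact: measurable_funTS.
move: cheb; rewrite -lee_pdivlMl// => /le_trans; apply.
rewrite -EFinM lee_fin mulrCA ler_wpM2l// powRM ?powR_ge0//.
rewrite -powRrM -powRN (_ : - (alpha * (1 + 1)) = - 2 * alpha)%R//; ring.
Qed.

(** Marcinkiewicz interpolation between the estimate at the exponent two and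
    the trivial bound of the transform by the integral of [g].  At the height [lambda]
    the function is cut where [g] exceeds a power of [lambda] chosen such that
    the large part contributes at most [lambda / 2]. *)
Let embedding_lt2 (p p' : R) : (1 < p < 2)%R -> (p^-1 + p'^-1 = 1)%R ->
  exists2 K : R, (0 <= K)%R &
  forall (theta : R) (g : R -> R) (N : R),
  measurable_fun (setT : set T) g -> leb.-integrable setT (EFin \o g) ->
  (forall t, (0 <= g t)%R) -> (forall t, (t < 0)%R -> g t = 0%R) -> (0 < N)%R ->
  \int[leb]_t (g t `^ p)%:E <= N%:E ->
  \int[mu]_(z in H) (`|phase_laplace theta g z| `^ (alpha * p'))%:E <=
  (K * N `^ (alpha * (p' - 1)))%:E.
Proof.
move=> /andP[p1 p2] pp'.
have p0 : (0 < p)%R by apply: lt_trans p1.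
have p'0 : (p' != 0)%R.
  apply/negP => /eqP p'0; move: pp'; rewrite p'0 invr0 addr0 => pE.
  by have := p1; rewrite -(invrK p) pE invr1 ltxx.
have pE : (p' * (p - 1) = p)%R.
  have : ((p^-1 + p'^-1) * (p * p') = p * p')%R by rewrite pp' mul1r.
  rewrite mulrDl (_ : p^-1 * (p * p') = p')%R; last by field; rewrite gt_eqF.
  rewrite (_ : p'^-1 * (p * p') = p)%R; last by field.
  by move=> e; rewrite mulrBr mulr1 [(p' * p)%R]mulrC -e; ring.
have p'2 : (2 < p')%R.
  have : (0 < (p' - 2) * (p - 1))%R by rewrite mulrBl pE; lra.
  by rewrite pmulr_lgt0 ?subr_gt0.
pose s := (p' - 2)%R.
have s0 : (0 < s)%R by rewrite subr_gt0.
have sE : ((1 - p) * s = p - 2)%R.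
  rewrite /s (_ : (1 - p) * (p' - 2) = 2 * (p - 1) - p' * (p - 1))%R; last by ring.
  by rewrite pE; ring.
pose K4 := (K2 * 4 `^ alpha)%R.
have K40 : (0 <= K4)%R by rewrite mulr_ge0 ?powR_ge0.
exists (K4 * (alpha * (2 + s)) / s * (2 `^ s) `^ alpha)%R.
  apply: mulr_ge0; last exact: powR_ge0.
  by rewrite divr_ge0 ?(ltW s0)// mulr_ge0// mulr_ge0 ?(ltW alpha0)// addr_ge0// ltW.
move=> theta g N mg ig g0 gN N0 hN.
(* [Lam t < lambda] says that [g t] is large.  It also holds where [g] vanishes,
   the power of 0 being 0, but such points contribute nothing. *)
pose Lam t := (2 * N * (g t `^ (1 - p)))%R.
have mgp (r : R) : measurable_fun (setT : set T) (fun t => g t `^ r)%R.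
  exact: (measurableT_comp (measurable_powR r) mg).
have mLam : measurable_fun (setT : set T) Lam by exact: measurable_funM.
have Lam0 t : (0 <= Lam t)%R by rewrite mulr_ge0 ?powR_ge0// mulr_ge0// ltW.
have -> : (alpha * p' = alpha * (2 + s))%R by rewrite /s addrC subrK.
have NE : (K4 * (alpha * (2 + s)) / s * (2 `^ s) `^ alpha * N `^ (alpha * (p' - 1)) =
   K4 * (alpha * (2 + s)) / s * (2 `^ s * N `^ (s + 1)) `^ alpha)%R.
  have -> : (alpha * (p' - 1) = (s + 1) * alpha)%R by rewrite /s; ring.
  by rewrite (powRrM N) (powRM alpha (powR_ge0 2 s) (powR_ge0 N (s + 1))) [RHS]mulrA.
rewrite NE.
apply: (@integral_powR_interpolation R _ CC mu H (fun z => `|phase_laplace theta g z|%R)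
  (fun t => g t ^+ 2)%R Lam).
- exact: mH.
- by apply: measurable_abs; exact: measurable_phase_laplace.
- by move=> z; exact: normr_ge0.
- exact: measurable_funX.
- by move=> t; exact: sqr_ge0.
- exact: mLam.
- exact: Lam0.
- exact: ler0n.
- exact: s0.
- exact: alpha1.
- exact: K40.
- by apply: mulr_ge0; exact: powR_ge0.
- have E t : (g t ^+ 2 * Lam t `^ s = 2 `^ s * N `^ s * g t `^ p)%R.
    rewrite /Lam powRM ?powR_ge0 ?mulr_ge0 ?(ltW N0)// powRM ?(ltW N0)// -powRrM sE.
    have [->|gt0] := eqVneq (g t) 0%R.
      by rewrite expr2 !mul0r [in RHS]powR0 ?mulr0// gt_eqF.
    rewrite mulrCA -powR_mulrn// -powRD; last by rewrite gt0 implybT.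
    by rewrite (_ : 2%:R + (p - 2) = p)%R//; ring.
  under eq_integral do rewrite E EFinM.
  rewrite ge0_integralZl_EFin//; last 3 first.
  + by move=> t _; rewrite lee_fin powR_ge0.
  + exact/measurable_EFinP.
  + by apply: mulr_ge0; exact: powR_ge0.
  apply: (@le_trans _ _ ((2 `^ s * N `^ s)%:E * N%:E)).
    by rewrite lee_wpmul2l// lee_fin; apply: mulr_ge0; exact: powR_ge0.
  rewrite -EFinM lee_fin -mulrA -[X in (_ * (_ * X))%R](powRr1 (ltW N0)) -powRD//.
  by rewrite (gt_eqF N0) implybT.
- move=> lambda B l0 hB.
  pose S := [set t : R | (lambda < Lam t)%R].
  have mS : measurable (S : set T) by apply: measurable_ltr_set.
  pose g1 t := (g t * \1_(~` S) t)%R.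
  pose g2 t := (g t * \1_S t)%R.
  have gE t : g t = (g1 t + g2 t)%R.
    rewrite /g1 /g2 -mulrDr !indicE in_setC.
    by case: (t \in S); rewrite /= ?addr0 ?add0r mulr1.
  have g10 t : (0 <= g1 t)%R by apply: mulr_ge0.
  have g20 t : (0 <= g2 t)%R by apply: mulr_ge0.
  have mg1 : measurable_fun (setT : set T) g1.
    by apply: measurable_funM => //; apply: measurable_indic; exact: measurableC.
  have mg2 : measurable_fun (setT : set T) g2.
    by apply: measurable_funM => //; exact: measurable_indic.
  have g1N t : (t < 0)%R -> g1 t = 0%R by move=> t0; rewrite /g1 gN// mul0r.
  have g2N t : (t < 0)%R -> g2 t = 0%R by move=> t0; rewrite /g2 gN// mul0r.
  have ig1 : leb.-integrable setT (EFin \o g1).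
    apply: (@le_integrableR _ T R leb setT _ g) => // t _.
    by rewrite ger0_norm// gE lerDl.
  have ig2 : leb.-integrable setT (EFin \o g2).
    apply: (@le_integrableR _ T R leb setT _ g) => // t _.
    by rewrite ger0_norm// [leRHS]gE lerDr.
  have g1le t : (g1 t <= lambda / (2 * N) * g t `^ p)%R.
    have [tS|tS] := boolP (t \in S).
      rewrite /g1 indicE in_setC tS mulr0 mulr_ge0 ?powR_ge0// divr_ge0 ?(ltW l0)//.
      by rewrite mulr_ge0// ltW.
    rewrite /g1 indicE in_setC tS mulr1.
    have : ~~ (lambda < Lam t)%R by apply/negP => tl; move/negP: tS; apply; rewrite inE.
    rewrite -leNgt => tl.
    have [->|gt0] := eqVneq (g t) 0%R; first by rewrite powR0 ?mulr0// gt_eqF.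
    have gE1 : g t = (g t `^ p * g t `^ (1 - p))%R.
      by rewrite -powRD ?gt0 ?implybT// addrC subrK powRr1.
    rewrite {1}gE1 mulrC ler_wpM2r ?powR_ge0//.
    by rewrite ler_pdivlMr ?mulr_gt0// mulrC.
  have intg1 : (\int[leb]_t g1 t <= lambda / 2)%R.
    rewrite -lee_fin EFin_Rintegral//.
    apply: (@le_trans _ _ (\int[leb]_t ((lambda / (2 * N))%:E * (g t `^ p)%:E))).
      apply: ge0_le_integral => //.
      - by move=> t _; rewrite lee_fin.
      - exact/measurable_EFinP.
      - by apply: emeasurable_funM => //; exact/measurable_EFinP.
      - by move=> t _; rewrite -EFinM lee_fin.
    rewrite ge0_integralZl_EFin//; last 3 first.
    + by move=> t _; rewrite lee_fin powR_ge0.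
    + exact/measurable_EFinP.
    + by rewrite divr_ge0 ?(ltW l0)// mulr_ge0// ltW.
    apply: (@le_trans _ _ ((lambda / (2 * N))%:E * N%:E)).
      by rewrite lee_wpmul2l// lee_fin divr_ge0 ?(ltW l0)// mulr_ge0// ltW.
    rewrite -EFinM lee_fin le_eqVlt; apply/orP; left; apply/eqP.
    by field; rewrite gt_eqF.
  have B0 : (0 <= B)%R.
    rewrite -lee_fin (le_trans _ hB)//; apply: integral_ge0 => v _; rewrite lee_fin.
    by apply: mulr_ge0 => //; exact: sqr_ge0.
  have hB' : \int[leb]_t (g2 t ^+ 2)%:E <= B%:E.
    apply: le_trans hB; rewrite le_eqVlt; apply/orP; left; apply/eqP.
    apply: eq_integral => t _; rewrite /g2 exprMn; congr (_ * _)%:E.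
    by rewrite indicE; case: (_ \in _); rewrite ?expr1n// expr0n.
  have l20 : (0 < lambda / 2)%R by rewrite divr_gt0.
  have := measure_gt_phase_laplace theta mg2 ig2 g20 g2N l20 hB'.
  have -> : (K2 * ((lambda / 2) `^ (- 2) * B) `^ alpha = K4 * (lambda `^ (- 2) * B) `^ alpha)%R.
    have h2 : (0 <= 2^-1 :> R)%R by rewrite invr_ge0.
    have lB0 : (0 <= lambda `^ (- 2) * B)%R by rewrite mulr_ge0// powR_ge0.
    have h4 : (0 <= 4 :> R)%R by rewrite ler0n.
    rewrite (powRM (- 2) (ltW l0) h2).
    have -> : (2^-1 `^ (- 2) = 4 :> R)%R.
      by rewrite -powR_inv1// -powRrM mulN1r opprK powR_mulrn//; ring.
    have -> : (lambda `^ (- 2) * 4 * B = 4 * (lambda `^ (- 2) * B))%R by ring.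
    by rewrite (powRM _ h4 lB0) mulrA.
  apply: le_trans; apply: le_measure; rewrite ?inE.
  + apply: measurableI => //; apply: measurable_ltr_set => //; apply: measurable_abs.
    exact: measurable_phase_laplace.
  + apply: measurableI => //; apply: measurable_ltr_set => //; apply: measurable_abs.
    exact: measurable_phase_laplace.
  + move=> z [Hz /= lz]; split => //=.
    have x0 : (0 <= complex.Re z)%R by apply/ltW; exact: Hz.
    have mcos : measurable_fun (setT : set T) (fun t => cos (complex.Im z * t + theta)).
      apply: (measurable_continuous_comp (h := cos)); first exact: continuous_cos.
      by apply: measurable_funD => //; exact: measurable_funM.
    have mex : measurable_fun (setT : set T) (fun t => expR (- complex.Re z * t)).
      by apply: continuous_measurable_fun; exact: continuous_expRM.
    have LE : phase_laplace theta g z = (phase_laplace theta g1 z + phase_laplace theta g2 z)%R.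
      rewrite /phase_laplace /cosT -RintegralD//; last 2 first.
      - apply: integrable_cosM; first exact: measurable_funM.
        exact: integrable_damped.
      - apply: integrable_cosM; first exact: measurable_funM.
        exact: integrable_damped.
      by apply: eq_Rintegral => t _; rewrite gE; ring.
    have h1 := le_trans (phase_laplace_le theta mg1 g10 g1N ig1 x0) intg1.
    rewrite LE in lz.
    have := lt_le_trans lz (ler_normD _ _).
    move=> /lt_le_trans/(_ (lerD h1 (lexx _))).
    by rewrite -ltrBlDl (_ : lambda - lambda / 2 = lambda / 2)%R//; by field.
Qed.

Let embedding_integrable (p p' : R) : (1 < p <= 2)%R -> (p^-1 + p'^-1 = 1)%R ->
  exists2 K : R, (0 <= K)%R &
  forall (theta : R) (g : R -> R) (N : R),
  measurable_fun (setT : set T) g -> leb.-integrable setT (EFin \o g) ->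
  (forall t, (0 <= g t)%R) -> (forall t, (t < 0)%R -> g t = 0%R) -> (0 < N)%R ->
  \int[leb]_t (g t `^ p)%:E <= N%:E ->
  \int[mu]_(z in H) (`|phase_laplace theta g z| `^ (alpha * p'))%:E <=
  (K * N `^ (alpha * (p' - 1)))%:E.
Proof.
move=> /andP[p1]; rewrite le_eqVlt => /predU1P[p2|p2] pp'; last first.
  by apply: embedding_lt2 pp'; rewrite p1.
have p'E : (p' = 1 + 1)%R.
  by rewrite -[LHS]invrK (_ : p'^-1 = 2^-1)%R ?invrK//; move: pp'; rewrite p2; lra.
exists K2 => // theta g N mg ig g0 gN N0 hN; rewrite p'E addrK mulr1.
apply: embedding2 => //; first exact: ltW.
by apply: le_trans hN; rewrite le_eqVlt; apply/orP; left; apply/eqP;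
  apply: eq_integral => t _; rewrite p2 powR_mulrn.
Qed.

(** Integrability of [g] is removed by truncating it to bounded intervals: the
    transforms of the truncations converge pointwise, and Fatou's lemma applies. *)
Lemma carleson_embedding_ge0 (p p' : R) : (1 < p <= 2)%R -> (p^-1 + p'^-1 = 1)%R ->
  exists2 K : R, (0 <= K)%R &
  forall (theta : R) (g : R -> R) (N : R),
  measurable_fun (setT : set T) g ->
  (forall t, (0 <= g t)%R) -> (forall t, (t <= 0)%R -> g t = 0%R) -> (0 < N)%R ->
  \int[leb]_t (g t `^ p)%:E <= N%:E ->
  (forall z : R[i], (0 < complex.Re z)%R -> leb.-integrable setT (fun t => (expR (- complex.Re z * t) * g t)%:E)) ->
  \int[mu]_(z in H) (`|phase_laplace theta g z| `^ (alpha * p'))%:E <=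
  (K * N `^ (alpha * (p' - 1)))%:E.
Proof.
move=> p12 pp'; have [K K0 hK] := embedding_integrable p12 pp'.
have p0 : (0 < p)%R by case/andP : p12 => p1 _; apply: lt_trans p1.
exists K => // theta g N mg g0 gN N0 hN ig.
pose gn n t := (g t * \1_(`[0%R, n%:R]%classic : set R) t)%R.
have mgn n : measurable_fun (setT : set T) (gn n).
  by apply: measurable_funM => //; exact: measurable_indic.
have gn0 n t : (0 <= gn n t)%R by exact: mulr_ge0.
have gng n t : (gn n t <= g t)%R by rewrite /gn ler_piMr// indicE lern1 leq_b1.
have gnN n t : (t < 0)%R -> gn n t = 0%R by move=> t0; rewrite /gn gN ?mul0r// ltW.
have ign n : leb.-integrable setT (EFin \o gn n).
  have z1 : (0 < complex.Re (Complex 1 0 : R[i]))%R by rewrite /=.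
  apply: (@le_integrableR _ T R leb setT _ (fun t => expR n%:R * (expR (- 1 * t) * g t))%R) => //.
    move=> t _; rewrite ger0_norm// /gn indicE.
    case: (boolP (t \in _)) => [|_]; last by rewrite mulr0 mulr_ge0 ?expR_ge0// mulr_ge0 ?expR_ge0.
    rewrite inE/= in_itv/= => /andP[t0 tn]; rewrite mulr1 mulrA -expRD.
    by rewrite ler_peMl// -[leLHS]expR0 ler_expR mulN1r subr_ge0.
  have ig1 : leb.-integrable setT (EFin \o (fun t : R => expR (- 1 * t) * g t)%R) by exact: ig z1.
  exact: integrableRZl.
have hn n : \int[leb]_t (gn n t `^ p)%:E <= N%:E.
  apply: le_trans hN; apply: ge0_le_integral => //.
  - by move=> t _; rewrite lee_fin powR_ge0.
  - by apply/measurable_EFinP; exact: (measurableT_comp (measurable_powR p) (mgn n)).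
  - by apply/measurable_EFinP; exact: (measurableT_comp (measurable_powR p) mg).
  - by move=> t _; rewrite lee_fin ge0_ler_powR ?nnegrE// ltW.
have bound n := hK theta (gn n) N (mgn n) (ign n) (gn0 n) (@gnN n) N0 (hn n).
pose F n (z : CC) := (`|phase_laplace theta (gn n) z| `^ (alpha * p'))%:E.
have cF z : H z -> F n z @[n --> \oo] --> (`|phase_laplace theta g z| `^ (alpha * p'))%:E.
  have mc : measurable_fun (setT : set T) (fun t => cos (complex.Im z * t + theta)).
    apply: (measurable_continuous_comp (h := cos)); first exact: continuous_cos.
    by apply: measurable_funD => //; exact: measurable_funM.
  have me : measurable_fun (setT : set T) (fun t => expR (- complex.Re z * t)).
    by apply: continuous_measurable_fun; exact: continuous_expRM.
  move=> Hz; have az : (0 < alpha * p')%R.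
    rewrite mulr_gt0//; move: pp' p12 => /(canRL (addKr _)) p'E /andP[p1 _].
    by rewrite -invr_gt0 p'E addrC subr_gt0 invf_lt1.
  apply: cvg_EFin; first exact: nearW.
  rewrite (_ : fine \o _ = fun n => (`|phase_laplace theta (gn n) z| `^ (alpha * p'))%R)//.
  apply: cvg_powR => //.
  suff hc : phase_laplace theta (gn n) z @[n --> \oo] --> phase_laplace theta g z.
    exact: (cvg_comp _ _ hc (@norm_continuous _ R _)).
  apply: (@Rintegral_dominated_cvg R _ T leb setT _ _ (fun t => expR (- complex.Re z * t) * g t)%R) => //.
  - by move=> n; apply: measurable_funM => //; apply: measurable_funM.
  - by apply: measurable_funM => //; apply: measurable_funM.
  - move=> t _; apply: cvg_near_cst; near=> n; congr (_ * (_ * _))%R.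
    have [t0|t0] := ltP 0%R t; last by rewrite /gn gN// mul0r.
    rewrite /gn indicE mem_set ?mulr1//= in_itv/= (ltW t0)/=.
    by near: n; exact: nbhs_infty_ger.
  - exact: ig.
  - move=> n t _; rewrite normrM -[leRHS]mul1r; apply: ler_pM => //; first exact: normr_cos_le1.
    by rewrite ger0_norm ?mulr_ge0 ?expR_ge0// ler_wpM2l ?expR_ge0.
apply: (@le_trans _ _ (\int[mu]_(z in H) limn_einf (F ^~ z))).
  rewrite le_eqVlt; apply/orP; left; apply/eqP; apply: eq_integral => z; rewrite inE => Hz.
  by rewrite -(cvg_lim _ (cF z Hz))// (is_cvg_limn_einfE (cvgP _ (cF z Hz))).
have mF n : measurable_fun H (F n).
  apply: measurable_funTS; apply/measurable_EFinP.
  apply: (measurableT_comp (measurable_powR _)).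
  by apply: measurable_abs; exact: measurable_phase_laplace.
have F0 n z : H z -> 0 <= F n z by move=> _; rewrite lee_fin powR_ge0.
apply: (le_trans (fatou mu mH mF F0)).
rewrite limn_einf_lim; apply: lime_le; first exact: is_cvg_einfs.
apply: nearW => n; apply: le_trans (bound n); apply: ereal_inf_lbound.
by exists n => /=.
Unshelve. all: by end_near. Qed.

End embedding.

(** * Carleson embedding of transforms of real functions *)

Section laplace_transform.
Context {R : realType}.

Notation leb := (@lebesgue_measure R).
Notation T := (measurableTypeR R).
Notation CC := (borelC R).
Notation H := (@right_half_plane R : set CC).
Notation P := (@pos_halfline R : set T).

Lemma powRD_le (a b r : R) : 0 <= a -> 0 <= b -> 0 <= r ->
  (a + b) `^ r <= 2 `^ r * (a `^ r + b `^ r).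
Proof.
wlog ab : a b / a <= b => [hw a0 b0 r0|a0 b0 r0].
  have [ab|/ltW ba] := leP a b; first exact: hw.
  by rewrite addrC [X in _ * X]addrC hw.
apply: (@le_trans _ _ ((2 * b) `^ r)).
  by rewrite ge0_ler_powR ?nnegrE ?addr_ge0 ?mulr_ge0//; lra.
by rewrite powRM// ler_wpM2l ?powR_ge0// lerDr powR_ge0.
Qed.

(** By [|h| <= 1 + |h|^p], the damped function is dominated by
    [exp (- x t) + |h t|^p]. *)
Lemma integrable_damped_Lp (p x : R) (h : R -> R) : 1 <= p -> 0 < x ->
  measurable_fun (setT : set T) h -> (forall t, t <= 0 -> h t = 0) ->
  (\int[leb]_t (`|h t| `^ p)%:E < +oo)%E ->
  leb.-integrable setT (fun t => (expR (- x * t) * h t)%:E).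
Proof.
move=> p1 x0 mh hN hfin.
have me : measurable_fun (setT : set T) (fun t => expR (- x * t)).
  by apply: continuous_measurable_fun; exact: continuous_expRM.
have mhp : measurable_fun (setT : set T) (fun t => `|h t| `^ p).
  by apply: (measurableT_comp (measurable_powR p)); exact: measurable_abs.
have ihp : leb.-integrable setT (EFin \o (fun t => `|h t| `^ p)).
  apply/integrableP; split; first exact/measurable_EFinP.
  by under eq_integral do rewrite /= ger0_norm ?powR_ge0//.
apply: (@le_integrableR _ T R leb setT (fun t => expR (- x * t) * h t)
  (fun t => expR (- x * `|t|) + `|h t| `^ p)) => //.
- exact: measurable_funM.
- move=> t _; have [t0|t0] := ltP 0 t; last first.
    by rewrite hN// mulr0 normr0 addr_ge0 ?expR_ge0 ?powR_ge0.
  rewrite normrM (ger0_norm (expR_ge0 _)) (gtr0_norm t0).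
  have e1 : expR (- x * t) <= 1 by rewrite -expR0 ler_expR mulNr oppr_le0 mulr_ge0// ltW.
  have [h1|h1] := leP `|h t| 1.
    apply: (@le_trans _ _ (expR (- x * t) * 1)); first by rewrite ler_wpM2l ?expR_ge0.
    by rewrite mulr1 lerDl powR_ge0.
  apply: (@le_trans _ _ `|h t|); first by rewrite ler_piMl.
  apply: (@le_trans _ _ (`|h t| `^ p)); last by rewrite lerDr expR_ge0.
  by rewrite -[leLHS]powRr1// ler_powR// ltW.
- by apply: integrableRD => //; exact: integral_expR_abs.
Qed.

Section real.
Variables (mu : {sigma_finite_measure set CC -> \bar R}) (C alpha : R).
Hypotheses (C0 : 0 < C) (alpha1 : 1 <= alpha).
Hypothesis carleson : forall (l r : bool) (a b : R), a <= b ->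
  (mu (carleson_square l r a b) <= (C * (b - a) `^ alpha)%:E)%E.

Lemma carleson_embedding_real (p p' : R) : 1 < p <= 2 -> p^-1 + p'^-1 = 1 -> 0 < p' ->
  exists2 K : R, 0 <= K &
  forall (theta : R) (h : R -> R) (N : R),
  measurable_fun (setT : set T) h -> (forall t, t <= 0 -> h t = 0) -> 0 < N ->
  (\int[leb]_t (`|h t| `^ p)%:E <= N%:E)%E ->
  (\int[mu]_(z in H) (`|phase_laplace theta h z| `^ (alpha * p'))%:E <=
  (K * N `^ (alpha * (p' - 1)))%:E)%E.
Proof.
move=> p12 pp' p'0; have [K K0 hK] := carleson_embedding_ge0 C0 alpha1 carleson p12 pp'.
have /andP[p1 _] := p12; have p0 : 0 < p by apply: lt_trans p1.
set r := alpha * p'.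
have r0 : 0 <= r by rewrite mulr_ge0// ltW// (lt_le_trans ltr01).
exists (2 `^ r * (K + K)) => [|theta h N mh hN N0 hhN].
  by rewrite mulr_ge0 ?powR_ge0 ?addr_ge0.
have mH := @measurable_right_half_plane R.
have me (x : R) : measurable_fun (setT : set T) (fun t => expR (x * t)).
  by apply: continuous_measurable_fun; exact: continuous_expRM.
(* The positive and the negative part. *)
pose g1 t := Num.max (h t) 0; pose g2 t := Num.max (- h t) 0.
have mg1 : measurable_fun (setT : set T) g1 by exact: measurable_maxr.
have mg2 : measurable_fun (setT : set T) g2.
  by apply: measurable_maxr => //; exact: measurableT_comp.
have g10 t : 0 <= g1 t by rewrite le_max lexx orbT.
have g20 t : 0 <= g2 t by rewrite le_max lexx orbT.
have hE t : h t = g1 t - g2 t.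
  by rewrite /g1 /g2; have [h0|h0] := leP 0 (h t);
    [rewrite max_r ?subr0// oppr_le0|rewrite max_l ?sub0r ?opprK// oppr_ge0 ltW].
have g1h t : g1 t <= `|h t| by rewrite ge_max ler_norm/=.
have g2h t : g2 t <= `|h t| by rewrite ge_max -normrN ler_norm/=.
have g1N t : t <= 0 -> g1 t = 0 by move=> t0; rewrite /g1 hN// maxxx.
have g2N t : t <= 0 -> g2 t = 0 by move=> t0; rewrite /g2 hN// oppr0 maxxx.
have mhp : measurable_fun (setT : set T) (fun t => `|h t| `^ p).
  by apply: (measurableT_comp (measurable_powR p)); exact: measurable_abs.
have key (g : R -> R) : measurable_fun (setT : set T) g -> (forall t, 0 <= g t) ->
    (forall t, g t <= `|h t|) -> (forall t, t <= 0 -> g t = 0) ->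
    (\int[leb]_t (g t `^ p)%:E <= N%:E)%E /\
    (forall z : R[i], 0 < complex.Re z ->
       leb.-integrable setT (fun t => (expR (- complex.Re z * t) * g t)%:E)).
  move=> mg g0 gh gN.
  have gle : (\int[leb]_t (g t `^ p)%:E <= N%:E)%E.
    apply: le_trans hhN; apply: ge0_le_integral => //.
    - by move=> t _; rewrite lee_fin powR_ge0.
    - by apply/measurable_EFinP; exact: (measurableT_comp (measurable_powR p)).
    - exact/measurable_EFinP.
    - by move=> t _; rewrite lee_fin ge0_ler_powR ?nnegrE ?(ltW p0).
  split=> // z z0; apply: (integrable_damped_Lp (p := p)) => //; first exact: ltW.
  under eq_integral do rewrite ger0_norm//.
  by rewrite (le_lt_trans gle)// ltry.
have [l1 i1] := key _ mg1 g10 g1h g1N; have [l2 i2] := key _ mg2 g20 g2h g2N.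
have b1 := hK theta g1 N mg1 g10 g1N N0 l1 i1.
have b2 := hK theta g2 N mg2 g20 g2N N0 l2 i2.
have mF g : measurable_fun (setT : set T) g ->
    measurable_fun H (fun z => (`|phase_laplace theta g z| `^ r)%:E).
  move=> mg; apply: measurable_funTS; apply/measurable_EFinP.
  apply: (measurableT_comp (measurable_powR _)).
  by apply: measurable_abs; exact: measurable_phase_laplace.
apply: (@le_trans _ _ (\int[mu]_(z in H) ((2 `^ r)%:E *
   ((`|phase_laplace theta g1 z| `^ r)%:E + (`|phase_laplace theta g2 z| `^ r)%:E)))%E).
  apply: ge0_le_integral => //.
  - exact: mF.
  - by apply: emeasurable_funM => //; apply: emeasurable_funD; exact: mF.
  - move=> z Hz; rewrite -EFinD -EFinM lee_fin.
    have -> : phase_laplace theta h z = phase_laplace theta g1 z - phase_laplace theta g2 z.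
      rewrite /phase_laplace /cosT -RintegralB//; last 2 first.
      - apply: integrable_cosM; first exact: measurable_funM.
        exact: i1.
      - apply: integrable_cosM; first exact: measurable_funM.
        exact: i2.
      by apply: eq_Rintegral => t _; rewrite hE; ring.
    apply: le_trans (powRD_le _ _ r0) => //.
    by rewrite ge0_ler_powR ?nnegrE ?addr_ge0// (le_trans (ler_normB _ _)).
rewrite ge0_integralZl_EFin//; last 2 first.
- by move=> z _; rewrite adde_ge0// lee_fin powR_ge0.
- by apply: emeasurable_funD; exact: mF.
rewrite ge0_integralD//; last 2 first.
- exact: mF.
- exact: mF.
rewrite -/r in b1 b2; move: (leeD b1 b2); rewrite -EFinD.
set c := 2 `^ r; have c0 : (0 <= c%:E)%E by rewrite lee_fin powR_ge0.
move=> /(lee_wpmul2l c0) /le_trans; apply.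
by rewrite -EFinM lee_fin -mulrDl mulrA.
Qed.

End real.
End laplace_transform.

(** * Laplace transforms of complex functions *)

Section complex_laplace.
Context {R : realType}.

Notation leb := (@lebesgue_measure R).
Notation T := (measurableTypeR R).
Notation CC := (borelC R).
Notation H := (@right_half_plane R : set CC).
Notation P := (@pos_halfline R : set T).

Let mP : measurable P. Proof. exact: measurable_itv. Qed.
Let mH : measurable H. Proof. exact: measurable_right_half_plane. Qed.

Lemma mem_pos_halfline (t : R) : (t \in P) = (0 < t).
Proof. by apply/idP/idP; rewrite inE /pos_halfline /= in_itv/= andbT. Qed.

Definition causal (u : R -> R) (t : R) : R := if 0 < t then u t else 0.

Lemma measurable_causal (u : R -> R) : measurable_fun P u ->
  measurable_fun (setT : set T) (causal u).
Proof.
move=> mu.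
have -> : causal u = u \_ P.
  by apply/funext => t; rewrite patchE mem_pos_halfline.
exact: (measurable_restrictT u mP).1.
Qed.

Lemma causal0 (u : R -> R) (t : R) : t <= 0 -> causal u t = 0.
Proof. by rewrite /causal leNgt; case: (0 < t). Qed.

Lemma measurable_normc d (X : measurableType d) (D : set X) (f : X -> R[i]) :
  measurable_fun D (f : X -> CC) -> measurable_fun D (fun x => Normc.normc (f x)).
Proof.
move=> mf; have -> : (fun x => Normc.normc (f x)) =
    (fun x => Num.sqrt (complex.Re (f x) ^+ 2 + complex.Im (f x) ^+ 2)).
  by apply/funext => x; case: (f x).
apply: (measurableT_comp (continuous_measurable_fun (@sqrt_continuous R))).
by apply: measurable_funD; apply: measurable_funX;
  [exact: (measurableT_comp measurable_Re mf)|exact: (measurableT_comp measurable_Im mf)].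
Qed.

Lemma cLnormE d (X : measurableType d) (m : {measure set X -> \bar R}) (D : set X) (p : R)
    (f : X -> R[i]) : 0 < p ->
  cLnorm m D p f = ((\int[m]_(x in D) (Normc.normc (f x) `^ p)%:E) `^ p^-1)%E.
Proof.
move=> p0; rewrite /cLnorm unlock; congr (_ `^ _)%E.
rewrite [RHS]integral_mkcond; apply: eq_integral => x _.
rewrite !patchE; case: ifPn => _ /=.
  by rewrite ger0_norm ?normc_ge0.
by rewrite normr0 powR0// gt_eqF.
Qed.

(** The kernel [exp (- t z)] has modulus [exp (- t Re z)] and argument [- t Im z]. *)
Lemma laplace_kernelE (f : R -> R[i]) (z : R[i]) (t : R) :
  let a := (complex.Im z * t)%R in let e := expR (- complex.Re z * t) in
  laplace_kernel f z t =
  Complex (cos (a + 0) * (e * complex.Re (f t)) + cos (a - pi / 2) * (e * complex.Im (f t)))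
          (cos (a + 0) * (e * complex.Im (f t)) - cos (a - pi / 2) * (e * complex.Re (f t))).
Proof.
move=> a e; rewrite /laplace_kernel /cexp.
have -> : complex.Re (- (t%:C%C * z)) = - complex.Re z * t.
  by case: z {a e} => x y /=; ring.
have -> : complex.Im (- (t%:C%C * z)) = - a.
  by rewrite /a; case: z {a e} => x y /=; ring.
rewrite addr0 cosN sinN.
have -> : cos (a - pi / 2) = sin a.
  by rewrite cosB cos_pihalf sin_pihalf mulr0 mulr1 add0r.
case: (f t) => u v; rewrite -/e; apply/eqP; rewrite eq_complex /=.
by apply/andP; split; apply/eqP; ring.
Qed.

(** The real and the imaginary part of the Laplace transform are sums of two
    transforms of real functions; the phase [- pi / 2] turns the cosine of the
    kernel into a sine. *)
Lemma laplace_phase_laplace (f : R -> R[i]) (z : R[i]) :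
  let u := causal (fun t => complex.Re (f t)) in let v := causal (fun t => complex.Im (f t)) in
  measurable_fun P (f : T -> CC) ->
  leb.-integrable setT (fun t => (expR (- complex.Re z * t) * u t)%:E) ->
  leb.-integrable setT (fun t => (expR (- complex.Re z * t) * v t)%:E) ->
  cintegrable leb P (laplace_kernel f z) /\
  laplace f z = Complex
    (phase_laplace 0 u z + phase_laplace (- (pi / 2)) v z)
    (phase_laplace 0 v z - phase_laplace (- (pi / 2)) u z).
Proof.
move=> u v mf iu iv.
set x := complex.Re z; set y := complex.Im z.
have me : measurable_fun (setT : set T) (fun t => expR (- x * t)).
  by apply: continuous_measurable_fun; exact: continuous_expRM.
have ic theta g : measurable_fun (setT : set T) g ->
    leb.-integrable setT (fun t => (expR (- x * t) * g t)%:E) ->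
    leb.-integrable setT (fun t => (cos (y * t + theta) * (expR (- x * t) * g t))%:E).
  by move=> mg ig; apply: integrable_cosM => //; exact: measurable_funM.
have mu : measurable_fun (setT : set T) u.
  by apply: measurable_causal; exact: (measurableT_comp measurable_Re mf).
have mv : measurable_fun (setT : set T) v.
  by apply: measurable_causal; exact: (measurableT_comp measurable_Im mf).
have iRe : leb.-integrable setT (fun t => (cos (y * t + 0) * (expR (- x * t) * u t) +
     cos (y * t - pi / 2) * (expR (- x * t) * v t))%:E).
  by apply: integrableRD => //; exact: ic.
have iIm : leb.-integrable setT (fun t => (cos (y * t + 0) * (expR (- x * t) * v t) -
     cos (y * t - pi / 2) * (expR (- x * t) * u t))%:E).
  by apply: (integrableB measurableT (ic _ _ mv iv) (ic _ _ mu iu)).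
have posP t : t \in P -> 0 < t by rewrite mem_pos_halfline.
split.
  split.
    move: (integrableS measurableT mP (@subsetT _ _) iRe); apply: eq_integrable => // t tP.
    by rewrite laplace_kernelE /= /u /v /causal (posP _ tP).
  move: (integrableS measurableT mP (@subsetT _ _) iIm); apply: eq_integrable => // t tP.
  by rewrite laplace_kernelE /= /u /v /causal (posP _ tP).
have ext (f1 f2 : R -> R) : (forall t, 0 < t -> f1 t = f2 t) -> (forall t, t <= 0 -> f2 t = 0) ->
    \int[leb]_(t in P) f1 t = \int[leb]_t f2 t.
  move=> uv v0; rewrite Rintegral_mkcond; apply: eq_Rintegral => t _; rewrite patchE.
  by rewrite mem_pos_halfline; case: (ltP 0 t) => [/uv//|/v0 ->].
rewrite /laplace /cintegral /phase_laplace /cosT -/x -/y; congr Complex.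
  rewrite -RintegralD ?ic//; apply: ext => t t0.
    by rewrite laplace_kernelE/= /u /v /causal t0.
  by rewrite /u /v !causal0// !mulr0 addr0.
rewrite -RintegralB ?ic//; apply: ext => t t0.
  by rewrite laplace_kernelE/= /u /v /causal t0.
by rewrite /u /v !causal0// !mulr0 subr0.
Qed.

Lemma integral_causal_le (u m : R -> R) (p : R) : 0 < p ->
  measurable_fun P u -> measurable_fun P m -> (forall t, `|u t| <= m t) ->
  (\int[leb]_t (`|causal u t| `^ p)%:E <= \int[leb]_(t in P) (m t `^ p)%:E)%E.
Proof.
move=> p0 mu mm um; rewrite [leRHS]integral_mkcond; apply: ge0_le_integral => //.
- apply/measurable_EFinP; apply: (measurableT_comp (measurable_powR p)).
  by apply: measurable_abs; exact: measurable_causal.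
- apply: (measurable_restrictT _ mP).1; apply/measurable_EFinP.
  exact: (measurableT_comp (measurable_powR p)).
- move=> t _; rewrite patchE mem_pos_halfline /causal; case: (ltP 0 t) => t0.
    have m0 := le_trans (normr_ge0 (u t)) (um t).
    by rewrite lee_fin ge0_ler_powR ?nnegrE// ltW.
  by rewrite normr0 powR0 ?gt_eqF.
Qed.

End complex_laplace.

(** * Carleson embedding of Laplace transforms *)

Section laplace_Lp.
Context {R : realType}.

Notation leb := (@lebesgue_measure R).
Notation T := (measurableTypeR R).
Notation CC := (borelC R).
Notation H := (@right_half_plane R : set CC).
Notation P := (@pos_halfline R : set T).

Let mH : measurable H. Proof. exact: measurable_right_half_plane. Qed.

(** Norm bounds are handled as bounds of integrals of powers, in which the
    estimates above are expressed. *)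
Lemma cLnorm_le d (X : measurableType d) (m : {measure set X -> \bar R}) (D : set X) (p c : R)
    (f : X -> R[i]) : 0 < p -> 0 <= c ->
  (cLnorm m D p f <= c%:E <-> \int[m]_(x in D) (Normc.normc (f x) `^ p)%:E <= (c `^ p)%:E)%E.
Proof.
move=> p0 c0; rewrite cLnormE//; set I := (\int[m]_(x in D) _)%E.
have I0 : (0 <= I)%E by apply: integral_ge0 => x _; rewrite lee_fin powR_ge0.
have in0y (x : \bar R) : (0 <= x)%E -> x \in `[0%E, +oo%E].
  by move=> x0; rewrite in_itv/= x0 leey.
split=> h.
  rewrite -[leLHS]poweRe1// -(mulVf (lt0r_neq0 p0)) poweRrM -poweR_EFin.
  by apply: gt0_ler_poweR; rewrite ?in0y ?poweR_ge0 ?lee_fin// ltW.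
rewrite -[c in leRHS]powRr1// -(mulfV (lt0r_neq0 p0)) powRrM -poweR_EFin.
by apply: gt0_ler_poweR; rewrite ?in0y ?lee_fin ?powR_ge0// invr_ge0 ltW.
Qed.

Lemma ge0_integralD_le d (X : measurableType d) (m : {measure set X -> \bar R}) (D : set X)
    (f g : X -> R) (a b : R) : measurable D -> (forall x, 0 <= f x) -> (forall x, 0 <= g x) ->
  measurable_fun D f -> measurable_fun D g ->
  (\int[m]_(x in D) (f x)%:E <= a%:E)%E -> (\int[m]_(x in D) (g x)%:E <= b%:E)%E ->
  (\int[m]_(x in D) (f x + g x)%:E <= (a + b)%:E)%E.
Proof.
move=> mD f0 g0 mf mg fa gb; under eq_integral do rewrite EFinD.
rewrite ge0_integralD//; first by rewrite EFinD; exact: leeD.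
- by move=> x _; rewrite lee_fin.
- exact/measurable_EFinP.
- by move=> x _; rewrite lee_fin.
- exact/measurable_EFinP.
Qed.

Lemma integrable_damped_causal (p : R) (f : R -> R[i]) (z : R[i]) : 1 <= p ->
  in_cLp leb P p f -> H z ->
  leb.-integrable setT
    (fun t => (expR (- complex.Re z * t) * causal (fun t => complex.Re (f t)) t)%:E) /\
  leb.-integrable setT
    (fun t => (expR (- complex.Re z * t) * causal (fun t => complex.Im (f t)) t)%:E).
Proof.
move=> p1 [mf fp] Hz; have p0 : 0 < p by exact: lt_le_trans p1.
have mu : measurable_fun P (fun t => complex.Re (f t)).
  exact: (measurableT_comp measurable_Re mf).
have mv : measurable_fun P (fun t => complex.Im (f t)).
  exact: (measurableT_comp measurable_Im mf).
have If : (\int[leb]_(t in P) (Normc.normc (f t) `^ p)%:E < +oo)%E.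
  by move: fp; rewrite cLnormE// => /lty_poweRy; apply; rewrite invr_neq0// gt_eqF.
have mn := measurable_normc mf.
have iw (w : R -> R) (mw : measurable_fun P w) (wf : forall t, `|w t| <= Normc.normc (f t)) :
    leb.-integrable setT (fun t => (expR (- complex.Re z * t) * causal w t)%:E).
  apply: (@integrable_damped_Lp R p (complex.Re z) (causal w) p1 Hz (measurable_causal mw)).
    exact: causal0.
  exact: (le_lt_trans (integral_causal_le p0 mw mn wf) If).
by split; [exact: (iw _ mu (fun t => normr_Re_le (f t)))|exact: (iw _ mv (fun t => normr_Im_le (f t)))].
Qed.

Lemma cintegrable_laplace (p : R) (f : R -> R[i]) (z : R[i]) : 1 <= p ->
  in_cLp leb P p f -> H z -> cintegrable leb P (laplace_kernel f z).
Proof.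
move=> p1 fp Hz; have [iu iv] := integrable_damped_causal p1 fp Hz.
by have [] := laplace_phase_laplace (proj1 fp) iu iv.
Qed.

Lemma measurable_laplace (p : R) (f : R -> R[i]) : 1 <= p ->
  in_cLp leb P p f -> measurable_fun H (laplace f : CC -> CC).
Proof.
move=> p1 fp; have mf := proj1 fp.
pose u := causal (fun t => complex.Re (f t)); pose v := causal (fun t => complex.Im (f t)).
have mu : measurable_fun (setT : set T) u.
  by apply: measurable_causal; exact: (measurableT_comp measurable_Re mf).
have mv : measurable_fun (setT : set T) v.
  by apply: measurable_causal; exact: (measurableT_comp measurable_Im mf).
suff : measurable_fun H ((fun z => Complex
    (phase_laplace 0 u z + phase_laplace (- (pi / 2)) v z)
    (phase_laplace 0 v z - phase_laplace (- (pi / 2)) u z)) : CC -> CC).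
  apply: eq_measurable_fun => z; rewrite inE => Hz.
  have [iu iv] := integrable_damped_causal p1 fp Hz.
  by have [_ ->] := laplace_phase_laplace mf iu iv.
apply: measurable_Complex; apply: measurable_funTS.
  by apply: measurable_funD; exact: measurable_phase_laplace.
by apply: measurable_funB; exact: measurable_phase_laplace.
Qed.

Section embedding.
Variables (mu : {sigma_finite_measure set CC -> \bar R}) (C alpha : R).
Hypotheses (C0 : 0 < C) (alpha1 : 1 <= alpha).
Hypothesis carleson : forall (l r : bool) (a b : R), a <= b ->
  (mu (carleson_square l r a b) <= (C * (b - a) `^ alpha)%:E)%E.

(** The bound is stated for every [c > 0] above the norm of [f], which includes a
    norm equal to zero without a separate argument. *)
Lemma carleson_embedding (p p' : R) : 1 < p <= 2 -> p^-1 + p'^-1 = 1 -> 0 < p' ->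
  exists2 K : R, 0 < K & forall (f : R -> R[i]) (c : R), 0 < c ->
    in_cLp leb P p f -> (cLnorm leb P p f <= c%:E)%E ->
    (cLnorm mu H (alpha * p') (laplace f) <= (K * c)%:E)%E.
Proof.
move=> p12 pp' p'0; have [K K0 hK] := carleson_embedding_real C0 alpha1 carleson p12 pp' p'0.
have /andP[p1 _] := p12; have p0 : 0 < p by apply: lt_trans p1.
set q := alpha * p' in hK *.
have q0 : 0 < q by rewrite mulr_gt0// (lt_le_trans ltr01).
pose B := 2 `^ q * (2 `^ q * (4 * K) + 1).
have B0 : 0 < B.
  rewrite mulr_gt0 ?powR_gt0// ltr_wpDl// mulr_ge0 ?powR_ge0// mulr_ge0//.
exists (B `^ q^-1) => [|f c c0 fp fc]; first by rewrite powR_gt0.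
have mf := proj1 fp.
apply/cLnorm_le => //; first by rewrite mulr_ge0 ?powR_ge0 ?(ltW c0).
have -> : (B `^ q^-1 * c) `^ q = B * c `^ q.
  by rewrite powRM ?powR_ge0 ?(ltW c0)// -powRrM mulVf ?gt_eqF// powRr1// ltW.
pose u := causal (fun t => complex.Re (f t)); pose v := causal (fun t => complex.Im (f t)).
have mu' : measurable_fun P (fun t => complex.Re (f t)).
  exact: (measurableT_comp measurable_Re mf).
have mv' : measurable_fun P (fun t => complex.Im (f t)).
  exact: (measurableT_comp measurable_Im mf).
have mU : measurable_fun (setT : set T) u by exact: measurable_causal.
have mV : measurable_fun (setT : set T) v by exact: measurable_causal.
have mn := measurable_normc mf.
have N0 : 0 < c `^ p by rewrite powR_gt0.
have NE : (c `^ p) `^ (alpha * (p' - 1)) = c `^ q.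
  rewrite -powRrM; congr powR; rewrite /q mulrCA; congr (_ * _).
  have -> : p = p' / (p' - 1).
    move: pp' => /(canRL (addrK _)) pE; rewrite -[LHS]invrK pE.
    by rewrite -[RHS]invrK; congr (_^-1); rewrite invf_div mulrBl mulfV ?gt_eqF// mul1r.
  rewrite divfK// subr_eq0; apply/eqP => p'1; move: pp'; rewrite p'1 invr1 => /(canRL (addrK _)).
  by rewrite subrr => /eqP; rewrite invr_eq0 gt_eqF.
have uN : (\int[leb]_t (`|u t| `^ p)%:E <= (c `^ p)%:E)%E.
  apply: le_trans (proj1 (cLnorm_le _ _ _ p0 (ltW c0)) fc).
  exact: (integral_causal_le p0 mu' mn (fun t => normr_Re_le (f t))).
have vN : (\int[leb]_t (`|v t| `^ p)%:E <= (c `^ p)%:E)%E.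
  apply: le_trans (proj1 (cLnorm_le _ _ _ p0 (ltW c0)) fc).
  exact: (integral_causal_le p0 mv' mn (fun t => normr_Im_le (f t))).
pose F theta (h : R -> R) (z : CC) : R := `|phase_laplace theta h z| `^ q.
have F0 theta h z : 0 <= F theta h z by exact: powR_ge0.
have mF theta h : measurable_fun (setT : set T) h -> measurable_fun H (fun z => F theta h z).
  move=> mh; apply: measurable_funTS; apply: (measurableT_comp (measurable_powR _)).
  by apply: measurable_abs; exact: measurable_phase_laplace.
have bU theta : (\int[mu]_(z in H) (F theta u z)%:E <= (K * c `^ q)%:E)%E.
  by rewrite -NE; exact: (hK theta u (c `^ p) mU (@causal0 _ _) N0 uN).
have bV theta : (\int[mu]_(z in H) (F theta v z)%:E <= (K * c `^ q)%:E)%E.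
  by rewrite -NE; exact: (hK theta v (c `^ p) mV (@causal0 _ _) N0 vN).
pose th : R := - (pi / 2).
pose G z := (F 0 u z + F th v z) + (F 0 v z + F th u z).
have G0 z : 0 <= G z by rewrite !addr_ge0.
have mG : measurable_fun H G.
  by apply: measurable_funD; apply: measurable_funD; exact: mF.
have pw z : H z -> Normc.normc (laplace f z) `^ q <= 2 `^ q * 2 `^ q * G z.
  move=> Hz; have [iu iv] := integrable_damped_causal (ltW p1) fp Hz.
  have [_ ->] := laplace_phase_laplace mf iu iv.
  set a1 := phase_laplace 0 _ z; set a2 := phase_laplace _ _ z.
  set a3 := phase_laplace 0 _ z; set a4 := phase_laplace _ _ z.
  have s (x y : R) : `|x + y| `^ q <= 2 `^ q * (`|x| `^ q + `|y| `^ q).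
    apply: le_trans (powRD_le (normr_ge0 x) (normr_ge0 y) (ltW q0)).
    by rewrite ge0_ler_powR ?nnegrE ?addr_ge0 ?(ltW q0)// ler_normD.
  apply: (@le_trans _ _ ((`|a1 + a2| + `|a3 - a4|) `^ q)).
    rewrite ge0_ler_powR ?nnegrE ?addr_ge0 ?(ltW q0) ?normc_ge0//.
    exact: (normc_le_ReIm (Complex (a1 + a2) (a3 - a4))).
  apply: le_trans (powRD_le (normr_ge0 _) (normr_ge0 _) (ltW q0)) _.
  rewrite -mulrA; apply: ler_wpM2l; first exact: powR_ge0.
  rewrite [leRHS]mulrDr; apply: lerD; first exact: s.
  by have := s a3 (- a4); rewrite normrN.
apply: (@le_trans _ _ (\int[mu]_(z in H) ((2 `^ q * 2 `^ q)%:E * (G z)%:E))%E).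
  apply: ge0_le_integral => //.
  - by move=> z _; rewrite lee_fin powR_ge0.
  - apply/measurable_EFinP; apply: (measurableT_comp (measurable_powR _)).
    exact: (measurable_normc (measurable_laplace (ltW p1) fp)).
  - by apply: emeasurable_funM => //; exact/measurable_EFinP.
have c20 : 0 <= 2 `^ q * 2 `^ q :> R by rewrite mulr_ge0 ?powR_ge0.
rewrite ge0_integralZl_EFin//; last 2 first.
- by move=> z _; rewrite lee_fin.
- exact/measurable_EFinP.
have GE : (\int[mu]_(z in H) (G z)%:E <= (4 * K * c `^ q)%:E)%E.
  have -> : 4 * K * c `^ q = (K * c `^ q + K * c `^ q) + (K * c `^ q + K * c `^ q) by ring.
  apply: (ge0_integralD_le mH).
  - by move=> z; rewrite addr_ge0.
  - by move=> z; rewrite addr_ge0.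
  - by apply: measurable_funD; exact: mF.
  - by apply: measurable_funD; exact: mF.
  - exact: (ge0_integralD_le mH (F0 _ _) (F0 _ _) (mF _ _ mU) (mF _ _ mV) (bU _) (bV _)).
  - exact: (ge0_integralD_le mH (F0 _ _) (F0 _ _) (mF _ _ mV) (mF _ _ mU) (bV _) (bU _)).
have c20E : (0 <= (2 `^ q * 2 `^ q)%:E :> \bar R)%E by rewrite lee_fin.
apply: le_trans (lee_wpmul2l c20E GE) _.
rewrite -EFinM lee_fin /B -!mulrA; apply: ler_wpM2l; first exact: powR_ge0.
rewrite !mulrA; apply: ler_wpM2r; first exact: powR_ge0.
by rewrite lerDl.
Qed.

End embedding.
End laplace_Lp.

(** * The equivalence *)

Section laplace_carleson.
Context {R : realType}.

Notation leb := (@lebesgue_measure R).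
Notation T := (measurableTypeR R).
Notation CC := (borelC R).
Notation H := (@right_half_plane R : set CC).
Notation P := (@pos_halfline R : set T).

Let mH : measurable H. Proof. exact: measurable_right_half_plane. Qed.
Let mP : measurable P. Proof. exact: measurable_itv. Qed.

Section measure.
Variable mu : {measure set CC -> \bar R}.
Hypothesis mu_supp : supported_in mu H.
Variables (C alpha : R).
Hypothesis carleson : forall (l r : bool) (a b : R), a <= b ->
  (mu (carleson_square l r a b) <= (C * (b - a) `^ alpha)%:E)%E.

(** The squares over the intervals of endpoints [- n] and [n] have finite measure
    and exhaust the half plane; the rest of the plane is a null set. *)
Lemma sigma_finite_carleson : sigma_finite setT mu.
Proof.
pose Q (n : nat) := carleson_square true true (- n%:R) (n%:R : R) : set CC.
exists (fun n => if n is n'.+1 then Q n' else ~` H).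
  apply/esym/seteqP; split => // z _.
  have [Hz|nHz] := pselect (H z); last by exists 0%N.
  have : (0 : R) <= Num.max (complex.Re z) `|complex.Im z| + 1.
    by rewrite addr_ge0// le_max normr_ge0 orbT.
  move=> /archi_boundP; set n := Num.bound _ => nz.
  have zn : Num.max (complex.Re z) `|complex.Im z| < n%:R by apply: lt_trans nz; rewrite ltrDl.
  move: zn; rewrite gt_max => /andP[zn1]; rewrite ltr_norml => /andP[zn2 zn3].
  exists n.+1 => //; split; first by rewrite in_itv/= (ltW zn2) zn3.
  have z0 : 0 < complex.Re z by exact: Hz.
  by rewrite z0/= opprK (lt_le_trans zn1)// lerDl.
case=> [|n]; first by split; [exact: measurableC|rewrite mu_supp ltry].
split; first exact: measurable_carleson_square.
apply: le_lt_trans (carleson true true _) _; last exact: ltry.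
by rewrite -subr_ge0 opprK addr_ge0.
Qed.

End measure.

Lemma laplace_carleson_embedding (mu : {measure set CC -> \bar R}) (p p' q : R) :
  supported_in mu H -> p^-1 + p'^-1 = 1 -> 1 < p <= 2 -> 0 < p' -> p' <= q ->
  (exists2 C : R, 0 < C & forall (l r : bool) (a b : R), a <= b ->
     (mu (carleson_square l r a b) <= (C * (b - a) `^ (q / p'))%:E)%E) ->
  laplace_well_defined mu p q /\ laplace_bounded mu p q.
Proof.
move=> mu_supp pp' p12 p'0 p'q [C C0 carl].
have /andP[/ltW p1 _] := p12.
have sf := sigma_finite_carleson mu_supp carl.
pose mu' : {sigma_finite_measure set CC -> \bar R} :=
  HB.pack_for (SigmaFiniteMeasure.type CC R) (Measure.sort mu)
    (isSFinite.Build _ _ _ _ (sfinite_measure_sigma_finite sf)) (isSigmaFinite.Build _ _ _ _ sf).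
have muE : mu = mu' :> {measure set CC -> \bar R} by exact: eq_measure.
have alpha1 : 1 <= q / p' by rewrite ler_pdivlMr// mul1r.
have [K K0 hK] := @carleson_embedding R mu' C _ C0 alpha1 carl p p' p12 pp' p'0.
rewrite divfK ?gt_eqF// in hK.
have n0 (f : R -> R[i]) : (0 <= cLnorm leb P p f)%E by exact: Lnorm_ge0.
have finN (f : R -> R[i]) : in_cLp leb P p f -> cLnorm leb P p f = (fine (cLnorm leb P p f))%:E.
  by move=> [_ fp]; rewrite fineK// ge0_fin_numE.
have bnd (f : R -> R[i]) e : in_cLp leb P p f -> 0 < e ->
    (cLnorm mu H q (laplace f) <= (K * (fine (cLnorm leb P p f) + e))%:E)%E.
  move=> fp e0; rewrite muE; apply: hK => //.
    by rewrite ltr_wpDl// fine_ge0.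
  by rewrite [leLHS]finN// lee_fin lerDl ltW.
split.
  move=> f fp; split; first by move=> s Hs; exact: (cintegrable_laplace p1 fp Hs).
  split; first exact: (measurable_laplace p1 fp).
  by apply: le_lt_trans (bnd f 1 fp ltr01) _; exact: ltry.
exists K => // f fp; apply/lee_addgt0Pr => e e0.
have eK : 0 < e / K by rewrite divr_gt0.
apply: le_trans (bnd f _ fp eK) _.
by rewrite [in leRHS]finN// -EFinM -EFinD lee_fin mulrDr [K * (e / K)]mulrC divfK// gt_eqF.
Qed.

Lemma normc_exp_fun (z : R[i]) (t : R) :
  Normc.normc (exp_fun z t) = expR (- complex.Re z * t).
Proof.
rewrite /exp_fun /cexp /= !exprMn -mulrDr cos2Dsin2 mulr1 sqrtr_sqr ger0_norm ?expR_ge0//.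
by congr expR; case: z => x y /=; ring.
Qed.

Lemma measurable_exp_fun (z : R[i]) : measurable_fun P (exp_fun z : T -> CC).
Proof.
have mx a : measurable_fun (setT : set T) (fun t => expR (a * t)).
  by apply: continuous_measurable_fun; exact: continuous_expRM.
suff : measurable_fun P ((fun t => Complex
    (expR (- complex.Re z * t) * cos (t * complex.Im z + 0))
    (expR (- complex.Re z * t) * cos (t * complex.Im z + pi / 2))) : T -> CC).
  apply: eq_measurable_fun => t _; rewrite /exp_fun /cexp.
  have -> : complex.Re (- (t%:C%C * z)) = - complex.Re z * t by case: z => x y /=; ring.
  have -> : complex.Im (- (t%:C%C * z)) = - (t * complex.Im z) by case: z => x y /=; ring.
  rewrite addr0 cosN sinN; congr Complex; congr *%R.
  by rewrite cosD cos_pihalf sin_pihalf mulr0 mulr1 sub0r.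
by apply: measurable_Complex; apply: measurable_funTS; apply: measurable_funM => //;
  apply: continuous_measurable_fun; exact: continuous_cosM.
Qed.

Lemma cLnorm_exp_fun (p : R) (z : R[i]) : 0 < p -> H z ->
  cLnorm leb P p (exp_fun z) = ((p * complex.Re z)^-1 `^ p^-1)%:E.
Proof.
move=> p0 Hz; have x0 : 0 < complex.Re z by exact: Hz.
rewrite cLnormE// -poweR_EFin; congr (_ `^ _)%E.
rewrite -integral_expR_half ?mulr_gt0// -integral_itv_obnd_cbnd; last first.
  apply/measurable_EFinP; apply: measurable_funTS.
  by apply: continuous_measurable_fun; exact: continuous_expRM.
apply: eq_integral => t _; congr EFin.
by rewrite normc_exp_fun powR_expR; congr expR; ring.
Qed.

Lemma in_cLp_exp_fun (p : R) (z : R[i]) : 0 < p -> H z -> in_cLp leb P p (exp_fun z).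
Proof.
by move=> p0 Hz; split; [exact: measurable_exp_fun|rewrite cLnorm_exp_fun// ltry].
Qed.

(** The transform of [exp (- t z)] at [s] is [1 / (z + s)]. *)
Lemma Re_laplace_exp_fun (z s : R[i]) : H z -> H s ->
  complex.Re (laplace (exp_fun z) s) = complex.Re (z + s) /
    (complex.Re (z + s) ^+ 2 + complex.Im (z + s) ^+ 2).
Proof.
move=> Hz Hs; set X := complex.Re (z + s); set Y := complex.Im (z + s).
have X0 : 0 < X by rewrite /X raddfD/= addr_gt0.
have [iXY eXY] := integral_expRcos_half Y 0 X0.
rewrite cos0 sin0 mulr1 mulr0 subr0 in eXY; rewrite -eXY /laplace /cintegral /=.
rewrite -Rintegral_itv_obnd_cbnd; last first.
  by apply: integrableS iXY => // t; rewrite /= !in_itv/= !andbT => /ltW.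
apply: eq_Rintegral => t _; rewrite /laplace_kernel /exp_fun /cexp /= addr0.
have -> : - X * t = complex.Re (- (t%:C%C * s)) + complex.Re (- (t%:C%C * z)).
  by rewrite /X; case: (z) (s) => x y [x' y'] /=; ring.
have -> : t * Y = - (complex.Im (- (t%:C%C * s)) + complex.Im (- (t%:C%C * z))).
  by rewrite /Y; case: (z) (s) => x y [x' y'] /=; ring.
by rewrite cosN cosD expRD /=; ring.
Qed.

(** For the square of side [d] over the interval from [a] to [b], the exponential
    of parameter [z = d - i a] is tested: for [s] in the square, [z + s] has real
    part between [d] and [2 d] and imaginary part between 0 and [d], hence the
    real part of [1 / (z + s)] is at least [d / (5 d ^ 2)]. *)
Lemma carleson_of_test (mu : {measure set CC -> \bar R}) (p p' q : R) :
  p^-1 + p'^-1 = 1 -> 1 <= p -> 0 < p' -> 0 < q ->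
  (exists2 C : R, 0 < C & forall z : R[i], H z ->
     (cLnorm mu H q (laplace (exp_fun z)) <= C%:E * cLnorm leb P p (exp_fun z))%E) ->
  exists2 C : R, 0 < C & forall (l r : bool) (a b : R), a <= b ->
     (mu (carleson_square l r a b) <= (C * (b - a) `^ (q / p'))%:E)%E.
Proof.
move=> pp' p1 p'0 q0 [C C0 test]; have p0 : 0 < p by exact: lt_le_trans p1.
exists ((5 * C) `^ q * (p^-1 `^ p^-1) `^ q).
  by rewrite mulr_gt0 ?powR_gt0 ?invr_gt0// mulr_gt0.
move=> l r a b; rewrite le_eqVlt => /predU1P[<-|ab].
  rewrite (_ : carleson_square _ _ _ _ = set0) ?measure0 ?lee_fin ?mulr_ge0 ?powR_ge0//.
  by apply/seteqP; split => // z [_]; rewrite subrr => /andP[/lt_trans h /h]; rewrite ltxx.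
set Q := carleson_square l r a b; set d := b - a.
have d0 : 0 < d by rewrite subr_gt0.
pose z : R[i] := Complex d (- a).
have Hz : H z by [].
have fz := in_cLp_exp_fun p0 Hz.
have mL : measurable_fun H (fun s => (Normc.normc (laplace (exp_fun z) s) `^ q)%:E).
  apply/measurable_EFinP; apply: (measurableT_comp (measurable_powR _)).
  exact: (measurable_normc (measurable_laplace p1 fz)).
have QH : Q `<=` H by move=> s [_ /andP[]].
have mQ : measurable (Q : set CC) by exact: measurable_carleson_square.
have dp0 : 0 <= (p * d)^-1 `^ p^-1 by exact: powR_ge0.
have lowerb s : Q s -> (5 * d)^-1 <= Normc.normc (laplace (exp_fun z) s).
  move=> Qs; apply: le_trans (normr_Re_le _); apply: le_trans (ler_norm _).
  rewrite Re_laplace_exp_fun//; last exact: QH.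
  case: Qs; case: (s) => x y /=; rewrite in_itv => sab /andP[x0 xd].
  have [y0 yd] : 0 <= - a + y /\ - a + y <= d.
    move: sab; rewrite /d; case: (l); case: (r) => /=; lra.
  set X := d + x; set Y := - a + y.
  have X1 : d <= X by rewrite /X; lra.
  have X2 : X <= 2 * d by rewrite /X -/d in xd *; lra.
  have XY0 : 0 < X ^+ 2 + Y ^+ 2 by rewrite ltr_pwDl ?sqr_ge0// exprn_gt0// (lt_le_trans d0).
  rewrite ler_pdivlMr// mulrC ler_pdivrMr ?mulr_gt0//.
  have XX : X ^+ 2 <= 2 * d * X by rewrite expr2 ler_wpM2r// (le_trans (ltW d0)).
  have YY : Y ^+ 2 <= d * X by rewrite expr2 ler_pM// (le_trans yd).
  apply: (le_trans (lerD XX YY)); rewrite -mulrDl [leRHS]mulrC ler_wpM2r//.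
    by rewrite (le_trans (ltW d0)).
  by move: (ltW d0); lra.
have key : (((5 * d)^-1 `^ q)%:E * mu Q <= ((C * (p * d)^-1 `^ p^-1) `^ q)%:E)%E.
  rewrite -integral_cst//.
  have := test z Hz; rewrite cLnorm_exp_fun// -EFinM.
  move=> /(cLnorm_le _ _ _ q0 (mulr_ge0 (ltW C0) dp0)).1; apply: le_trans.
  apply: (@le_trans _ _ (\int[mu]_(s in Q) (Normc.normc (laplace (exp_fun z) s) `^ q)%:E)%E).
    apply: ge0_le_integral => //.
    - by move=> s _; rewrite lee_fin powR_ge0.
    - exact: (measurable_funS mH QH mL).
    - move=> s Qs; rewrite lee_fin ge0_ler_powR ?nnegrE ?normc_ge0 ?(ltW q0) ?lowerb//.
      by rewrite invr_ge0 mulr_ge0// ltW.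
  by apply: ge0_subset_integral => // s _; rewrite lee_fin powR_ge0.
have D0 : 0 < (5 * d)^-1 `^ q by rewrite powR_gt0// invr_gt0 mulr_gt0.
move: key; rewrite -lee_pdivlMl// => /le_trans; apply.
rewrite -EFinM lee_fin le_eqVlt; apply/orP; left; apply/eqP.
have d0' := ltW d0; have C0' := ltW C0; have pV0 : 0 <= p^-1 by rewrite invr_ge0 ltW.
have dV0 : 0 <= d^-1 by rewrite invr_ge0.
have c5 : 0 <= 5 :> R by rewrite ler0n.
have -> : ((5 * d)^-1 `^ q)^-1 = (5 * d) `^ q.
  by rewrite -(powR_inv1 (mulr_ge0 c5 d0')) -powRrM mulN1r powRN invrK.
rewrite (powRM _ C0' dp0) invfM (powRM _ pV0 dV0) (powRM _ (powR_ge0 _ _) (powR_ge0 _ _)).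
rewrite (powRM _ c5 d0') (powRM _ c5 C0').
have -> : d `^ (q / p') = d `^ q * (d^-1 `^ p^-1) `^ q.
  have -> : d^-1 `^ p^-1 = d `^ (- p^-1) by rewrite -(powR_inv1 d0') -powRrM mulN1r.
  rewrite -powRrM -powRD; last by rewrite (gt_eqF d0) implybT.
  by congr (_ `^ _); move: pp' => /(canRL (addKr _)) ->; ring.
move: (5 `^ q) (d `^ q) (C `^ q) ((p^-1 `^ p^-1) `^ q) ((d^-1 `^ p^-1) `^ q) => x1 x2 x3 x4 x5.
ring.
Qed.

End laplace_carleson.

Theorem theorem3p2 (R : realType) (mu : {measure set (borelC R) -> \bar R})
    (mu_supp : supported_in mu (@right_half_plane R))
    (mu_reg : regular_on mu (@right_half_plane R))
    (p p' q : R) (p_conj : p^-1 + p'^-1 = 1)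
    (p'_gt1 : 1 < p') (p'_le_q : p' <= q) (p_le2 : p <= 2) :
  [<-> laplace_well_defined mu p q /\ laplace_bounded mu p q;
       exists2 C : R, 0 < C &
         forall (l r : bool) (a b : R), a <= b ->
           (mu (carleson_square l r a b) <= (C * (b - a) `^ (q / p'))%:E)%E;
       exists2 C : R, 0 < C &
         forall z : R[i], @right_half_plane R z ->
           (cLnorm mu (@right_half_plane R) q (laplace (exp_fun z)) <=
            C%:E * cLnorm (@lebesgue_measure R) (@pos_halfline R) p
                     (exp_fun z))%E].
Proof.
have p'0 : 0 < p' by exact: lt_trans p'_gt1.
have q0 : 0 < q by exact: lt_le_trans p'_le_q.
have p1 : 1 < p.
  have pV : p^-1 = 1 - p'^-1 by rewrite -p_conj addrK.
  have p'V : p'^-1 < 1 by rewrite invf_lt1.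
  have p'V0 : 0 < p'^-1 by rewrite invr_gt0.
  have pV0 : 0 < p^-1 by rewrite pV subr_gt0.
  by rewrite -[p]invrK -(invr1 R) ltf_pV2 ?posrE// pV gtrBl.
have p0 : 0 < p by exact: lt_trans p1.
have p12 : 1 < p <= 2 by rewrite p1.
have embed := laplace_carleson_embedding mu_supp p_conj p12 p'0 p'_le_q.
have square := @carleson_of_test R mu p p' q p_conj (ltW p1) p'0 q0.
have test : laplace_bounded mu p q -> exists2 C : R, 0 < C &
    forall z : R[i], @right_half_plane R z ->
      (cLnorm mu (@right_half_plane R) q (laplace (exp_fun z)) <=
       C%:E * cLnorm (@lebesgue_measure R) (@pos_halfline R) p (exp_fun z))%E.
  by move=> [C C0 hC]; exists C => // z Hz; apply: hC; exact: in_cLp_exp_fun.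
by tfae=> [[_ /test/square]|/embed[_ /test]|/square/embed].
Qed.
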